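(* Let the mesh $\mathcal M$, the time step $\delta t>0$ and the final time $T$ be fixed. Let $(\varepsilon^{(m)})_{m\in\mathbb N}$ be a sequence of positive real numbers tending to zero. For each $m$ let $(\rho^{(m)},\boldsymbol u^{(m)})=(\rho^{(m),n},\boldsymbol u^{(m),n})_{0\le n\le N}$ be a corresponding solution of the compressible MAC pressure correction scheme (steps (S1)-(S5) of the context) with Mach number $\varepsilon=\varepsilon^{(m)}$ and well-prepared initial data $(\rho_0^{\varepsilon},\boldsymbol u_0^{\varepsilon})$, $\varepsilon=\varepsilon^{(m)}$, as described in the context. Let $\delta p^{(m)}=(\delta p^{(m),n})_{0\le n\le N}$ be the associated scaled zero-mean pressures. Then: 1. The sequence $(\rho^{(m)})_{m\in\mathbb N}$ converges to the constant function $\rho=1$ as $m\to+\infty$ in $\mathrm L^\infty((0,T),\mathrm L^q(\Omega))$, for all $q\in[1,\min(\gamma,2)]$. 2. The sequence $(\boldsymbol u^{(m)},\delta p^{(m)})_{m\in\mathbb N}$ tends, in any discrete norm, to the solution $(\boldsymbol u,\delta p)$ of the usual MAC pressure correction scheme for the incompressible Navier-Stokes equations, which reads, for $0\le n\le N-1$: Prediction step (solve for $\tilde{\boldsymbol u}^{n+1}$): for $1\le i\le d$ and all $\sigma\in\mathcal E_{\rm int}^{(i)}$, $$\frac1{\delta t}\bigl(\tilde u^{n+1}_{\sigma,i}-u^n_{\sigma,i}\bigr)+{\rm div}(\tilde u_i^{n+1}\boldsymbol u^n)_\sigma-{\rm div}\,\boldsymbol\tau(\tilde{\boldsymbol u}^{n+1})_{\sigma,i}+(\boldsymbol\nabla(\delta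 p)^n)_{\sigma,i}=0 .$$ Correction step (solve for $(\delta p)^{n+1}$ and $\boldsymbol u^{n+1}$): for $1\le i\le d$ and all $\sigma\in\mathcal E_{\rm int}^{(i)}$, $$\frac1{\delta t}\bigl(u^{n+1}_{\sigma,i}-\tilde u^{n+1}_{\sigma,i}\bigr)+(\boldsymbol\nabla(\delta p)^{n+1})_{\sigma,i}-(\boldsymbol\nabla(\delta p)^{n})_{\sigma,i}=0,$$ and for all $K\in\mathcal M$, $({\rm div}\,\boldsymbol u^{n+1})_K=0$. (Here all velocity fields vanish on external faces and each $(\delta p)^n$ has zero mean value over $\Omega$.)
   Context: **Domain and parameters.** $d\in\{2,3\}$, $\Omega\subset\mathbb R^d$ is a parallelepiped with faces orthogonal to the vectors $\boldsymbol e^{(1)},\dots,\boldsymbol e^{(d)}$ of the canonical basis, $T>0$, $\wp(\rho)=\rho^\gamma$ with $\gamma\ge1$, and $\mu,\lambda\in\mathbb R$ satisfy $\mu>0$, $\mu+\lambda>0$. $\varepsilon>0$ is the Mach number. **Mesh.** $\mathcal M$ is a MAC mesh: the Cartesian product of one-dimensional grids, giving a partition of $\Omega$ into rectangular (primal) cells $K$. $\mathcal E$ is the set of faces, $\mathcal E(K)$ the set of faces of $K$, $\mathcal E_{\rm ext}$ the set of faces included in $\partial\Omega$, $\mathcal E_{\rm int}=\mathcal E\setminus\mathcal E_{\rm ext}$; $\mathcal E^{(i)}$ is the set of faces orthogonal to $\boldsymbol e^{(i)}$, $\mathcal E^{(i)}_{\rm int}=\mathcal E_{\rm int}\cap\mathcal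 E^{(i)}$, $\mathcal E^{(i)}_{\rm ext}=\mathcal E_{\rm ext}\cap\mathcal E^{(i)}$. We write $\sigma=K|L$ for an internal face separating $K$ and $L$; $\boldsymbol n_{K,\sigma}$ is the unit normal to $\sigma$ outward $K$. For $\sigma\in\mathcal E(K)$, $D_{K,\sigma}$ is the half of $K$ adjacent to $\sigma$; the dual cell is $D_\sigma=D_{K,\sigma}\cup D_{L,\sigma}$ for $\sigma=K|L$, and $D_\sigma=D_{K,\sigma}$ for $\sigma\in\mathcal E_{\rm ext}\cap\mathcal E(K)$. For each $i$, the $D_\sigma$, $\sigma\in\mathcal E^{(i)}$, form a partition of $\Omega$. $\bar{\mathcal E}(D_\sigma)$ is the set of faces $\epsilon$ of $D_\sigma$ (dual faces), $\epsilon=D_\sigma|D_{\sigma'}$ denotes a dual face separating $D_\sigma$ and $D_{\sigma'}$, and $\boldsymbol n_{D_\sigma,\epsilon}$ is the unit normal to $\epsilon$ outward $D_\sigma$. $|\cdot|$ denotes the $d$- or $(d-1)$-dimensional measure. **Discrete fields.** A discrete density or pressure is a family $(\rho_K)_{K\in\mathcal M}$; a discrete velocity is a family $(u_{\sigma,i})_{\sigma\in\mathcal E^{(i)},1\le i\le d}$ with $u_{\sigma,i}=0$ for $\sigma\in\mathcal E^{(i)}_{\rm ext}$. **Mass fluxes and divergence.** $F_{K,\sigma}(\rho,\boldsymbol u)=0$ if $\sigma\in\mathcal E_{\rm ext}$, and $F_{K,\sigma}(\rho,\boldsymbol u)=|\sigma|\rho_\sigma u_{K,\sigma}$ for $\sigma=K|L\in\mathcal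 E^{(i)}_{\rm int}$, where $u_{K,\sigma}=u_{\sigma,i}\,\boldsymbol n_{K,\sigma}\cdot\boldsymbol e^{(i)}$ and $\rho_\sigma$ is upwind: $\rho_\sigma=\rho_K$ if $u_{K,\sigma}\ge0$, $\rho_\sigma=\rho_L$ otherwise. Then ${\rm div}(\rho\boldsymbol u)_K=\frac1{|K|}\sum_{\sigma\in\mathcal E(K)}F_{K,\sigma}(\rho,\boldsymbol u)$ and $({\rm div}\,\boldsymbol u)_K={\rm div}(1\times\boldsymbol u)_K$ (density identically 1). **Gradient.** For a discrete pressure $p=(p_K)_K$ and $\sigma=K|L\in\mathcal E_{\rm int}^{(i)}$: $(\boldsymbol\nabla p)_{\sigma,i}=\frac{|\sigma|}{|D_\sigma|}(p_L-p_K)\,\boldsymbol n_{K,\sigma}\cdot\boldsymbol e^{(i)}$. **Dual density.** For $\sigma=K|L$: $|D_\sigma|\rho_{D_\sigma}=|D_{K,\sigma}|\rho_K+|D_{L,\sigma}|\rho_L$. **Velocity convection.** For $\sigma\in\mathcal E^{(i)}_{\rm int}$, ${\rm div}(\rho v_i\boldsymbol u)_\sigma=\frac1{|D_\sigma|}\sum_{\epsilon\in\bar{\mathcal E}(D_\sigma)}F_{\sigma,\epsilon}(\rho,\boldsymbol u)\,v_{\epsilon,i}$, with $v_{\epsilon,i}=(v_{\sigma,i}+v_{\sigma',i})/2$ for $\epsilon=D_\sigma|D_{\sigma'}$. The dual fluxes are: zero if $\epsilon\subset\partial\Omega$; if $\boldsymbol e^{(i)}$ is normal to $\epsilon$, with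 $\epsilon$ included in the cell $K$ and $\sigma'$ the other face of $K$ normal to $\boldsymbol e^{(i)}$, $F_{\sigma,\epsilon}=\frac12\bigl(F_{K,\sigma}\,\boldsymbol n_{D_\sigma,\epsilon}\cdot\boldsymbol n_{K,\sigma}+F_{K,\sigma'}\,\boldsymbol n_{D_\sigma,\epsilon}\cdot\boldsymbol n_{K,\sigma'}\bigr)$; if $\boldsymbol e^{(i)}$ is tangent to $\epsilon$, then (with $\sigma=K|L$) $\epsilon$ is the union of halves of two primal faces $\tau\in\mathcal E(K)$, $\tau'\in\mathcal E(L)$, and $F_{\sigma,\epsilon}=\frac12(F_{K,\tau}+F_{L,\tau'})$. ${\rm div}(v_i\boldsymbol u)_\sigma$ denotes the same expression with $\rho\equiv1$. **Diffusion.** $\boldsymbol u\mapsto({\rm div}\,\boldsymbol\tau(\boldsymbol u)_{\sigma,i})_{\sigma\in\mathcal E_{\rm int}^{(i)},1\le i\le d}$ is a fixed linear operator on discrete velocities (the standard MAC discretization of $\mu\Delta\boldsymbol u+(\mu+\lambda)\boldsymbol\nabla{\rm div}\,\boldsymbol u$, depending only on $\mathcal M,\mu,\lambda$) which is coercive: $-\sum_{i=1}^d\sum_{\sigma\in\mathcal E_{\rm int}^{(i)}}|D_\sigma|u_{\sigma,i}\,{\rm div}\,\boldsymbol\tau(\boldsymbol u)_{\sigma,i}\ge\mu\|\boldsymbol u\|_{1,\mathcal M}^2$ for all discrete velocities. Here $\|\cdot\|_{1,\mathcal M}$ is the usual discrete $\mathrm H^1$ norm: $\|\boldsymbol u\|^2_{1,\mathcal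 M}=\sum_{i=1}^d\bigl[\sum_{\epsilon=D_\sigma|D_{\sigma'}}\frac{|\epsilon|}{d_\epsilon}(u_{\sigma,i}-u_{\sigma',i})^2+\sum_{\epsilon\subset\partial\Omega,\,\epsilon\in\bar{\mathcal E}(D_\sigma)}\frac{|\epsilon|}{d_\epsilon}u_{\sigma,i}^2\bigr]$, where the sums are over dual faces of the cells $D_\sigma$, $\sigma\in\mathcal E^{(i)}$, and $d_\epsilon$ is the distance between the centres of $\sigma,\sigma'$ (internal dual face), resp. between the centre of $\sigma$ and $\epsilon$ (boundary dual face); terms with $u_{\sigma,i}=0$, $\sigma\in\mathcal E_{\rm ext}^{(i)}$, $\epsilon\subset\partial\Omega$ are zero. **Initial data (well prepared).** For each $\varepsilon$: $\rho_0^\varepsilon>0$, $\rho_0^\varepsilon\in\mathrm L^\infty(\Omega)$, $\boldsymbol u_0^\varepsilon\in\mathrm H^1_0(\Omega)^d$, and there is $C$ independent of $\varepsilon$ such that $$\|\boldsymbol u_0^\varepsilon\|_{\mathrm H^1(\Omega)^d}+\tfrac1\varepsilon\|{\rm div}\,\boldsymbol u_0^\varepsilon\|_{\mathrm L^2(\Omega)}+\tfrac1{\varepsilon^2}\|\rho_0^\varepsilon-1\|_{\mathrm L^\infty(\Omega)}\le C.$$ Moreover $\boldsymbol u_0^\varepsilon$ converges in $\mathrm L^2(\Omega)^d$ to some $\bar{\boldsymbol u}_0\in\mathrm L^2(\Omega)^d$ as $\varepsilon\to0$. **Scheme.** $\delta t>0$ is a constant time step, $N=\lfloor T/\delta t\rfloor$,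 $t_n=n\delta t$. Initialization: $\rho_K^0=\frac1{|K|}\int_K\rho_0^\varepsilon$, $u^0_{\sigma,i}=\frac1{|\sigma|}\int_\sigma\boldsymbol u_0^\varepsilon\cdot\boldsymbol e^{(i)}$ for $\sigma\in\mathcal E^{(i)}_{\rm int}$, and $\rho^{-1}$ is given by $\frac1{\delta t}(\rho_K^0-\rho_K^{-1})+{\rm div}(\rho^0\boldsymbol u^0)_K=0$ (it is positive for $\varepsilon$ small, which is needed for the scheme to be defined). $p^n_K=\wp(\rho^n_K)$. A solution is a family $(\rho^n,\boldsymbol u^n)_{0\le n\le N}$ (with predicted velocities $\tilde{\boldsymbol u}^n$, $1\le n\le N$) with $\rho^n_K>0$ such that for $0\le n\le N-1$, all $1\le i\le d$, $\sigma\in\mathcal E_{\rm int}^{(i)}$, $K\in\mathcal M$: (S1) $(\overline{\boldsymbol\nabla p})^n_{\sigma,i}=\bigl(\rho^n_{D_\sigma}/\rho^{n-1}_{D_\sigma}\bigr)^{1/2}(\boldsymbol\nabla p^n)_{\sigma,i}$; (S2) $\frac1{\delta t}(\rho^n_{D_\sigma}\tilde u^{n+1}_{\sigma,i}-\rho^{n-1}_{D_\sigma}u^n_{\sigma,i})+{\rm div}(\rho^n\tilde u_i^{n+1}\boldsymbol u^n)_\sigma-{\rm div}\,\boldsymbol\tau(\tilde{\boldsymbol u}^{n+1})_{\sigma,i}+\frac1{\varepsilon^2}(\overline{\boldsymbol\nabla p})^n_{\sigma,i}=0$; (S3) $\frac1{\delta t}\rho^n_{D_\sigma}(u^{n+1}_{\sigma,i}-\tilde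 u^{n+1}_{\sigma,i})+\frac1{\varepsilon^2}(\boldsymbol\nabla p^{n+1})_{\sigma,i}-\frac1{\varepsilon^2}(\overline{\boldsymbol\nabla p})^n_{\sigma,i}=0$; (S4) $\frac1{\delta t}(\rho_K^{n+1}-\rho_K^n)+{\rm div}(\rho^{n+1}\boldsymbol u^{n+1})_K=0$; (S5) $p_K^{n+1}=\wp(\rho_K^{n+1})$. **Scaled pressure.** $\delta p^n_K=\varepsilon^{-2}\bigl(p^n_K-|\Omega|^{-1}\sum_{L\in\mathcal M}|L|p^n_L\bigr)$. **Conventions on convergence.** Discrete densities are identified with functions that are piecewise constant in space (on the cells $K$) and time (on the time steps), so convergence in $\mathrm L^\infty((0,T),\mathrm L^q(\Omega))$ means $\max_{0\le n\le N}\|\rho^{(m),n}-1\|_{\mathrm L^q(\Omega)}\to0$. Mesh and time step being fixed, convergence ''in any discrete norm'' is convergence of each of the finitely many discrete unknowns. The limit scheme is started from the values $(\boldsymbol u^0,(\delta p)^0)$ of the limit at $n=0$.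
   Formalization: In item 2 the initial scaled pressures need not converge for well-prepared data; convergence of (u, δp) to the incompressible solution is stated along every subsequence (or the whole sequence) for which δp at n=0 converges, and such subsequences are shown to exist. *)

(* Defs.v *)
From HB Require Import structures.
From mathcomp Require Export all_boot all_order all_algebra.
From mathcomp Require Export all_classical all_reals all_analysis.

Set Implicit Arguments.
Unset Strict Implicit.
Unset Printing Implicit Defensive.

Import Order.TTheory GRing.Theory Num.Theory.
Import numFieldNormedType.Exports.

Local Open Scope classical_set_scope.
Local Open Scope ring_scope.

Notation Rd R n := (n.-tuple (measurableTypeR R)).

Section lebesgue_Rn.
Variable R : realType.

Section step.
Variable n : nat.

Definition consp (p : measurableTypeR R * Rd R n) : Rd R n.+1 :=
  [tuple of p.1 :: p.2].

Lemma measurable_consp : measurable_fun [set: _] consp.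
Proof. exact: measurable_cons. Qed.

HB.instance Definition _ := isMeasurableFun.Build _ _ _ _ _ measurable_consp.

Variable m : {sigma_finite_measure set (Rd R n) -> \bar R}.

Definition leb_step : set (Rd R n.+1) -> \bar R :=
  pushforward (@lebesgue_measure R \x m)%E consp.

Let leb_step0 : leb_step set0 = 0%E.
Proof. exact: measure0. Qed.

Let leb_step_ge0 A : (0 <= leb_step A)%E.
Proof. exact: measure_ge0. Qed.

Let leb_step_sigma_additive : semi_sigma_additive leb_step.
Proof. exact: measure_semi_sigma_additive. Qed.

HB.instance Definition _ := isMeasure.Build _ _ _ leb_step
  leb_step0 leb_step_ge0 leb_step_sigma_additive.

Let leb_step_sigma_finite : sigma_finite setT leb_step.
Proof.
have /sigma_finiteP[F [TF ndF Foo]] := sigma_finiteT (@lebesgue_measure R).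
have /sigma_finiteP[G [TG ndG Goo]] := sigma_finiteT m.
pose g (x : Rd R n.+1) : measurableTypeR R * Rd R n :=
  (tnth x ord0, [tuple of behead x]).
have mg : measurable_fun [set: _] g.
  by apply/measurable_fun_pair; [exact: measurable_tnth
                                |exact: measurable_behead].
exists (fun k => g @^-1` (F k `*` G k)).
  apply/seteqP; split => // x _.
  have [k _ Fk] : (\bigcup_k F k) (g x).1 by rewrite -TF.
  have [l _ Gl] : (\bigcup_k G k) (g x).2 by rewrite -TG.
  exists (maxn k l) => //; split.
  - by move: Fk; exact/subsetPset/ndF/leq_maxl.
  - by move: Gl; exact/subsetPset/ndG/leq_maxr.
move=> k; have [mF Fk] := Foo k; have [mG Gk] := Goo k; split.
  by rewrite -[X in measurable X]setTI; apply: mg => //; exact: measurableX.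
rewrite /leb_step /pushforward -comp_preimage.
rewrite (_ : g \o consp = id); last first.
  by rewrite funeqE => -[a t] /=; congr (_, _); apply: val_inj.
rewrite preimage_id product_measure1E//.
by rewrite lte_mul_pinfty// ge0_fin_numE.
Qed.

HB.instance Definition _ := Measure_isSigmaFinite.Build _ _ _ leb_step
  leb_step_sigma_finite.

End step.

(* Lebesgue measure on R^n, as an iterated product measure. *)
Fixpoint leb n : {sigma_finite_measure set (Rd R n) -> \bar R} :=
  match n with
  | 0 => @dirac _ (Rd R 0) [tuple] R
  | k.+1 => leb_step (leb k)
  end.

End lebesgue_Rn.
Arguments leb {R} n.

Section function_spaces.
Variables (R : realType) (n : nat).
Implicit Types (D : set (Rd R n)) (f g : Rd R n -> R) (p : \bar R).

Definition LpN D p f : \bar R := Lnorm (leb n) p (EFin \o (f \_ D)).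

Definition Lp D p f := measurable_fun D f /\ (LpN D p f < +oo)%E.

(* Derivatives are taken in the normed space 'rV[R]_n, measures live on
   n-tuples; [pt] identifies the two. *)
Definition pt (x : Rd R n) : 'rV[R]_n := \row_j tnth x j.

Definition partial (j : 'I_n) (phi : 'rV[R]_n -> R) : 'rV[R]_n -> R :=
  'D_(delta_mx 0 j) phi.

Definition smooth (phi : 'rV[R]_n -> R) := forall s : seq 'I_n,
  let psi := foldr partial phi s in
  continuous psi /\ forall j x, derivable psi x (delta_mx 0 j).

Definition test_function D (phi : 'rV[R]_n -> R) :=
  smooth phi /\ exists K : set 'rV[R]_n,
    [/\ compact K, K `<=` pt @` D & forall x, ~ K x -> phi x = 0].

Definition weak_partial D (j : 'I_n) f g := forall phi, test_function D phi ->
  \int[leb n]_(x in D) (f x * partial j phi (pt x)) =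
  - \int[leb n]_(x in D) (g x * phi (pt x)).

Definition inH1 D f (Df : 'I_n -> Rd R n -> R) :=
  Lp D 2%:E f /\ forall j, Lp D 2%:E (Df j) /\ weak_partial D j f (Df j).

Definition H1_cvg D (phi_ : nat -> 'rV[R]_n -> R) f
    (Df : 'I_n -> Rd R n -> R) :=
  LpN D 2%:E (fun x => phi_ k (pt x) - f x) @[k --> \oo] --> 0%E /\
  forall j,
    LpN D 2%:E (fun x => partial j (phi_ k) (pt x) - Df j x) @[k --> \oo]
      --> 0%E.

Definition inH10 D f (Df : 'I_n -> Rd R n -> R) :=
  inH1 D f Df /\ exists2 phi_ : nat -> 'rV[R]_n -> R,
    forall k, test_function D (phi_ k) & H1_cvg D phi_ f Df.

(* H^1(D)^n norm of the field [v], of weak gradient [Dv]. *)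
Definition H1N D (v : 'I_n -> Rd R n -> R) (Dv : 'I_n -> 'I_n -> Rd R n -> R)
    : \bar R :=
  ((\sum_(i < n) (LpN D 2%:E (v i) ^+ 2 +
      \sum_(j < n) LpN D 2%:E (Dv i j) ^+ 2)) `^ 2^-1)%E.

End function_spaces.

Section trace.
Variables (R : realType) (n : nat) (i : 'I_n).

(* The point of the hyperplane x_i = a with other coordinates y. *)
Definition hyperplane_pt (a : R) (y : Rd R n.-1) : Rd R n :=
  [tuple oapp (tnth y) (a : measurableTypeR R) (unlift i j) | j < n].

(* [g] is the trace of [f] (with weak gradient [Df]) on the subset of the
   hyperplane x_i = a parametrized by [S]: the trace operator is the continuous
   extension to H^1 of the restriction of smooth functions. *)
Definition is_trace (D : set (Rd R n)) (f : Rd R n -> R)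
    (Df : 'I_n -> Rd R n -> R) (a : R) (S : set (Rd R n.-1))
    (g : Rd R n.-1 -> R) :=
  Lp S 2%:E g /\ exists phi_ : nat -> 'rV[R]_n -> R,
    [/\ forall k, smooth (phi_ k), H1_cvg D phi_ f Df &
        LpN S 2%:E (fun y => phi_ k (pt (hyperplane_pt a y)) - g y)
          @[k --> \oo] --> 0%E].

End trace.

Record mac_mesh (R : realType) (d : nat) := MacMesh {
  ncells : 'I_d -> nat;
  grid : 'I_d -> nat -> R;
  ncells_gt0 : forall i, (0 < ncells i)%N;
  grid_lt : forall i k, (k < ncells i)%N -> grid i k < grid i k.+1 }.

Section mesh.
Variables (R : realType) (d : nat) (M : mac_mesh R d).

Definition cell := {dffun forall j : 'I_d, 'I_(ncells M j)}.

(* [face i] is the set of faces orthogonal to e^(i): there is one more of them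
   than cells in direction i; the face of index k lies on x_i = grid i (k i). *)
Definition face (i : 'I_d) := {dffun forall j : 'I_d, 'I_(ncells M j + (j == i))}.

Definition density := cell -> R.
Definition velocity := forall i : 'I_d, face i -> R.

Lemma face_of_subproof (K : cell) (i j : 'I_d) (b : bool) :
  (K j + (b && (j == i)) < ncells M j + (j == i))%N.
Proof.
by rewrite -addSn leq_add//; case: b; case: (j == i).
Qed.

(* The face of K orthogonal to e^(i), on the side of e^(i) (b = true) or of
   - e^(i) (b = false); its outward normal is (sgn b) e^(i). *)
Definition face_of (K : cell) (i : 'I_d) (b : bool) : face i :=
  [ffun j => Ordinal (face_of_subproof K i j b)].

Definition sgn (b : bool) : R := if b then 1 else -1.

(* The cell adjacent to s on the side of (sgn b) e^(i), if any. *)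
Definition side i (s : face i) (b : bool) : option cell :=
  [pick K | face_of K i (~~ b) == s].

Definition internal i (s : face i) : bool := side s false && side s true.

(* The face s' of E^(i) such that D_s' is adjacent to D_s on the side of
   (sgn b) e^(j), if any. *)
Definition dual_nb i (s : face i) (j : 'I_d) (b : bool) : option (face i) :=
  [pick s' : face i | [forall l : 'I_d,
     (s' l + (~~ b && (l == j)) == s l + (b && (l == j)))%N]].

Definition Omega : set (Rd R d) :=
  [set x | forall j, grid M j 0 < (tnth x j : R) < grid M j (ncells M j)].

(* The cells are half-open so as to form a partition of Omega. *)
Definition cell_set (K : cell) : set (Rd R d) :=
  [set x | Omega x /\
     forall j, grid M j (K j) <= (tnth x j : R) < grid M j (K j).+1].

Definition face_set i (s : face i) : set (Rd R d.-1) :=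
  [set y | forall l : 'I_d.-1, let j := lift i l in
     grid M j (s j) < (tnth y l : R) < grid M j (s j).+1].

Definition piecewise (rho : density) (x : Rd R d) : R :=
  \sum_(K : cell) rho K * \1_(cell_set K) x.

Definition width (j : 'I_d) (k : nat) : R := grid M j k.+1 - grid M j k.

Definition vol (K : cell) : R := \prod_j width j (K j).

Definition vol_Omega : R := \prod_j (grid M j (ncells M j) - grid M j 0).

Definition area i (s : face i) : R := \prod_(j | j != i) width j (s j).

(* |D_{K,s}| is [vol K / 2]. *)
Definition dual_vol i (s : face i) : R :=
  \sum_(b : bool) if side s b is Some K then vol K / 2 else 0.

(* Extent of D_s in the direction e^(i). *)
Definition dual_width i (s : face i) : R :=
  \sum_(b : bool) if side s b is Some K then width i (K i) / 2 else 0.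

(* |epsilon|, for the dual faces of D_s orthogonal to e^(j). *)
Definition dual_area i (s : face i) (j : 'I_d) : R :=
  if j == i then area s
  else dual_width s * \prod_(l | (l != i) && (l != j)) width l (s l).

(* d_epsilon, for the dual face of D_s of outward normal (sgn b) e^(j). *)
Definition dual_dist i (s : face i) (j : 'I_d) (b : bool) : R :=
  if j == i then (if side s b is Some K then width i (K i) else 0)
  else if dual_nb s j b is Some s' then (width j (s j) + width j (s' j)) / 2
  else width j (s j) / 2.

Definition discrete_velocity (u : velocity) :=
  forall i (s : face i), ~~ internal s -> u i s = 0.

(* F_{K,s}(rho,u) for s = face_of K i b. *)
Definition flux (rho : density) (u : velocity) (K : cell) i b : R :=
  let s := face_of K i b in
  if side s b is Some L then
    let uKs := u i s * sgn b in
    area s * (if 0 <= uKs then rho K else rho L) * uKs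
  else 0.

Definition div_mass (rho : density) (u : velocity) (K : cell) : R :=
  (vol K)^-1 * \sum_(i < d) \sum_(b : bool) flux rho u K i b.

Definition divergence (u : velocity) : cell -> R := div_mass (fun=> 1) u.

(* For s = K|L with K on the side of - e^(i), so that n_{K,s} = e^(i). *)
Definition grad (p : density) i (s : face i) : R :=
  match side s false, side s true with
  | Some K, Some L => area s / dual_vol s * (p L - p K)
  | _, _ => 0
  end.

Definition dual_density (rho : density) i (s : face i) : R :=
  (dual_vol s)^-1 *
  \sum_(b : bool) if side s b is Some K then vol K / 2 * rho K else 0.

(* F_{s,epsilon}(rho,u), for the dual face of D_s of outward normal
   (sgn b) e^(j). *)
Definition dual_flux (rho : density) (u : velocity) i (s : face i) j b : R :=
  if j == i then
    if side s b is Some K then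
      (flux rho u K i (~~ b) * (sgn b * sgn (~~ b)) +
       flux rho u K i b * (sgn b * sgn b)) / 2
    else 0
  else
    match side s false, side s true with
    | Some K, Some L => (flux rho u K j b + flux rho u L j b) / 2
    | _, _ => 0
    end.

(* div(rho v_i u)_s; a dual face with no neighbouring dual cell lies on the
   boundary, where the flux is zero. *)
Definition convection (rho : density) (v u : velocity) i (s : face i) : R :=
  (dual_vol s)^-1 * \sum_(j < d) \sum_(b : bool)
    if dual_nb s j b is Some s' then
      dual_flux rho u s j b * ((v i s + v i s') / 2)
    else 0.

(* Each internal dual face is counted once, from the dual cell D_s such that its
   outward normal is e^(j). *)
Definition h1norm_sq (u : velocity) : R :=
  \sum_(i < d) \sum_(s : face i) \sum_(j < d)
    ((if dual_nb s j true is Some s' then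
        dual_area s j / dual_dist s j true * (u i s - u i s') ^+ 2
      else 0) +
     \sum_(b : bool)
       if dual_nb s j b is None then
         dual_area s j / dual_dist s j b * u i s ^+ 2
       else 0).

(* The diffusion operator enters only as a linear coercive operator; its values
   on external faces are irrelevant. *)
Definition linear_diffusion (divtau : velocity -> velocity) :=
  forall (a : R) (u v : velocity),
    discrete_velocity u -> discrete_velocity v ->
    forall i (s : face i), internal s ->
      divtau (fun k t => a * u k t + v k t) i s =
      a * divtau u i s + divtau v i s.

Definition coercive_diffusion (mu : R) (divtau : velocity -> velocity) :=
  forall u : velocity, discrete_velocity u ->
    mu * h1norm_sq u <=
    - \sum_(i < d) \sum_(s : face i | internal s)
        dual_vol s * u i s * divtau u i s.

(* [Du0 eps i j] is the j-th weak partial derivative of the i-th component of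
   [u0 eps]. *)
Definition well_prepared (rho0 : R -> Rd R d -> R)
    (u0 : R -> 'I_d -> Rd R d -> R) (Du0 : R -> 'I_d -> 'I_d -> Rd R d -> R)
    (ubar0 : 'I_d -> Rd R d -> R) :=
  [/\ forall eps, 0 < eps ->
        [/\ {ae leb d, forall x, Omega x -> 0 < rho0 eps x},
            Lp Omega +oo%E (rho0 eps) &
            forall i, inH10 Omega (u0 eps i) (Du0 eps i)],
      exists C : R, forall eps, 0 < eps ->
        (H1N Omega (u0 eps) (Du0 eps) +
         (eps^-1)%:E * LpN Omega 2%:E (fun x => \sum_(i < d) Du0 eps i i x)%R +
         ((eps ^+ 2)^-1)%:E * LpN Omega +oo (fun x => rho0 eps x - 1)%R
           <= C%:E)%E &
      forall i, Lp Omega 2%:E (ubar0 i) /\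
        LpN Omega 2%:E (fun x => u0 eps i x - ubar0 i x) @[eps --> 0^'+]
          --> 0%E].

Definition pressure (gamma : R) (rho : density) : density :=
  fun K => rho K `^ gamma.

Definition scaled_pressure (gamma eps : R) (rho : density) : density := fun K =>
  (eps ^+ 2)^-1 * (pressure gamma rho K -
     vol_Omega^-1 * \sum_(L : cell) vol L * pressure gamma rho L).

Definition initial_density (rho0 : Rd R d -> R) (rho : density) :=
  forall K, rho K = (vol K)^-1 * \int[leb d]_(x in cell_set K) rho0 x.

Definition initial_velocity (u0 : 'I_d -> Rd R d -> R)
    (Du0 : 'I_d -> 'I_d -> Rd R d -> R) (u : velocity) :=
  discrete_velocity u /\
  forall i (s : face i), internal s ->
    exists2 g : Rd R d.-1 -> R,
      is_trace i Omega (u0 i) (Du0 i) (grid M i (s i)) (face_set s) g &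
      u i s = (area s)^-1 * \int[leb d.-1]_(y in face_set s) g y.

Definition corrected_grad (gamma : R) (rhoprev rho : density) i (s : face i) :=
  Num.sqrt (dual_density rho s / dual_density rhoprev s) *
  grad (pressure gamma rho) s.

Definition prev_density (rhom1 : density) (rho : nat -> density) (n : nat) :=
  if n is k.+1 then rho k else rhom1.

(* [rhom1] is rho^{-1} and [ut] is the sequence of predicted velocities. No
   positivity is required of [rhom1]: with well-prepared data it is positive as
   soon as eps is small enough. *)
Definition compressible_solution (gamma : R) (divtau : velocity -> velocity)
    (dt : R) (N : nat) (eps : R) (rho0 : Rd R d -> R)
    (u0 : 'I_d -> Rd R d -> R) (Du0 : 'I_d -> 'I_d -> Rd R d -> R)
    (rho : nat -> density) (u : nat -> velocity) :=
  exists (rhom1 : density) (ut : nat -> velocity),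
  [/\ [/\ initial_density rho0 (rho 0%N),
          initial_velocity u0 Du0 (u 0%N) &
          forall K,
            dt^-1 * (rho 0%N K - rhom1 K) + div_mass (rho 0%N) (u 0%N) K = 0],
      forall n, (n <= N)%N ->
        discrete_velocity (u n) /\ forall K, 0 < rho n K,
      forall n, (n < N)%N -> discrete_velocity (ut n.+1) &
      forall n, (n < N)%N ->
      let rhop := prev_density rhom1 rho n in
      [/\ forall i (s : face i), internal s ->
            dt^-1 * (dual_density (rho n) s * ut n.+1 i s -
                     dual_density rhop s * u n i s) +
            convection (rho n) (ut n.+1) (u n) s -
            divtau (ut n.+1) i s +
            (eps ^+ 2)^-1 * corrected_grad gamma rhop (rho n) s = 0,
          forall i (s : face i), internal s ->
            dt^-1 * (dual_density (rho n) s * (u n.+1 i s - ut n.+1 i s)) +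
            (eps ^+ 2)^-1 * grad (pressure gamma (rho n.+1)) s -
            (eps ^+ 2)^-1 * corrected_grad gamma rhop (rho n) s = 0 &
          forall K,
            dt^-1 * (rho n.+1 K - rho n K) +
            div_mass (rho n.+1) (u n.+1) K = 0]].

Definition incompressible_solution (divtau : velocity -> velocity)
    (dt : R) (N : nat) (u : nat -> velocity) (dp : nat -> density) :=
  exists ut : nat -> velocity,
  [/\ forall n, (n <= N)%N ->
        discrete_velocity (u n) /\ \sum_(K : cell) vol K * dp n K = 0,
      forall n, (n < N)%N -> discrete_velocity (ut n.+1) &
      forall n, (n < N)%N ->
      [/\ forall i (s : face i), internal s ->
            dt^-1 * (ut n.+1 i s - u n i s) +
            convection (fun=> 1) (ut n.+1) (u n) s -
            divtau (ut n.+1) i s + grad (dp n) s = 0,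
          forall i (s : face i), internal s ->
            dt^-1 * (u n.+1 i s - ut n.+1 i s) +
            grad (dp n.+1) s - grad (dp n) s = 0 &
          forall K, divergence (u n.+1) K = 0]].

End mesh.

Arguments face {R d} M i.
Arguments Omega {R d} M.

(* Main.v *)
Require Import Defs.
From mathcomp Require Import ring lra measurable_realfun.
Import Order.TTheory GRing.Theory Num.Theory.
Import numFieldNormedType.Exports.
Local Open Scope classical_set_scope.
Local Open Scope ring_scope.

Set Implicit Arguments.
Unset Strict Implicit.
Unset Printing Implicit Defensive.

(** The low Mach number limit of the pressure correction scheme, on a fixed mesh and with
a fixed time step.

The discrete unknowns are finitely many, so the theorem is about the limit of a finite
sequence of algebraic systems, and it is proved by induction on the time index n. What is
propagated is: the densities of the steps n - 1 and n tend to 1, the velocities of step n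
tend to a discretely divergence-free field, and the scaled pressures of step n converge
([time_step_cvg], [scheme_cvg]).

The prediction step is a linear system whose operator converges. The limit operator is
injective by the energy identity: the dual fluxes are antisymmetric, hence the convection
does no work when the advecting field is divergence free, and the diffusion is coercive
([momentum_coercive], [prediction_inj]). Cramer's rule then gives the convergence of the
predicted velocities, without any bound on them beforehand ([cvg_linear_system]).

The correction step is nonlinear, and the point is to show that the oscillation of the
new pressure is O(eps^2) although nothing is known on the new density
([pressure_oscillation]). If the oscillation were much larger, the pressure values would
skip an interval of length proportional to eps^2. Across the faces that separate the
cells above this gap from those below, the pressure force pushes the fluid out of the
high pressure region with a large velocity; upwinding then makes this region lose more
mass than it contains. Since the mean density is conserved, the bound on the oscillation
forces the new density to tend to 1. The scaled pressure gradients are thus bounded, the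
mass balance yields a divergence that tends to zero, and the scaled pressure appears as
the solution of a discrete Poisson problem, which is invertible because the mesh is
connected and the mean value is prescribed ([pressure_op_inj], [correction_cvg]). The
same two injectivity properties give the uniqueness of the limit
([incompressible_unique]).

The induction starts from the initial data. The density is at distance O(eps^2) of 1 by
the uniform bound on the data, so the scaled initial pressures are bounded: they converge
along subsequences, and this is why the densities are first shown to converge along
subsequences of any subsequence. The face values of the initial velocity are means of
traces. An integration by parts against an affine weight expresses the mean of a trace by
integrals over a slab adjacent to the face ([trace_slab]). Applied to thin slabs, this
formula shows that the face values converge, since the velocities converge in L2 and are
bounded in H^1 ([initial_face_value_cvg]); applied to the two opposite faces of a cell, it
gives the divergence theorem ([cell_flux]), so that the discrete divergence of the initial
velocity is O(eps). *)

(** * Combinatorics of the mesh and summation by parts *)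

Section mac_combinatorics.
Variables (R : realType) (d : nat) (M : mac_mesh R d).
Implicit Types (K L : cell M) (i j : 'I_d) (b : bool).

Lemma face_ofE K i b j : face_of K i b j = (K j + (b && (j == i)))%N :> nat.
Proof. by rewrite ffunE. Qed.

Lemma face_of_inj i b : injective (fun K => face_of K i b).
Proof.
move=> K L KL; apply/ffunP => j; apply: val_inj.
have := face_ofE K i b j; rewrite KL face_ofE => /eqP.
by rewrite eqn_add2r => /eqP.
Qed.

Lemma sideP i (s : face M i) b K : side s b = Some K <-> face_of K i (~~ b) = s.
Proof.
rewrite /side; case: pickP => [L /eqP sL|no]; split.
- by case=> <-.
- by move=> sK; congr Some; apply: (@face_of_inj i (~~ b)); rewrite sL.
- by [].
- by move=> sK; move: (no K); rewrite sK eqxx.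
Qed.

Lemma side_face_of K i b : side (face_of K i b) (~~ b) = Some K.
Proof. by apply/sideP; rewrite negbK. Qed.

Lemma big_side i b (H : cell M -> R) :
  \sum_K H K = \sum_(s : face M i) oapp H 0 (side s b).
Proof.
rewrite (partition_big (fun K => face_of K i (~~ b)) xpredT)//=.
apply: eq_bigr => s _; case E: (side s b) => [K|]/=.
  rewrite (big_pred1 K)// => L /=; move/sideP: E => <-.
  exact: (inj_eq (@face_of_inj i (~~ b))).
rewrite big_pred0// => L; apply/negP => /eqP/sideP.
by rewrite E.
Qed.

Lemma internalP i (s : face M i) : reflect
  (exists K L, side s false = Some K /\ side s true = Some L) (internal s).
Proof.
rewrite /internal; apply: (iffP andP).
- case: (side s false) => [K|[]//]; case: (side s true) => [L|[_]//] _.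
  by exists K, L.
- by move=> [K [L [-> ->]]].
Qed.

Lemma internal_face_of K i b : internal (face_of K i b) = side (face_of K i b) b.
Proof.
by rewrite /internal; have := side_face_of K i b; case: b => /= ->; rewrite ?andbT.
Qed.

Lemma width_gt0 j k : (k < ncells M j)%N -> 0 < width M j k.
Proof. by move=> ?; rewrite subr_gt0 grid_lt. Qed.

Lemma vol_gt0 K : 0 < vol K.
Proof. by apply: prodr_gt0 => j _; exact: width_gt0. Qed.

Lemma area_gt0 i (s : face M i) : 0 < area s.
Proof.
apply: prodr_gt0 => j ji; apply: width_gt0.
suff {2}<- : (ncells M j + (j == i) = ncells M j)%N by [].
by rewrite (negbTE ji) addn0.
Qed.

Lemma dual_vol_ge0 i (s : face M i) : 0 <= dual_vol s.
Proof.
apply: sumr_ge0 => b _; case: side => // K; by rewrite divr_ge0// ltW// vol_gt0.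
Qed.

Lemma dual_vol_gt0 i (s : face M i) : internal s -> 0 < dual_vol s.
Proof.
move/internalP => [K [L [sK sL]]].
by rewrite /dual_vol big_bool /= sK sL addr_gt0// divr_gt0// vol_gt0.
Qed.

Definition jump (f : cell M -> R) i (s : face M i) : R :=
  match side s false, side s true with
  | Some K, Some L => f L - f K
  | _, _ => 0
  end.

Lemma jump_external f i (s : face M i) : ~~ internal s -> jump f s = 0.
Proof.
by rewrite /internal /jump; case: side => // K; case: side.
Qed.

Lemma gradE p i (s : face M i) : grad p s = area s / dual_vol s * jump p s.
Proof.
by rewrite /grad /jump; case: side => [K|]; [case: side => [L|]|]; rewrite ?mulr0.
Qed.

Lemma dual_vol_grad p i (s : face M i) : dual_vol s * grad p s = area s * jump p s.
Proof.
have [si|se] := boolP (internal s); last by rewrite gradE jump_external// !mulr0.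
by rewrite gradE mulrA mulrCA divff ?mulr1// gt_eqF// dual_vol_gt0.
Qed.

(** The mass flux through a face in the direction of its positive normal: the
fluxes seen from both sides are this number and its opposite. *)
Definition face_flux (rho : density M) (u : velocity M) i (s : face M i) : R :=
  match side s false, side s true with
  | Some K, Some L => area s * (if 0 <= u i s then rho K else rho L) * u i s
  | _, _ => 0
  end.

Lemma fluxE rho u K i b :
  flux rho u K i b = sgn R b * face_flux rho u (face_of K i b).
Proof.
rewrite /flux /face_flux; have := side_face_of K i b.
case: b => /= ->; case: side => [L|]; rewrite ?mulr0 ?mulr1 ?mul1r ?mulN1r//.
rewrite mulrN1 oppr_ge0 mulrN; congr (- _).
set x := u _ _; case: ltgtP => [x0|x0|->]; rewrite ?mulr0//.
Qed.

Lemma face_flux1 u i (s : face M i) :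
  face_flux (fun=> 1) u s = if internal s then area s * u i s else 0.
Proof.
rewrite /face_flux /internal; case: side => [K|]//; case: side => [L|]//=.
by rewrite if_same mulr1.
Qed.

(** Discrete integration by parts: each internal face is met twice, once from each side
and with opposite fluxes. *)
Lemma sum_div_mass rho u (f : cell M -> R) :
  \sum_K vol K * f K * div_mass rho u K =
  - \sum_i \sum_(s : face M i) face_flux rho u s * jump f s.
Proof.
under eq_bigr => K _.
  rewrite /div_mass (mulrC (vol K)) -mulrA mulVKf ?gt_eqF ?vol_gt0// mulr_sumr.
  over.
rewrite exchange_big /= -sumrN; apply: eq_bigr => i _.
under eq_bigr do rewrite big_bool !fluxE mul1r mulN1r mulrDr mulrN.
rewrite big_split sumrN /= (big_side i false) (big_side i true) -sumrB -sumrN.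
apply: eq_bigr => s _; rewrite /jump /face_flux.
case E1: (side s false) => [K|]; case E2: (side s true) => [L|] /=.
- move/sideP: (E1) => ->; move/sideP: (E2) => ->; rewrite E1 E2; ring.
- by move/sideP: (E1) => ->; rewrite ?E1 ?E2 ?mulr0 ?mul0r ?oppr0 ?subr0 ?addr0.
- by move/sideP: (E2) => ->; rewrite ?E1 ?E2 ?mulr0 ?mul0r ?oppr0 ?subr0 ?addr0.
- by rewrite ?mulr0 ?oppr0 ?addr0.
Qed.

Lemma sum_divergence u (p : density M) : discrete_velocity u ->
  \sum_K vol K * p K * divergence u K =
  - \sum_i \sum_(s : face M i) dual_vol s * u i s * grad p s.
Proof.
move=> du; rewrite sum_div_mass; congr (- _); apply: eq_bigr => i _.
apply: eq_bigr => s _; rewrite face_flux1 mulrAC dual_vol_grad.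
by case: ifPn => [_|/du ->]; rewrite ?mulr0 ?mul0r//; ring.
Qed.

Lemma sum_div_mass0 (rho : density M) (u : velocity M) : \sum_K vol K * div_mass rho u K = 0.
Proof.
transitivity (\sum_K vol K * 1 * div_mass rho u K).
  by apply: eq_bigr => K _; rewrite mulr1.
rewrite sum_div_mass big1 ?oppr0// => i _; rewrite big1// => s _.
by rewrite /jump; case: side => [?|]; [case: side => [?|]|]; rewrite ?subrr ?mulr0.
Qed.

(** Connectedness of the mesh: from any cell one reaches the corner cell by
decreasing the indices one at a time. *)
Lemma cell_connected (P : cell M -> Prop) :
  (forall i (s : face M i) K L, side s false = Some K -> side s true = Some L ->
     P K <-> P L) ->
  forall K L, P K -> P L.
Proof.
move=> PP; pose O : cell M := [ffun j => Ordinal (ncells_gt0 M j)].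
suff PO K : P K <-> P O by move=> K L /PO PK; apply/PO.
have [n] := ubnP (\sum_j K j)%N; elim: n K => // n IH K Kn.
have [/existsP[i Ki]|] := boolP [exists i, K i != 0%N :> nat]; last first.
  rewrite negb_exists => /forallP K0.
  suff -> : K = O by [].
  apply/ffunP => j; apply: val_inj; rewrite ffunE /=.
  by have /negPn/eqP := K0 j.
have ltK j : (K j - (j == i) < ncells M j)%N.
  by rewrite (leq_ltn_trans (leq_subr _ _)).
pose K' : cell M := [ffun j => Ordinal (ltK j)].
have e : face_of K' i true = face_of K i false.
  apply/ffunP => j; apply: ord_inj; rewrite !face_ofE /= addn0 ffunE /= subnK//.
  by case: eqP => // ->; rewrite lt0n.
have K'K : P K' <-> P K.
  apply: (PP i (face_of K i false)); last exact: side_face_of.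
  by rewrite -e; exact: side_face_of.
rewrite -K'K; apply: IH.
have -> : (\sum_j K' j = (\sum_j K j).-1)%N; last first.
  by rewrite (leq_trans _ (Kn : (_ <= n)%N))// prednK// lt0n sum_nat_eq0 negb_forall;
    apply/existsP; exists i.
rewrite (bigD1 i)//= [in RHS](bigD1 i)//= ffunE /= eqxx -[in RHS]subn1.
rewrite -addnBAC ?lt0n//; congr (_ + _)%N.
by apply: eq_bigr => j /negbTE ji; rewrite ffunE /= ji subn0.
Qed.

Lemma cell_inhab : cell M.
Proof. exact: [ffun j => Ordinal (ncells_gt0 M j)]. Qed.

Lemma jump0_const (f : cell M -> R) :
  (forall i (s : face M i), internal s -> jump f s = 0) -> forall K L, f K = f L.
Proof.
move=> f0 K L; suff: f L = f K by [].
apply: (@cell_connected (fun L => f L = f K)) (erefl (f K)) => i s K1 K2 s1 s2.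
have /= := f0 i s; rewrite /internal /jump s1 s2 => /(_ isT)/eqP.
by rewrite subr_eq0 => /eqP ->.
Qed.

(** With telescoping factors, this says that the cells partition the domain, at the level
of measures ([sum_vol]) and at the level of indicator functions ([cell_indic_sum]). *)
Lemma sum_cell_prod (h : 'I_d -> nat -> R) :
  \sum_(K : cell M) \prod_j h j (K j) = \prod_j \sum_(k < ncells M j) h j k.
Proof.
pose n := \max_j ncells M j.
have nM j : (ncells M j <= n)%N by rewrite /n; exact: leq_bigmax.
under [RHS]eq_bigr => j _ do rewrite (big_ord_widen n (h j) (nM j)).
rewrite bigA_distr_big_dep.
pose f K : {ffun 'I_d -> 'I_n} := [ffun j => widen_ord (nM j) (K j)].
rewrite (reindex f) /=.
  apply: eq_big => [K|K _]; last by apply: eq_bigr => j _; rewrite ffunE.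
  by symmetry; apply/familyP => j; rewrite ffunE; exact: (ltn_ord (K j)).
pose g (t : {ffun 'I_d -> 'I_n}) : cell M :=
  [ffun j => insubd (Ordinal (ncells_gt0 M j)) (t j : nat)].
exists g => [K _|t].
  by apply/ffunP => j; apply: val_inj; rewrite !ffunE /= insubdK//; exact: (ltn_ord (K j)).
move=> /familyP tP; apply/ffunP => j; apply: val_inj; rewrite !ffunE /= insubdK//.
exact: tP.
Qed.

Lemma sum_vol : \sum_(K : cell M) vol K = vol_Omega M.
Proof.
rewrite (sum_cell_prod (@width _ _ M)); apply: eq_bigr => j _.
by rewrite -(big_mkord xpredT (width M j)) (@telescope_sumr_eq _ _ _ (grid M j)).
Qed.

Lemma vol_Omega_gt0 : 0 < vol_Omega M.
Proof.
rewrite -sum_vol (bigD1 cell_inhab)//= ltr_wpDr ?vol_gt0// sumr_ge0// => K _.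
exact/ltW/vol_gt0.
Qed.

End mac_combinatorics.

(** * Dual mesh and the energy balance of the convection term *)

Section dual_mesh.
Variables (R : realType) (d : nat) (M : mac_mesh R d).
Implicit Types (K L : cell M) (i j : 'I_d) (b : bool).

Definition dual_adjacent i (s : face M i) j b (s' : face M i) : bool :=
  [forall l : 'I_d, (s' l + (~~ b && (l == j)) == s l + (b && (l == j)))%N].

Lemma dual_adjacentC i (s s' : face M i) j b :
  dual_adjacent s j b s' = dual_adjacent s' j (~~ b) s.
Proof.
by apply/forallP/forallP => h l; rewrite eq_sym ?negbK// -[b]negbK -eqbF_neg ?eqbF_neg;
  have := h l; rewrite ?negbK.
Qed.

Lemma dual_nbP i (s : face M i) j b s' :
  dual_nb s j b = Some s' <-> dual_adjacent s j b s'.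
Proof.
rewrite /dual_nb; case: pickP => [t st|no]; split.
- by case=> <-.
- move=> ss'; congr Some; apply/ffunP => l; apply: ord_inj.
  move/forallP: st => /(_ l)/eqP; move/forallP: ss' => /(_ l)/eqP <-.
  by move/eqP; rewrite eqn_add2r => /eqP.
- by [].
- by move=> ss'; move: (no s'); rewrite -/(dual_adjacent s j b s') ss'.
Qed.

Lemma big_dual_nb i (s : face M i) j b (G : face M i -> R) :
  (if dual_nb s j b is Some s' then G s' else 0) =
  \sum_(s' | dual_adjacent s j b s') G s'.
Proof.
case E: dual_nb => [s'|].
  rewrite (big_pred1 s')// => t /=; apply/idP/eqP => [/dual_nbP|->].
    by rewrite E => -[].
  exact/dual_nbP.
rewrite big_pred0// => t; apply/negP => /dual_nbP; by rewrite E.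
Qed.

(** A dual cell adjacent across a dual face tangent to its own face is obtained by
translating both primal cells; the antisymmetry of the primal fluxes thus carries over to
the dual ones. *)
Lemma dual_adjacent_face_of i j b c K K' :
  dual_adjacent (face_of K i c) j b (face_of K' i c) =
  (face_of K' j (~~ b) == face_of K j b).
Proof.
apply/forallP/eqP => [h|/ffunP h l].
  apply/ffunP => l; apply: ord_inj; rewrite !face_ofE.
  have := h l; rewrite !face_ofE addnAC [in X in _ == X]addnAC eqn_add2r.
  by move=> /eqP.
have := congr1 (@nat_of_ord _) (h l); rewrite !face_ofE => {}h.
by rewrite addnAC h addnAC.
Qed.

Lemma dual_adjacent_opp i b K s' :
  dual_adjacent (face_of K i (~~ b)) i b s' = (s' == face_of K i b).
Proof.
apply/forallP/eqP => [h|-> l]; last by rewrite !face_ofE addnAC.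
apply/ffunP => l; apply: ord_inj; rewrite face_ofE.
have := h l; rewrite face_ofE addnAC eqn_add2r => /eqP ->.
by [].
Qed.

Lemma dual_flux_antisym rho u i (s s' : face M i) j b :
  internal s -> internal s' -> dual_adjacent s j b s' ->
  dual_flux rho u s j b = - dual_flux rho u s' j (~~ b).
Proof.
move=> si si' ss'; rewrite /dual_flux; case: eqP => [ji|/eqP ji].
  subst j; have [K sK] : exists K, side s b = Some K.
    move/internalP: si => [K [L [sK sL]]].
    by case: b {ss'}; [exists L|exists K].
  move/sideP: (sK) => es; move: ss'; rewrite -es dual_adjacent_opp => /eqP ->.
  rewrite (side_face_of K i b) -[X in side _ X]negbK side_face_of negbK.
  by case: b {sK es} => /=; ring.
move/internalP: si => [K [L [sK sL]]]; move/internalP: si' => [K' [L' [sK' sL']]].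
rewrite sK sL sK' sL' !fluxE.
move/sideP: sK => eK; move/sideP: sK' => eK'.
move/sideP: sL => eL; move/sideP: sL' => eL'.
move: (ss'); rewrite -eK -eK' dual_adjacent_face_of => /eqP ->.
move: (ss'); rewrite -eL -eL' dual_adjacent_face_of => /eqP ->.
by case: b {ss'} => /=; ring.
Qed.

Lemma dual_flux_boundary rho u i (s : face M i) j b : internal s ->
  dual_nb s j b = None -> dual_flux rho u s j b = 0.
Proof.
move=> si sn; rewrite /dual_flux; case: eqP => [ji|/eqP ji].
  subst j; case E: side => [K|]//; move/sideP: E => es.
  suff : dual_adjacent s i b (face_of K i b) by move/dual_nbP; rewrite sn.
  by rewrite -es dual_adjacent_opp.
move/internalP: si => [K [L [sK sL]]]; rewrite sK sL.
suff f0 c K0 : side s c = Some K0 -> flux rho u K0 j b = 0.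
  by rewrite (f0 _ _ sK) (f0 _ _ sL) addr0 mul0r.
move/sideP => es; rewrite /flux; case E: side => [K'|]//; move/sideP: E => e'.
suff : dual_adjacent s j b (face_of K' i (~~ c)) by move/dual_nbP; rewrite sn.
by rewrite -es dual_adjacent_face_of e'.
Qed.

(** In the direction normal to the face, the fluxes of the two primal cells through the
face itself cancel out. *)
Lemma sum_dual_flux rho u i (s : face M i) K L :
  side s false = Some K -> side s true = Some L ->
  \sum_j \sum_b dual_flux rho u s j b =
  (vol K * div_mass rho u K + vol L * div_mass rho u L) / 2.
Proof.
move=> sK sL; rewrite /div_mass !mulVKf ?gt_eqF ?vol_gt0// -big_split mulr_suml.
apply: eq_bigr => j _; rewrite !big_bool /= /dual_flux.
case: eqP => [ji|_]; last by rewrite sK sL; ring.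
subst j; rewrite sK sL !fluxE.
move/sideP: (sK) => -> /=; move/sideP: (sL) => -> /=; ring.
Qed.

(** The square of v at a face is multiplied by the total flux out of its dual cell, which
vanishes; the products of the values of v in two adjacent dual cells appear twice, with
opposite fluxes. *)
Lemma sum_convection (u v : velocity M) : discrete_velocity v ->
  (forall K, divergence u K = 0) ->
  forall i, \sum_(s : face M i) dual_vol s * v i s * convection (fun=> 1) v u s = 0.
Proof.
move=> dv du i; pose F (s : face M i) j b := dual_flux (fun=> 1) u s j b.
have step (s : face M i) : dual_vol s * v i s * convection (fun=> 1) v u s =
    \sum_j \sum_b \sum_(s' | dual_adjacent s j b s') F s j b * v i s * v i s' / 2.
  have [si|/dv vs0] := boolP (internal s); last first.
    by rewrite vs0 mulr0 mul0r big1// => j _; rewrite big1// => b _;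
       rewrite big1// => t _; rewrite mulr0 !mul0r.
  rewrite mulrAC /convection mulVKf ?gt_eqF ?dual_vol_gt0//.
  have sq : v i s * (\sum_j \sum_b F s j b * (v i s / 2)) = 0.
    under eq_bigr do rewrite -mulr_suml.
    rewrite -mulr_suml.
    move/internalP: (si) => [K [L [sK sL]]]; rewrite (sum_dual_flux _ _ sK sL).
    by rewrite -/(divergence u K) -/(divergence u L) !du !mulr0 addr0 !mul0r mulr0.
  rewrite -[RHS]addr0 -[X in _ = _ + X]sq mulrC !mulr_sumr -big_split.
  apply: eq_bigr => j _ /=.
  rewrite !mulr_sumr -big_split; apply: eq_bigr => b _ /=.
  rewrite -(@big_dual_nb _ s j b (fun s' => F s j b * v i s * v i s' / 2)).
  case E: dual_nb => [s'|]; first by rewrite /F; ring.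
  by rewrite /F dual_flux_boundary// mul0r !mulr0 addr0.
under eq_bigr do rewrite step.
rewrite exchange_big big1//= => j _.
under eq_bigr do rewrite big_bool.
rewrite big_split /= [X in _ + X](exchange_big_dep xpredT)//=.
rewrite -big_split big1//= => s _.
under [X in _ + X]eq_bigl => s' do rewrite dual_adjacentC.
rewrite -big_split big1//= => s' ss'.
have [/andP[si si']|] := boolP (internal s && internal s').
  by rewrite /F (@dual_flux_antisym _ _ _ s s' j true)//=; ring.
by rewrite negb_and => /orP[] /dv ->; ring.
Qed.

(** Energy identity of the prediction step: the convection does no work, and the diffusion
is dissipative. *)
Lemma momentum_coercive (mu : R) (divtau : velocity M -> velocity M) (u v : velocity M) :
  0 < mu -> coercive_diffusion mu divtau ->
  discrete_velocity v -> (forall K, divergence u K = 0) ->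
  0 <= \sum_i \sum_(s : face M i | internal s)
    dual_vol s * v i s * (convection (fun=> 1) v u s - divtau v i s).
Proof.
move=> mu0 cd dv du.
have -> : \sum_i \sum_(s : face M i | internal s)
    dual_vol s * v i s * (convection (fun=> 1) v u s - divtau v i s) =
  - \sum_i \sum_(s : face M i | internal s) dual_vol s * v i s * divtau v i s.
  rewrite -sumrN; apply: eq_bigr => i _.
  rewrite -[RHS]add0r -[X in _ = X + _](@sum_convection u v dv du i).
  rewrite [in RHS](bigID (fun s => internal s)) /= [X in _ + X + _]big1; last first.
    by move=> s /dv ->; rewrite mulr0 mul0r.
  by rewrite addr0 -sumrB; apply: eq_bigr => s _; rewrite mulrBr.
apply: le_trans (cd v dv); apply: mulr_ge0; first exact: ltW.
have w0 j k : (k < ncells M j)%N -> 0 <= width M j k by move/width_gt0/ltW.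
have dw i (s : face M i) : 0 <= dual_width s.
  by apply: sumr_ge0 => b _; case: side => // K; rewrite divr_ge0 ?w0.
have wn i (s : face M i) l : l != i -> 0 <= width M l (s l).
  move=> li; apply: w0; suff {2}<- : (ncells M l + (l == i) = ncells M l)%N by [].
  by rewrite (negbTE li) addn0.
have da i (s : face M i) j : 0 <= dual_area s j.
  rewrite /dual_area; case: ifP => _; first exact/ltW/area_gt0.
  by rewrite mulr_ge0// prodr_ge0// => l /andP[/wn].
have dd i (s : face M i) j b : 0 <= dual_dist s j b.
  rewrite /dual_dist; case: ifPn => ji; first by case: side => // K; rewrite w0.
  case: dual_nb => [s'|]; last by rewrite divr_ge0 ?wn.
  by rewrite divr_ge0// addr_ge0 ?wn.
apply: sumr_ge0 => i _; apply: sumr_ge0 => s _; apply: sumr_ge0 => j _.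
apply: addr_ge0.
  by case: (dual_nb (s : face M i) j true) => [s'|]//; rewrite mulr_ge0 ?divr_ge0 ?sqr_ge0.
apply: sumr_ge0 => b _; case: (dual_nb (s : face M i) j b) => [s'|]//.
by rewrite mulr_ge0 ?divr_ge0 ?sqr_ge0.
Qed.

End dual_mesh.

(** * Convergent linear systems *)

Section linear_systems.
Variable R : realType.

Lemma cvg_sumr (T : Type) (F : set_system T) {FF : Filter F} (I : Type)
    (r : seq I) (P : pred I) (f : I -> T -> R) (l : I -> R) :
  (forall k, P k -> f k x @[x --> F] --> l k) ->
  \sum_(k <- r | P k) f k x @[x --> F] --> \sum_(k <- r | P k) l k.
Proof. by move=> fl; apply: cvg_big => //; exact: add_continuous. Qed.

Lemma cvg_prodr (T : Type) (F : set_system T) {FF : Filter F} (I : Type)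
    (r : seq I) (P : pred I) (f : I -> T -> R) (l : I -> R) :
  (forall k, P k -> f k x @[x --> F] --> l k) ->
  \prod_(k <- r | P k) f k x @[x --> F] --> \prod_(k <- r | P k) l k.
Proof. by move=> fl; apply: cvg_big => //; exact: mul_continuous. Qed.

Lemma cvg_det n (A_ : nat -> 'M[R]_n) (A : 'M[R]_n) :
  (forall i j, A_ m i j @[m --> \oo] --> A i j) -> \det (A_ m) @[m --> \oo] --> \det A.
Proof.
move=> AA; rewrite /determinant; apply: cvg_sumr => s _; apply: cvgM; first exact: cvg_cst.
by apply: cvg_prodr => i _; exact: AA.
Qed.

Lemma cvg_adj n (A_ : nat -> 'M[R]_n) (A : 'M[R]_n) :
  (forall i j, A_ m i j @[m --> \oo] --> A i j) ->
  forall i j, (\adj (A_ m)) i j @[m --> \oo] --> (\adj A) i j.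
Proof.
move=> AA i j; rewrite /adjugate mxE; under eq_fun do rewrite mxE.
apply: cvgM; first exact: cvg_cst.
by apply: cvg_det => k l; rewrite !mxE; under eq_fun do rewrite !mxE; exact: AA.
Qed.

Definition linear_op (E : Type) (T : (E -> R) -> E -> R) :=
  forall a x y e, T (fun k => a * x k + y k) e = a * T x e + T y e.

Section operators.
Variable E : finType.
Implicit Types (T : (E -> R) -> E -> R) (x : E -> R).

Let unitv (e : E) : E -> R := fun k => (k == e)%:R.

Lemma linear_opE T x e : linear_op T -> T x e = \sum_k x k * T (unitv k) e.
Proof.
move=> lT.
have T0 : T (fun=> 0) e = 0.
  by have := lT (-1) (fun=> 0) (fun=> 0) e; rewrite (_ : (fun=> _) = (fun=> 0));
    [move=> ->; ring|apply/funext => k; ring].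
have -> : T x e = T (fun l => \sum_k x k * unitv k l) e.
  congr (T _ e); apply/funext => l; rewrite (bigD1 l)//= /unitv eqxx mulr1 big1 ?addr0//.
  by move=> k /negbTE kl; rewrite eq_sym kl mulr0.
elim: (index_enum E) => [|k r IH].
  rewrite big_nil -[RHS]T0; congr (T _ e); apply/funext => l; by rewrite big_nil.
rewrite big_cons -IH -lT; congr (T _ e); apply/funext => l; by rewrite big_cons.
Qed.

Let mat T : 'M[R]_#|E| := \matrix_(i, j) T (unitv (enum_val j)) (enum_val i).
Let colv x : 'cV[R]_#|E| := \col_i x (enum_val i).

Let mat_colv T x : linear_op T -> mat T *m colv x = colv (T x).
Proof.
move=> lT; apply/matrixP => i j; rewrite !mxE linear_opE// [RHS](reindex (@enum_val E xpredT)).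
  by apply: eq_bigr => k _; rewrite !mxE mulrC.
exact/onW_bij/enum_val_bij.
Qed.

(** Solutions of linear systems depend continuously on the system. By Cramer's rule,
det(A_m) x_m = adj(A_m) b_m, and both coefficients are polynomial in the entries of
A_m; so no bound on x_m is needed beforehand. *)
Lemma cvg_linear_system (T_ : nat -> (E -> R) -> E -> R) T (x_ b_ : nat -> E -> R) b :
  (forall m, linear_op (T_ m)) -> linear_op T ->
  (forall x e, T_ m x e @[m --> \oo] --> T x e) ->
  (forall x, (forall e, T x e = 0) -> forall e, x e = 0) ->
  (forall e, b_ m e @[m --> \oo] --> b e) ->
  (\forall m \near \oo, forall e, T_ m (x_ m) e = b_ m e) ->
  exists x, (forall e, x_ m e @[m --> \oo] --> x e) /\ forall e, T x e = b e.
Proof.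
move=> lT_ lT TT injT bb eqs.
have det_neq0 : \det (mat T) != 0.
  rewrite -det_tr; apply/negP => /det0P[v vn0 vT].
  have Tv : mat T *m v^T = 0 by rewrite -[mat T]trmxK -trmx_mul vT trmx0.
  pose x e := v ord0 (enum_rank e).
  have vx : v^T = colv x.
    by apply/matrixP => i j; rewrite (ord1 j) !mxE /x enum_valK.
  have x0 : forall e, x e = 0.
    apply: injT => e; move: Tv; rewrite vx mat_colv// => /matrixP/(_ (enum_rank e) ord0).
    by rewrite !mxE enum_rankK.
  case/eqP: vn0; apply/matrixP => i j.
  by rewrite (ord1 i) mxE -(enum_valK j); exact: x0.
have mT i j : mat (T_ m) i j @[m --> \oo] --> mat T i j.
  by rewrite mxE; under eq_fun do rewrite mxE; exact: TT.
pose y_ m i := (\det (mat (T_ m)))^-1 * (\adj (mat (T_ m)) *m colv (b_ m)) i ord0.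
pose y i := (\det (mat T))^-1 * (\adj (mat T) *m colv b) i ord0.
have yy i : y_ m i @[m --> \oo] --> y i.
  apply: cvgM; first by apply: cvgV => //; exact: cvg_det.
  rewrite mxE; under eq_fun do rewrite mxE; apply: cvg_sumr => k _; apply: cvgM.
    exact: cvg_adj.
  by rewrite mxE; under eq_fun do rewrite mxE; exact: bb.
have xy : \forall m \near \oo, forall e, y_ m (enum_rank e) = x_ m e.
  have dn : \forall m \near \oo, \det (mat (T_ m)) != 0.
    exact: (cvgr_neq0 _ (cvg_det mT) det_neq0).
  near=> m => e.
  have dm : \det (mat (T_ m)) != 0 by near: m.
  have em : colv (T_ m (x_ m)) = colv (b_ m).
    apply/matrixP => i j; rewrite !mxE; move: (enum_val i); near: m; exact: eqs.
  by rewrite /y_ -em -mat_colv// mulmxA mul_adj_mx mul_scalar_mx !mxE enum_rankK mulKf.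
have xx e : x_ m e @[m --> \oo] --> y (enum_rank e).
  apply: cvg_trans (yy (enum_rank e)); apply: near_eq_cvg.
  by apply: filterS xy => m /(_ e).
exists (fun e => y (enum_rank e)); split => // e.
have Tx : T_ m (x_ m) e @[m --> \oo] --> T (fun e => y (enum_rank e)) e.
  rewrite linear_opE//; under eq_fun do rewrite linear_opE//.
  by apply: cvg_sumr => k _; apply: cvgM; [exact: xx|exact: TT].
have Tb : T_ m (x_ m) e @[m --> \oo] --> b e.
  apply: cvg_trans (bb e); apply: near_eq_cvg.
  by apply: filterS eqs => m /(_ e) ->.
exact: (cvg_unique _ Tx Tb).
Unshelve. all: by end_near.
Qed.

End operators.
End linear_systems.

(** * A priori bound on the pressure at the new time step *)

Section finite_families.
Variable R : realType.

Lemma finite_lower_bound (T : finType) (f : T -> R) :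
  (forall x, 0 < f x) -> exists2 c, 0 < c & forall x, c <= f x.
Proof.
move=> f0; have s0 x : 0 <= \sum_(y | y != x) (f y)^-1.
  by apply: sumr_ge0 => y _; rewrite invr_ge0 ltW.
have S0 : 0 <= \sum_y (f y)^-1 by apply: sumr_ge0 => y _; rewrite invr_ge0 ltW.
exists (1 + \sum_y (f y)^-1)^-1 => [|x]; first by rewrite invr_gt0 ltr_pwDl.
rewrite -[leRHS]invrK lef_pV2 ?posrE ?invr_gt0 ?ltr_pwDl//.
by rewrite (bigD1 x)//= addrCA lerDl addr_ge0.
Qed.

(** Pigeonhole: if no interval of length J were skipped, raising a threshold by J would
capture a new element of T each time, and would do so more often than T has elements. *)
Lemma level_gap (T : finType) (p : T -> R) (J : R) (K L : T) : 0 < J ->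
  #|T|%:R * J < p L - p K ->
  exists t, [/\ exists K, p K <= t, exists L, t + J < p L &
                forall K, p K <= t \/ t + J < p K].
Proof.
move=> J0 osc; apply: contrapT => nogap.
suff n k : (k <= #|T|)%N -> (k < #|[pred X | (p X <= p K + k%:R * J)%R]|)%N.
  by have := n _ (leqnn _); rewrite ltnNge max_card.
elim: k => [_|k IH kT].
  by apply/card_gt0P; exists K; rewrite inE mul0r addr0.
apply: leq_ltn_trans (IH (ltnW kT)) _; apply: proper_card; apply/properP; split.
  apply/fintype.subsetP => X; rewrite !inE => /le_trans; apply.
  by rewrite lerD2l ler_pM2r// ler_nat.
have stepJ : p K + k%:R * J + J = p K + k.+1%:R * J by rewrite -addn1 natrD; ring.
apply: contrapT => noX; apply: nogap; exists (p K + k%:R * J); split.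
- by exists K; rewrite lerDl mulr_ge0// ltW.
- exists L; rewrite stepJ addrC -ltrBrDr; apply: le_lt_trans osc.
  by rewrite ler_pM2r// ler_nat.
- move=> X; apply/orP; rewrite stepJ leNgt [X in _ || X]ltNge -negb_and.
  apply/negP => /andP[X1 X2]; apply: noX; by exists X; rewrite !inE -?ltNge.
Qed.

End finite_families.

Section pressure_bound.
Variables (R : realType) (d : nat) (M : mac_mesh R d).

Lemma face_lower_bound (f : forall i, face M i -> R) :
  (forall i (s : face M i), internal s -> 0 < f i s) ->
  exists2 c, 0 < c & forall i (s : face M i), internal s -> c <= f i s.
Proof.
move=> f0; pose g (e : {i : 'I_d & face M i}) : R :=
  if internal (tagged e) then f (tag e) (tagged e) else 1.
have [|c c0 cg] := @finite_lower_bound R _ g.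
  by move=> [i s]; rewrite /g /=; case: ifP => // /f0.
by exists c => // i s si; have := cg (existT _ i s); rewrite /g /= si.
Qed.

Lemma pressure_lt gamma (rho : density M) K L : 1 <= gamma ->
  (forall K, 0 < rho K) ->
  pressure gamma rho K < pressure gamma rho L -> rho K < rho L.
Proof.
move=> g1 r0; apply: contraTT; rewrite -!leNgt => rKL.
by apply: ge0_ler_powR; rewrite ?nnegrE ?(le_trans ler01 g1)// ltW.
Qed.

Lemma mass_conserved (dt : R) (rho rho' : density M) (u : velocity M) :
  0 < dt -> (forall K, dt^-1 * (rho' K - rho K) + div_mass rho' u K = 0) ->
  \sum_K vol K * rho' K = \sum_K vol K * rho K.
Proof.
move=> dt0 mass; apply/eqP; rewrite -subr_eq0 -sumrB; apply/eqP.
transitivity (- dt * \sum_K vol K * div_mass rho' u K); last by rewrite sum_div_mass0 mulr0.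
rewrite mulr_sumr; apply: eq_bigr => K _.
have -> : div_mass rho' u K = - (dt^-1 * (rho' K - rho K)).
  by apply/eqP; rewrite -subr_eq0 opprK addrC mass.
by field; rewrite gt_eqF.
Qed.

(** An a priori bound on the pressure at the new time step. If the pressure
oscillated by much more than eps^2, its values would skip an interval of length
proportional to eps^2; the set A of the cells above this gap would then lose mass through
each of its boundary faces with a large velocity, while the cells below the gap, which
do not lose mass, keep the density in A away from zero: more mass would leave A than it
contains. *)
Lemma pressure_oscillation (dt W a0 : R) : 0 < dt -> 0 <= W -> 0 < a0 ->
  exists2 C, 0 < C & forall (gamma eps : R) (rho rho' : density M) (u h a : velocity M),
    1 <= gamma -> 0 < eps ->
    (forall K, 1 / 2 <= rho K <= 2) -> (forall K, 0 < rho' K) ->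
    (forall K, dt^-1 * (rho' K - rho K) + div_mass rho' u K = 0) ->
    (forall i (s : face M i), internal s ->
       [/\ u i s = h i s - a i s * ((eps ^+ 2)^-1 * grad (pressure gamma rho') s),
           `|h i s| <= W & a0 <= a i s]) ->
    forall K L, pressure gamma rho' L - pressure gamma rho' K <= C * eps ^+ 2.
Proof.
move=> dt0 W0 a00.
have [al al0 al_le] : exists2 c, 0 < c & forall i (s : face M i), internal s -> c <= area s.
  by apply: (@face_lower_bound (fun i s => area s)) => i s _; exact: area_gt0.
have [g0 g00 g0_le] : exists2 c, 0 < c &
    forall i (s : face M i), internal s -> c <= area s / dual_vol s.
  apply: (@face_lower_bound (fun i s => area s / dual_vol s)) => i s si.
  by rewrite divr_gt0 ?area_gt0 ?dual_vol_gt0.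
(* the speed V makes the mass lost through one face exceed the mass above the gap, and the
   gap J0 makes the pressure force exceed this speed *)
have [V V0 VE] : exists2 V, 0 < V & dt * al * V = 4 * vol_Omega M + dt * al.
  exists (4 * vol_Omega M / (dt * al) + 1); last by field; rewrite !gt_eqF.
  by rewrite ltr_wpDl// divr_ge0 ?mulr_ge0 ?ltW ?vol_Omega_gt0.
have [J0 J00 aJ] : exists2 J, 0 < J & a0 * g0 * J = W + V.
  exists ((W + V) / (a0 * g0)); last by field; rewrite !gt_eqF.
  by apply: divr_gt0; [exact: ltr_wpDl|exact: mulr_gt0].
have card0 : 0 < #|{: cell M}|%:R :> R.
  by rewrite ltr0n; apply/card_gt0P; exists (cell_inhab M).
exists (#|{: cell M}|%:R * J0); first by rewrite mulr_gt0.
move=> gamma eps rho rho' u h a g1 eps0 rhoB rho'0 mass vel K0 L0.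
set p := pressure gamma rho' in vel *.
rewrite leNgt; apply/negP; rewrite -mulrA => osc.
have J_gt0 : 0 < J0 * eps ^+ 2 by rewrite mulr_gt0// exprn_gt0.
have [t [[Kb Kbt] [Lt Ltt] gap]] := level_gap J_gt0 osc.
pose f (K : cell M) : R := (t + J0 * eps ^+ 2 < p K)%R%:R.
have fA K : t + J0 * eps ^+ 2 < p K -> f K = 1 by rewrite /f => ->.
have fN K : p K <= t -> f K = 0.
  by rewrite /f => pK; rewrite ltNge (le_trans pK)// lerDl ltW.
have f01 : forall X, 0 <= f X <= 1 by move=> X; rewrite /f ler0n lern1 leq_b1.
have push i (s : face M i) : internal s -> a0 * g0 * J0 <=
    a i s * (area s / dual_vol s) * J0.
  move=> si; have [_ _ a_le] := vel i s si.
  by apply: ler_wpM2r; rewrite ?(ltW J00)// ler_pM ?g0_le// ltW.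
(* faces across the gap are crossed outwards with speed at least V; r is any lower bound
   of the density above the gap *)
have cross i (s : face M i) r : 0 <= r -> (forall K, f K = 1 -> r <= rho' K) ->
    face_flux rho' u s * jump f s <= - (al * r * V) * `|jump f s|.
  move=> r0 rA; have [/internalP[K [L [sK sL]]]|se] := boolP (internal s); last first.
    by rewrite jump_external// normr0 !mulr0.
  have si : internal s by apply/internalP; exists K, L.
  have [us hW _] := vel i s si; have pu := push i s si.
  have areaP := al_le i s si.
  rewrite /face_flux /jump sK sL.
  have e2 : eps ^+ 2 != 0 by rewrite gt_eqF// exprn_gt0.
  have us' : u i s = h i s - a i s * (area s / dual_vol s) *
      ((p L - p K) / eps ^+ 2).
    by rewrite us gradE /jump sK sL -/p; congr (_ - _); rewrite [RHS]mulrA; ring.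
  have big_flux K1 x : f K1 = 1 -> V <= x -> al * r * V <= area s * rho' K1 * x.
    move=> fK1 Vx; apply: ler_pM => //; [|exact: ltW|].
      by rewrite mulr_ge0// ltW.
    by apply: ler_pM => //; [exact: ltW|exact: rA].
  move: hW; rewrite ler_norml => /andP[hW1 hW2].
  have ag0 : 0 <= a i s * (area s / dual_vol s).
    have [_ _ a_le] := vel i s si; apply: mulr_ge0; first exact: le_trans (ltW a00) a_le.
    exact: le_trans (ltW g00) (g0_le i s si).
  case: (gap K) => [pK|pK]; case: (gap L) => [pL|pL].
  - by rewrite (fN _ pK) (fN _ pL) subrr normr0 !mulr0.
  - rewrite (fN _ pK) (fA _ pL) subr0 normr1 !mulr1.
    have : J0 <= (p L - p K) / eps ^+ 2.
      by rewrite ler_pdivlMr ?exprn_gt0//; lra.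
    move=> /(ler_wpM2l ag0) uV.
    have uV' : u i s <= - V by rewrite us'; lra.
    have -> : (0 <= u i s) = false by apply/negbTE; rewrite -ltNge; lra.
    have := big_flux L (- u i s) (fA _ pL); rewrite mulrN; lra.
  - rewrite (fA _ pK) (fN _ pL) sub0r normrN normr1 !mulr1.
    have : J0 <= (p K - p L) / eps ^+ 2.
      by rewrite ler_pdivlMr ?exprn_gt0//; lra.
    move=> /(ler_wpM2l ag0) uV.
    have uV' : V <= u i s by rewrite us' -(opprB (p K)) mulNr mulrN; lra.
    have -> : (0 <= u i s) = true by lra.
    have := big_flux K (u i s) (fA _ pK); rewrite mulrN1; lra.
  - by rewrite (fA _ pK) (fA _ pL) subrr normr0 !mulr0.
have drho K : rho' K - rho K = - (dt * div_mass rho' u K).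
  move/(congr1 (fun x => dt * x)): (mass K).
  rewrite mulr0 mulrDr mulVKf ?gt_eqF// => E.
  by apply/eqP; rewrite -subr_eq0 opprK E.
have balance : \sum_K vol K * f K * (rho' K - rho K) =
    dt * \sum_i \sum_(s : face M i) face_flux rho' u s * jump f s.
  rewrite -[X in _ * X]opprK -sum_div_mass mulrN mulr_sumr -sumrN.
  by apply: eq_bigr => K _; rewrite drho; ring.
have loss r : 0 <= r -> (forall K, f K = 1 -> r <= rho' K) ->
    forall i (s : face M i),
    \sum_K vol K * f K * (rho' K - rho K) <= - (dt * (al * r * V) * `|jump f s|).
  move=> r0 rA i s; rewrite balance -mulrA -mulrN ler_wpM2l ?(ltW dt0)//.
  have B0 : 0 <= al * r * V by rewrite !mulr_ge0// ltW.
  have neg j (s' : face M j) : face_flux rho' u s' * jump f s' <= 0.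
    apply: le_trans (cross j s' r r0 rA) _.
    by rewrite mulNr oppr_le0 mulr_ge0.
  rewrite (bigD1 i)//= (bigD1 s)//= -addrA -[leRHS]addr0 -mulNr lerD ?cross//.
  rewrite -[leRHS]addr0 lerD// sumr_le0// => j _.
  by rewrite sumr_le0.
have mass0 : \sum_K vol K * (rho' K - rho K) = 0.
  by under eq_bigr do rewrite mulrBr; rewrite sumrB (mass_conserved dt0 mass) subrr.
have [i [s js]] : exists i (s : face M i), jump f s != 0.
  apply: contrapT => no; suff : f Lt = f Kb.
    by rewrite (fA _ Ltt) (fN _ Kbt) => /eqP; rewrite oner_eq0.
  apply: jump0_const => i s _; apply/eqP/negPn/negP => js.
  by apply: no; exists i, s.
have js1 : `|jump f s| = 1.
  move: js; rewrite /jump; case: side => [K|]; last by rewrite eqxx.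
  case: side => [L|]; last by rewrite eqxx.
  by rewrite /f; do 2 case: (_ < _) => /=; rewrite ?subrr ?eqxx// ?subr0 ?sub0r ?normrN normr1.
(* the cells below the gap do not lose mass *)
have [K1 fK1 rK1] : exists2 K, f K = 0 & 1 / 2 <= rho' K.
  apply: contrapT => no.
  have : \sum_K vol K * (1 - f K) * (rho' K - rho K) < 0.
    have neg K : vol K * (1 - f K) * (rho' K - rho K) <= 0.
      have := f01 K; case: (gap K) => [/fN fK|/fA fK] _; rewrite fK; last first.
        by rewrite subrr mulr0 mul0r.
      rewrite subr0 mulr1 mulr_ge0_le0 ?(ltW (vol_gt0 K))// leNgt; apply/negP => pos.
      apply: no; exists K => //; have := rhoB K; lra.
    rewrite (bigD1 Kb)//= ltr_wnDr ?sumr_le0//.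
    rewrite (fN _ Kbt) subr0 mulr1 nmulr_llt0 ?vol_gt0// ltNge; apply/negP => pos.
    by apply: no; exists Kb; rewrite ?fN//; have := rhoB Kb; lra.
  have -> : \sum_K vol K * (1 - f K) * (rho' K - rho K) =
      \sum_K vol K * (rho' K - rho K) - \sum_K vol K * f K * (rho' K - rho K).
    by rewrite -sumrB; apply: eq_bigr => K _; ring.
  rewrite mass0 => pos.
  have := @loss 0 (lexx _) (fun K _ => ltW (rho'0 K)) i s; lra.
have := @loss (1 / 2) _ _ i s; rewrite js1 mulr1.
have -> : dt * (al * (1 / 2) * V) = dt * al * V / 2 by ring.
rewrite VE.
have lowS : - (2 * vol_Omega M) <= \sum_K vol K * f K * (rho' K - rho K).
  rewrite -sum_vol mulr_sumr -sumrN; apply: ler_sum => K _.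
  have /andP[f0 f1] := f01 K; have /andP[r1 r2] := rhoB K.
  rewrite -[leRHS]mulrA mulrC -mulrN ler_pM2l ?vol_gt0//.
  have := mulr_ge0 f0 (ltW (rho'0 K)).
  have : 0 <= f K * (2 - rho K) by rewrite mulr_ge0// subr_ge0.
  lra.
have : 0 < dt * al by rewrite mulr_gt0.
move=> dal L; have {L} : \sum_K vol K * f K * (rho' K - rho K) <=
    - ((4 * vol_Omega M + dt * al) / 2).
  apply: L => [|K fK]; first lra.
  apply: (le_trans rK1); apply: ltW; apply: (@pressure_lt gamma) => //.
  rewrite -/p; case: (gap K) => [/fN|pK]; first by rewrite fK => /eqP; rewrite oner_eq0.
  case: (gap K1) => [pK1|/fA]; last by rewrite fK1 => /eqP; rewrite eq_sym oner_eq0.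
  apply: le_lt_trans pK1 (le_lt_trans _ pK); by rewrite lerDl ltW.
lra.
Qed.

End pressure_bound.

(** * Consistency of the discrete operators and their kernels *)

Section sequences.
Variable R : realType.
Implicit Types (a b : nat -> R) (l : R).

Lemma cvg0_mul_bounded a b (B : R) : a m @[m --> \oo] --> (0 : R) ->
  (\forall m \near \oo, `|b m| <= B) -> a m * b m @[m --> \oo] --> (0 : R).
Proof.
move=> a0 bB; apply/cvgr0Pnorm_lt => e e0.
have B1 : 0 < `|B| + 1 by rewrite ltr_wpDl.
have : \forall m \near \oo, `|a m| < e / (`|B| + 1).
  by move/cvgr0Pnorm_lt : a0; apply; rewrite divr_gt0.
apply: filterS2 bB => m bB am; rewrite normrM.
have bB1 : `|b m| <= `|B| + 1.
  by rewrite (le_trans bB)// (le_trans (ler_norm B))// lerDl.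
apply: le_lt_trans (ler_wpM2l (normr_ge0 _) bB1) _.
by rewrite -ltr_pdivlMr.
Qed.

Lemma cvg_upwind a b (u : nat -> R) l :
  a m @[m --> \oo] --> l -> b m @[m --> \oo] --> l ->
  (if 0 <= u m then a m else b m) @[m --> \oo] --> l.
Proof.
move=> /cvgrPdist_lt al /cvgrPdist_lt bl; apply/cvgrPdist_lt => e e0.
apply: filterS2 (al e e0) (bl e e0) => m.
by case: ifP.
Qed.

End sequences.

Section consistency.
Variables (R : realType) (d : nat) (M : mac_mesh R d).

Lemma dual_density1 i (s : face M i) : internal s ->
  dual_density (fun=> 1) s = 1 :> R.
Proof.
move=> si; rewrite -[RHS](@mulVf _ (dual_vol s)) ?gt_eqF ?dual_vol_gt0//.
congr (_ * _); apply: eq_bigr => b _; case: side => // K; exact: mulr1.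
Qed.

Lemma dual_density_cvg1 (rho : nat -> density M) i (s : face M i) : internal s ->
  (forall K, rho m K @[m --> \oo] --> (1 : R)) ->
  dual_density (rho m) s @[m --> \oo] --> (1 : R).
Proof.
move=> si rho1; rewrite -(dual_density1 si).
apply: cvgM; first exact: cvg_cst.
apply: cvg_sumr => b _; case: side => [K|]; last exact: cvg_cst.
by apply: cvgM; [exact: cvg_cst|exact: rho1].
Qed.

Lemma face_flux_cvg (rho : nat -> density M) (u : nat -> velocity M) (ub : velocity M)
    i (s : face M i) :
  (forall K, rho m K @[m --> \oo] --> (1 : R)) ->
  (forall i (s : face M i), u m i s @[m --> \oo] --> ub i s) ->
  face_flux (rho m) (u m) s @[m --> \oo] --> face_flux (fun=> 1) ub s.
Proof.
move=> rho1 uu; rewrite /face_flux.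
case: (side s false) => [K|]; last exact: cvg_cst.
case: (side s true) => [L|]; last exact: cvg_cst.
apply: cvgM; last exact: uu.
apply: cvgM; first exact: cvg_cst.
by rewrite if_same; exact: cvg_upwind.
Qed.

Section convergent_sequences.
Variables (rho : nat -> density M) (u : nat -> velocity M) (ub : velocity M).
Arguments u : clear implicits.
Arguments ub : clear implicits.
Hypothesis rho1 : forall K, rho m K @[m --> \oo] --> (1 : R).
Hypothesis uu : forall i (s : face M i), u m i s @[m --> \oo] --> ub i s.

Lemma flux_cvg K i b : flux (rho m) (u m) K i b @[m --> \oo] --> flux (fun=> 1) ub K i b.
Proof.
rewrite fluxE; under eq_fun do rewrite fluxE.
by apply: cvgM; [exact: cvg_cst|exact: face_flux_cvg].
Qed.

Lemma div_mass_cvg K : div_mass (rho m) (u m) K @[m --> \oo] --> divergence ub K.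
Proof.
apply: cvgM; first exact: cvg_cst.
by apply: cvg_sumr => i _; apply: cvg_sumr => b _; exact: flux_cvg.
Qed.

Lemma dual_flux_cvg i (s : face M i) j b :
  dual_flux (rho m) (u m) s j b @[m --> \oo] --> dual_flux (fun=> 1) ub s j b.
Proof.
rewrite /dual_flux; case: ifP => _.
  case: side => [K|]; last exact: cvg_cst.
  apply: cvgM; last exact: cvg_cst.
  by apply: cvgD; apply: cvgM; [exact: flux_cvg|exact: cvg_cst|exact: flux_cvg|exact: cvg_cst].
case: side => [K|]; last exact: cvg_cst.
case: side => [L|]; last exact: cvg_cst.
apply: cvgM; last exact: cvg_cst.
by apply: cvgD; exact: flux_cvg.
Qed.

Lemma convection_cvg (v : velocity M) i (s : face M i) :
  convection (rho m) v (u m) s @[m --> \oo] --> convection (fun=> 1) v ub s.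
Proof.
apply: cvgM; first exact: cvg_cst.
apply: cvg_sumr => j _; apply: cvg_sumr => b _.
case: dual_nb => [s'|]; last exact: cvg_cst.
by apply: cvgM; [exact: dual_flux_cvg|exact: cvg_cst].
Qed.

End convergent_sequences.

Lemma convection_linear (rho : density M) (u v w : velocity M) a i (s : face M i) :
  convection rho (fun k t => a * v k t + w k t) u s =
  a * convection rho v u s + convection rho w u s.
Proof.
rewrite /convection mulrCA -mulrDr; congr (_ * _).
rewrite mulr_sumr -big_split; apply: eq_bigr => j _ /=.
rewrite mulr_sumr -big_split; apply: eq_bigr => b _ /=.
by case: dual_nb => [s'|]; [field|rewrite mulr0 addr0].
Qed.

Lemma divergence_linear (u v : velocity M) a K :
  divergence (fun k t => a * u k t + v k t) K = a * divergence u K + divergence v K.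
Proof.
rewrite /divergence /div_mass mulrCA -mulrDr; congr (_ * _).
rewrite mulr_sumr -big_split; apply: eq_bigr => j _ /=.
rewrite mulr_sumr -big_split; apply: eq_bigr => b _ /=.
rewrite !fluxE !face_flux1; case: ifP => _; last by rewrite !mulr0 addr0.
ring.
Qed.

Lemma jump_linear (p q : density M) a i (s : face M i) :
  jump (fun K => a * p K + q K) s = a * jump p s + jump q s.
Proof.
rewrite /jump; case: side => [K|]; last by rewrite mulr0 addr0.
by case: side => [L|]; [ring|rewrite mulr0 addr0].
Qed.

Lemma grad_linear (p q : density M) a i (s : face M i) :
  grad (fun K => a * p K + q K) s = a * grad p s + grad q s.
Proof. by rewrite !gradE jump_linear; ring. Qed.

Lemma grad_external (p : density M) i (s : face M i) : ~~ internal s -> grad p s = 0.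
Proof. by move=> se; rewrite gradE jump_external// mulr0. Qed.

Lemma grad_cvg (p : nat -> density M) (q : density M) i (s : face M i) :
  (forall K, p m K @[m --> \oo] --> q K) -> grad (p m) s @[m --> \oo] --> grad q s.
Proof.
move=> pq; rewrite gradE; under eq_fun do rewrite gradE.
apply: cvgM; first exact: cvg_cst.
rewrite /jump; case: side => [K|]; last exact: cvg_cst.
by case: side => [L|]; [apply: cvgB; exact: pq|exact: cvg_cst].
Qed.

Lemma jump_scaled_pressure gamma eps (rho : density M) i (s : face M i) :
  jump (scaled_pressure gamma eps rho) s = (eps ^+ 2)^-1 * jump (pressure gamma rho) s.
Proof.
rewrite /jump; case: side => [K|]; last by rewrite mulr0.
by case: side => [L|]; [rewrite /scaled_pressure; ring|rewrite mulr0].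
Qed.

Lemma grad_scaled_pressure gamma eps (rho : density M) i (s : face M i) :
  grad (scaled_pressure gamma eps rho) s = (eps ^+ 2)^-1 * grad (pressure gamma rho) s.
Proof. by rewrite !gradE jump_scaled_pressure mulrCA. Qed.

Lemma sum_scaled_pressure gamma eps (rho : density M) :
  \sum_K vol K * scaled_pressure gamma eps rho K = 0.
Proof.
under eq_bigr do rewrite /scaled_pressure mulrCA mulrBr.
rewrite -mulr_sumr sumrB -mulr_suml sum_vol mulVKf ?subrr ?mulr0//.
by rewrite gt_eqF// vol_Omega_gt0.
Qed.

(** Tested against v, the equation leaves the squared norm of v plus a nonnegative
energy. *)
Lemma prediction_inj (mu dt : R) (divtau : velocity M -> velocity M) (u v : velocity M) :
  0 < mu -> 0 < dt -> coercive_diffusion mu divtau ->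
  discrete_velocity v -> (forall K, divergence u K = 0) ->
  (forall i (s : face M i), internal s ->
     dt^-1 * v i s + convection (fun=> 1) v u s - divtau v i s = 0) ->
  forall i (s : face M i), v i s = 0.
Proof.
move=> mu0 dt0 cd dv du eqv; have := momentum_coercive mu0 cd dv du.
have -> : \sum_i \sum_(s : face M i | internal s)
    dual_vol s * v i s * (convection (fun=> 1) v u s - divtau v i s) =
    - \sum_i \sum_(s : face M i | internal s) dual_vol s * dt^-1 * v i s ^+ 2.
  rewrite -sumrN; apply: eq_bigr => i _; rewrite -sumrN; apply: eq_bigr => s si.
  have -> : convection (fun=> 1) v u s - divtau v i s = - (dt^-1 * v i s).
    by apply/eqP; rewrite -subr_eq0 opprK addrC addrA (eqv i s si).
  ring.
have pos i (s : face M i) : 0 <= dual_vol s * dt^-1 * v i s ^+ 2.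
  by apply: mulr_ge0; rewrite ?sqr_ge0// mulr_ge0 ?dual_vol_ge0// invr_ge0 ltW.
have pos1 i : 0 <= \sum_(s : face M i | internal s) dual_vol s * dt^-1 * v i s ^+ 2.
  exact: sumr_ge0.
rewrite oppr_ge0 => S0 i s; have [si|] := boolP (internal s); last exact: dv.
have : \sum_i \sum_(s : face M i | internal s) dual_vol s * dt^-1 * v i s ^+ 2 = 0.
  by apply/eqP; rewrite eq_le S0/=; apply: sumr_ge0 => k _; exact: pos1.
move/psumr_eq0P => /(_ (fun i _ => pos1 i) i isT).
move/psumr_eq0P => /(_ (fun s _ => pos i s) s si)/eqP.
by rewrite mulf_eq0 gt_eqF/= ?sqrf_eq0 ?mulr_gt0 ?invr_gt0 ?dual_vol_gt0// => /eqP.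
Qed.

(** Discrete Poisson operator, multiplied by the volumes to make it symmetric. The mean
value is added to make it definite. *)
Definition pressure_op (p : density M) : density M := fun K =>
  vol K * (\sum_L vol L * p L - divergence (fun i s => grad p s) K).

Lemma pressure_op_linear : linear_op (E := cell M) pressure_op.
Proof.
move=> a p q K; rewrite /pressure_op mulrCA -mulrDr; congr (_ * _).
have -> : divergence (fun i s => grad (fun K => a * p K + q K) s) K =
    divergence (fun i s => a * grad p s + grad q s) K.
  congr (divergence _ K); apply/functional_extensionality_dep => i.
  by apply/funext => s; rewrite grad_linear.
rewrite divergence_linear mulrBr addrACA -opprD; congr (_ - _).
by rewrite mulr_sumr -big_split; apply: eq_bigr => L _ /=; ring.
Qed.

(** Tested against p, the operator gives the square of the mean plus the squared norm of
the gradient; a pressure with zero gradient is constant because the mesh is connected. *)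
Lemma pressure_op_inj (p : density M) :
  (forall K, pressure_op p K = 0) -> forall K, p K = 0.
Proof.
move=> p0; have : \sum_K p K * pressure_op p K = 0.
  by rewrite big1// => K _; rewrite p0 mulr0.
have -> : \sum_K p K * pressure_op p K =
    (\sum_L vol L * p L) ^+ 2 + \sum_i \sum_(s : face M i) dual_vol s * grad p s ^+ 2.
  rewrite /pressure_op.
  have -> : \sum_i \sum_(s : face M i) dual_vol s * grad p s ^+ 2 =
      - \sum_K vol K * p K * divergence (fun i s => grad p s) K.
    rewrite sum_divergence; last by move=> i s; exact: grad_external.
    by rewrite opprK; apply: eq_bigr => i _; apply: eq_bigr => s _; rewrite expr2 mulrA.
  rewrite expr2 mulr_suml -sumrB; apply: eq_bigr => K _; ring.
have pos i (s : face M i) : 0 <= dual_vol s * grad p s ^+ 2.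
  by rewrite mulr_ge0 ?dual_vol_ge0 ?sqr_ge0.
have pos1 i : 0 <= \sum_(s : face M i) dual_vol s * grad p s ^+ 2 by exact: sumr_ge0.
have pos2 : 0 <= \sum_i \sum_(s : face M i) dual_vol s * grad p s ^+ 2 by exact: sumr_ge0.
move/eqP; rewrite paddr_eq0 ?sqr_ge0// => /andP[]; rewrite sqrf_eq0 => /eqP mean0 /eqP.
move/psumr_eq0P => /(_ (fun i _ => pos1 i)) g0.
have cst : forall K L, p K = p L.
  apply: jump0_const => i s si; have := g0 i isT.
  move/psumr_eq0P => /(_ (fun s _ => pos i s) s isT)/eqP.
  rewrite mulf_eq0 gt_eqF ?dual_vol_gt0//= sqrf_eq0 gradE mulf_eq0.
  by rewrite gt_eqF ?divr_gt0 ?area_gt0 ?dual_vol_gt0//= => /eqP.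
move=> K; move: mean0; under eq_bigr => L _ do rewrite (cst L K).
rewrite -mulr_suml sum_vol => /eqP; rewrite mulf_eq0 gt_eqF ?vol_Omega_gt0//=.
by move/eqP.
Qed.

(** For x >= y > 0 and gamma >= 1, x^gamma - y^gamma >= (x - y) x^(gamma - 1). This is used
with the maximal density for x, which is at least the mean. *)
Lemma density_oscillation gamma del (rho : density M) : 1 <= gamma ->
  (forall K, 0 < rho K) ->
  1 / 2 <= (vol_Omega M)^-1 * \sum_K vol K * rho K ->
  (forall K L, pressure gamma rho L - pressure gamma rho K <= del) ->
  forall K, `|rho K - (vol_Omega M)^-1 * \sum_L vol L * rho L| <=
    del / (1 / 2) `^ (gamma - 1).
Proof.
move=> g1 r0 mean osc K; set c := (1 / 2) `^ _.
have c0 : 0 < c by rewrite powR_gt0//; lra.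
have V0 := vol_Omega_gt0 M.
have meanE a : a = (vol_Omega M)^-1 * \sum_(L : cell M) vol L * a.
  by rewrite -mulr_suml sum_vol mulrA mulVf ?mul1r// gt_eqF.
set mbar := (vol_Omega M)^-1 * _ in mean *.
have [Kx Kmax] : exists Kx, forall L, rho L <= rho Kx.
  have [Kx _ Kmax] := @arg_maxP _ _ _ (cell_inhab M) xpredT rho isT.
  by exists Kx => L; exact: Kmax.
have mbar_le : mbar <= rho Kx.
  rewrite [leRHS]meanE /mbar ler_wpM2l ?invr_ge0 ?(ltW V0)//; apply: ler_sum => L _.
  by rewrite ler_pM2l ?vol_gt0.
have low L : rho Kx - del / c <= rho L.
  rewrite lerBlDr -lerBlDl ler_pdivlMr//; apply: le_trans (osc L Kx).
  have gE x : 0 < x -> x `^ gamma = x * x `^ (gamma - 1).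
    by move=> x0; rewrite mulr_powRB1 ?(ltW x0)// (lt_le_trans ltr01).
  rewrite /pressure !gE// mulrBl.
  have g0 : 0 <= gamma - 1 by rewrite subr_ge0.
  have cx : c <= rho Kx `^ (gamma - 1).
    by apply: ge0_ler_powR; rewrite ?nnegrE ?(ltW (r0 _))//; lra.
  have lx : rho L `^ (gamma - 1) <= rho Kx `^ (gamma - 1).
    by apply: ge0_ler_powR; rewrite ?nnegrE ?(ltW (r0 _)).
  have := ler_wpM2l (ltW (r0 L)) lx.
  have := @ler_wpM2l _ (rho Kx - rho L) _ _ _ cx; rewrite subr_ge0 Kmax => /(_ isT).
  lra.
have mbar_ge : rho Kx - del / c <= mbar.
  rewrite [leLHS]meanE /mbar ler_wpM2l ?invr_ge0 ?(ltW V0)//; apply: ler_sum => L _.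
  by rewrite ler_pM2l ?vol_gt0.
have := low K; have := Kmax K; rewrite ler_norml; lra.
Qed.

End consistency.

(** * Convergence of the prediction and of the correction steps *)

Section prediction.
Variables (R : realType) (d : nat) (M : mac_mesh R d).
Variables (mu dt : R) (divtau : velocity M -> velocity M).
Arguments divtau : clear implicits.
Hypotheses (mu0 : 0 < mu) (dt0 : 0 < dt).
Hypotheses (lin : linear_diffusion divtau) (coer : coercive_diffusion mu divtau).

(** Linear systems are indexed by one finite type, so the faces of all directions are
gathered in a single type. *)
Let all_faces := {i : 'I_d & face M i}.
Definition velocity_of (x : all_faces -> R) : velocity M :=
  fun i s => if internal s then x (existT _ i s) else 0.

Lemma velocity_of_discrete x : discrete_velocity (velocity_of x).
Proof. by move=> i s /negbTE; rewrite /velocity_of => ->. Qed.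

Lemma velocity_ofK (u : velocity M) : discrete_velocity u ->
  velocity_of (fun e => u (tag e) (tagged e)) = u.
Proof.
move=> du; apply: functional_extensionality_dep => i; apply/funext => s.
by rewrite /velocity_of /=; case: ifPn => // /du ->.
Qed.

(** The operator of the prediction step, extended by the identity to the external
faces, where the unknown vanishes. *)
Definition prediction_op (rho : density M) (u : velocity M) (x : all_faces -> R)
    (e : all_faces) : R :=
  if internal (tagged e) then
    dt^-1 * dual_density rho (tagged e) * velocity_of x (tagged e) +
    convection rho (velocity_of x) u (tagged e) - divtau (velocity_of x) _ (tagged e)
  else x e.

Lemma prediction_op_linear rho u : linear_op (prediction_op rho u).
Proof.
move=> a x y [i s]; rewrite /prediction_op /=; case: ifP => // si.
have -> : velocity_of (fun k => a * x k + y k) =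
    (fun k t => a * velocity_of x t + velocity_of y t).
  apply: functional_extensionality_dep => j; apply/funext => t.
  by rewrite /velocity_of; case: ifP => //; rewrite mulr0 addr0.
rewrite convection_linear lin//; [ring|exact: velocity_of_discrete..].
Qed.

Lemma prediction_cvg (rho rhop : nat -> density M) (u ut : nat -> velocity M)
    (ub : velocity M) (g : nat -> velocity M) (gb : velocity M) :
  (forall K, rho m K @[m --> \oo] --> (1 : R)) ->
  (forall K, rhop m K @[m --> \oo] --> (1 : R)) ->
  (forall i (s : face M i), u m i s @[m --> \oo] --> ub i s) ->
  (forall i (s : face M i), internal s -> g m i s @[m --> \oo] --> gb i s) ->
  (forall K, divergence ub K = 0) ->
  (forall m, discrete_velocity (ut m)) ->
  (forall m i (s : face M i), internal s ->
     dt^-1 * (dual_density (rho m) s * ut m i s - dual_density (rhop m) s * u m i s) +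
     convection (rho m) (ut m) (u m) s - divtau (ut m) i s + g m i s = 0) ->
  exists utb, [/\ discrete_velocity utb,
    forall i (s : face M i), ut m i s @[m --> \oo] --> utb i s &
    forall i (s : face M i), internal s ->
      dt^-1 * (utb i s - ub i s) + convection (fun=> 1) utb ub s - divtau utb i s +
      gb i s = 0].
Proof.
move=> rho1 rhop1 uu gg dub dut eqs.
have dd1 := @dual_density1 R d M.
pose x_ m (e : all_faces) := ut m (tag e) (tagged e).
pose b_ m (e : all_faces) := if internal (tagged e) then
  dt^-1 * dual_density (rhop m) (tagged e) * u m (tag e) (tagged e) - g m _ (tagged e) else 0.
pose b (e : all_faces) := if internal (tagged e) then
  dt^-1 * 1 * ub (tag e) (tagged e) - gb _ (tagged e) else 0.
have := @cvg_linear_system R _ (fun m => prediction_op (rho m) (u m))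
  (prediction_op (fun=> 1) ub) x_ b_ b.
case.
- by move=> m; exact: prediction_op_linear.
- exact: prediction_op_linear.
- move=> x [i s]; rewrite /prediction_op /=.
  case: (boolP (internal s)) => [si|_]; last exact: cvg_cst.
  apply: cvgB; last exact: cvg_cst.
  apply: cvgD; last exact: convection_cvg.
  apply: cvgM; last exact: cvg_cst.
  apply: cvgM; first exact: cvg_cst.
  by rewrite dd1//; exact: dual_density_cvg1.
- move=> x x0.
  have v0 : forall i (s : face M i), velocity_of x s = 0.
    apply: (prediction_inj mu0 dt0 coer (@velocity_of_discrete x) dub) => i s si.
    by have := x0 (existT _ i s); rewrite /prediction_op /= si dd1// mulr1.
  move=> [i s]; have := x0 (existT _ i s); have := v0 i s.
  by rewrite /velocity_of /prediction_op /=; case: ifP.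
- move=> [i s]; rewrite /b_ /b /=.
  case: (boolP (internal s)) => [si|_]; last exact: cvg_cst.
  apply: cvgB; last exact: gg.
  apply: cvgM; last exact: uu.
  by apply: cvgM; [exact: cvg_cst|exact: dual_density_cvg1].
- near=> m => -[i s]; rewrite /prediction_op /b_ /= velocity_ofK//.
  case: (boolP (internal s)) => [si|se]; last exact: (dut m i s se).
  apply/eqP; rewrite -subr_eq0 -[X in _ == X](eqs m i s si); apply/eqP; ring.
move=> x [xx Tx].
have utd i (s : face M i) : ~~ internal s -> x (existT _ i s) = 0.
  by move=> /negbTE se; have := Tx (existT _ i s); rewrite /prediction_op /b /= se.
exists (velocity_of x); split; first exact: velocity_of_discrete.
  move=> i s; rewrite /velocity_of; have := xx (existT _ i s); rewrite /x_ /=.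
  by case: (boolP (internal s)) => // /utd ->.
move=> i s si; have := Tx (existT _ i s); rewrite /prediction_op /b /= si dd1// !mulr1.
move/eqP; rewrite -subr_eq0 => /eqP <-; ring.
Unshelve. all: by end_near.
Qed.

End prediction.

Section correction.
Variables (R : realType) (d : nat) (M : mac_mesh R d).
Variable dt : R.
Hypothesis dt0 : 0 < dt.

(** The correction step is a discrete Darcy problem: taking the divergence of
g = u + dt grad p gives a discrete Poisson problem for p, and then u is recovered
from g. *)
Lemma correction_cvg (u g : nat -> velocity M) (p : nat -> density M) (gb : velocity M) :
  (forall m, discrete_velocity (u m)) ->
  (forall m, \sum_K vol K * p m K = 0) ->
  (forall m i (s : face M i), g m i s = u m i s + dt * grad (p m) s) ->
  (forall i (s : face M i), g m i s @[m --> \oo] --> gb i s) ->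
  (forall K, divergence (u m) K @[m --> \oo] --> (0 : R)) ->
  exists (ub : velocity M) (pb : density M),
    [/\ discrete_velocity ub,
        (forall i (s : face M i), u m i s @[m --> \oo] --> ub i s) /\
        (forall K, p m K @[m --> \oo] --> pb K),
        forall K, divergence ub K = 0,
        \sum_K vol K * pb K = 0 &
        forall i (s : face M i), gb i s = ub i s + dt * grad pb s].
Proof.
move=> du p0 gE gg divu.
have dtn0 : dt != 0 by rewrite gt_eqF.
have divE m K : divergence (u m) K =
    divergence (g m) K - dt * divergence (fun i s => grad (p m) s) K.
  have -> : u m = (fun i s => - dt * grad (p m) s + g m i s).
    apply: functional_extensionality_dep => i; apply/funext => s.
    by rewrite gE; ring.
  by rewrite divergence_linear mulNr addrC.
have divg K : divergence (g m) K @[m --> \oo] --> divergence gb K.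
  by apply: (@div_mass_cvg _ _ _ (fun=> fun=> 1)) => // L; exact: cvg_cst.
have [||||pb [pp _]] := @cvg_linear_system R (cell M) (fun=> @pressure_op _ _ M)
    (@pressure_op _ _ M) p
    (fun m K => vol K * dt^-1 * (divergence (u m) K - divergence (g m) K))
    (fun K => vol K * dt^-1 * (0 - divergence gb K)) (fun=> @pressure_op_linear _ _ M)
    (@pressure_op_linear _ _ M).
- by move=> x e; exact: cvg_cst.
- exact: pressure_op_inj.
- by move=> K; apply: cvgM; [exact: cvg_cst|apply: cvgB; [exact: divu|exact: divg]].
- near=> m => K; rewrite /pressure_op p0 divE; field; exact: dtn0.
pose ub : velocity M := fun i s => gb i s - dt * grad pb s.
have uu i (s : face M i) : u m i s @[m --> \oo] --> ub i s.
  have -> : (fun m => u m i s) = (fun m => g m i s - dt * grad (p m) s).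
    by apply/funext => m; rewrite gE addrK.
  by apply: cvgB; [exact: gg|apply: cvgM; [exact: cvg_cst|exact: grad_cvg]].
exists ub, pb; split => //.
- move=> i s se; have us := uu i s.
  have u0 : u m i s @[m --> \oo] --> (0 : R).
    by under eq_fun do rewrite du//; exact: cvg_cst.
  exact: (cvg_unique _ us u0).
- move=> K; have d1 : divergence (u m) K @[m --> \oo] --> divergence ub K.
    by apply: (@div_mass_cvg _ _ _ (fun=> fun=> 1)) => // L; exact: cvg_cst.
  exact: (cvg_unique _ d1 (divu K)).
- have s1 : \sum_K vol K * p m K @[m --> \oo] --> \sum_K vol K * pb K.
    by apply: cvg_sumr => K _; apply: cvgM; [exact: cvg_cst|exact: pp].
  have s0 : \sum_K vol K * p m K @[m --> \oo] --> (0 : R).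
    by under eq_fun do rewrite p0; exact: cvg_cst.
  exact: (cvg_unique _ s1 s0).
- by move=> i s; rewrite /ub subrK.
Unshelve. all: by end_near.
Qed.

End correction.

(** * Convergence of one time step *)

Section one_step.
Variables (R : realType) (d : nat) (M : mac_mesh R d).

Lemma near_faces (P : forall i, face M i -> nat -> Prop) :
  (forall i (s : face M i), \forall m \near \oo, P i s m) ->
  \forall m \near \oo, forall i (s : face M i), P i s m.
Proof.
move=> FP; have FP' : \forall m \near \oo, forall e : {i : 'I_d & face M i},
    P (tag e) (tagged e) m by apply: filter_forall => e; exact: FP.
by apply: filterS FP' => m Pm i s; exact: (Pm (existT _ i s)).
Qed.

Lemma dual_density_gt0 (rho : density M) i (s : face M i) : internal s ->
  (forall K, 0 < rho K) -> 0 < dual_density rho s.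
Proof.
move=> si r0; rewrite /dual_density mulr_gt0 ?invr_gt0 ?dual_vol_gt0//.
move/internalP: si => [K [L [sK sL]]]; rewrite big_bool /= sK sL.
by rewrite addr_gt0// mulr_gt0// divr_gt0// vol_gt0.
Qed.

(** The upwind densities tend to 1, and the velocities are bounded: the mass fluxes and the
volume fluxes have the same limit. *)
Lemma divergence_cvg0 (rho : nat -> density M) (u : nat -> velocity M)
    (B : forall i, face M i -> R) :
  (forall K, rho m K @[m --> \oo] --> (1 : R)) ->
  (forall i (s : face M i), \forall m \near \oo, `|u m i s| <= B i s) ->
  (forall K, div_mass (rho m) (u m) K @[m --> \oo] --> (0 : R)) ->
  forall K, divergence (u m) K @[m --> \oo] --> (0 : R).
Proof.
move=> rho1 uB div0 K.
pose e m i b := sgn R b * (face_flux (fun=> 1) (u m) (face_of K i b) -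
  face_flux (rho m) (u m) (face_of K i b)).
have -> : (fun m => divergence (u m) K) = (fun m => div_mass (rho m) (u m) K +
    (vol K)^-1 * \sum_i \sum_b e m i b).
  apply/funext => m; rewrite /divergence /div_mass -mulrDr; congr (_ * _).
  rewrite -big_split; apply: eq_bigr => i _; rewrite -big_split; apply: eq_bigr => b _ /=.
  by rewrite !fluxE /e; ring.
rewrite -[X in _ --> X]addr0; apply: cvgD; first exact: div0.
rewrite -[X in _ --> X](mulr0 (vol K)^-1); apply: cvgM; first exact: cvg_cst.
rewrite [X in _ --> X](_ : 0 = \sum_(i < d) \sum_(b : bool) 0 :> R); last first.
  by rewrite big1// => i _; rewrite big1.
apply: cvg_sumr => i _; apply: cvg_sumr => b _; rewrite /e.
rewrite -[X in _ --> X](mulr0 (sgn R b)); apply: cvgM; first exact: cvg_cst.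
move: (face_of K i b) => s; rewrite /face_flux.
case: (side s false) => [K1|]; last by rewrite subrr; exact: cvg_cst.
case: (side s true) => [L1|]; last by rewrite subrr; exact: cvg_cst.
under eq_fun do rewrite if_same mulr1 -mulrBl -[X in X - _]mulr1 -mulrBr.
apply: cvg0_mul_bounded (uB i s).
rewrite -[X in _ --> X](mulr0 (area s)); apply: cvgM; first exact: cvg_cst.
rewrite -[X in _ --> X](subrr (1 : R)); apply: cvgB; first exact: cvg_cst.
exact: cvg_upwind.
Qed.

Variables (gamma mu dt : R) (divtau : velocity M -> velocity M).
Arguments divtau : clear implicits.
Hypotheses (gamma1 : 1 <= gamma) (mu0 : 0 < mu) (dt0 : 0 < dt).
Hypotheses (lin : linear_diffusion divtau) (coer : coercive_diffusion mu divtau).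
Variable eps : nat -> R.
Hypotheses (eps_gt0 : forall m, 0 < eps m) (eps0 : eps m @[m --> \oo] --> (0 : R)).

Lemma eps2_cvg0 (C : R) : C * eps m ^+ 2 @[m --> \oo] --> (0 : R).
Proof.
rewrite -[X in _ --> X](mulr0 C) -[X in _ * X](mulr0 0).
by apply: cvgM; [exact: cvg_cst|under eq_fun do rewrite expr2; exact: cvgM].
Qed.

(** The induction step. The velocity at the end of the step is an explicit part h, which
converges, minus a multiple of the new scaled pressure gradient, which is only known to
be bounded at first. *)
Lemma time_step_cvg (rhop rho rho' : nat -> density M) (u ut u' : nat -> velocity M)
    (ub : velocity M) (pb : density M) :
  (forall m K, 0 < rho m K) -> (forall m K, 0 < rho' m K) ->
  (forall m, discrete_velocity (ut m)) -> (forall m, discrete_velocity (u' m)) ->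
  (forall K, rhop m K @[m --> \oo] --> (1 : R)) ->
  (forall K, rho m K @[m --> \oo] --> (1 : R)) ->
  (forall i (s : face M i), u m i s @[m --> \oo] --> ub i s) ->
  (forall K, divergence ub K = 0) ->
  (forall K, scaled_pressure gamma (eps m) (rho m) K @[m --> \oo] --> pb K) ->
  (forall m i (s : face M i), internal s ->
     dt^-1 * (dual_density (rho m) s * ut m i s - dual_density (rhop m) s * u m i s) +
     convection (rho m) (ut m) (u m) s - divtau (ut m) i s +
     (eps m ^+ 2)^-1 * corrected_grad gamma (rhop m) (rho m) s = 0) ->
  (forall m i (s : face M i), internal s ->
     dt^-1 * (dual_density (rho m) s * (u' m i s - ut m i s)) +
     (eps m ^+ 2)^-1 * grad (pressure gamma (rho' m)) s -
     (eps m ^+ 2)^-1 * corrected_grad gamma (rhop m) (rho m) s = 0) ->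
  (forall m K, dt^-1 * (rho' m K - rho m K) + div_mass (rho' m) (u' m) K = 0) ->
  exists (utb ub' : velocity M) (pb' : density M),
    [/\ [/\ discrete_velocity utb, discrete_velocity ub',
            forall K, divergence ub' K = 0 & \sum_K vol K * pb' K = 0],
        [/\ forall K, rho' m K @[m --> \oo] --> (1 : R),
            forall i (s : face M i), u' m i s @[m --> \oo] --> ub' i s &
            forall K, scaled_pressure gamma (eps m) (rho' m) K @[m --> \oo] --> pb' K],
        forall i (s : face M i), internal s ->
          dt^-1 * (utb i s - ub i s) + convection (fun=> 1) utb ub s - divtau utb i s +
          grad pb s = 0 &
        forall i (s : face M i), internal s ->
          dt^-1 * (ub' i s - utb i s) + grad pb' s - grad pb s = 0].
Proof.
move=> r0 r'0 dut du' rhop1 rho1 uu dub pp E1 E2 E3.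
have dtn0 : dt != 0 by rewrite gt_eqF.
pose g m i (s : face M i) := (eps m ^+ 2)^-1 * corrected_grad gamma (rhop m) (rho m) s.
have gg i (s : face M i) : internal s -> g m i s @[m --> \oo] --> grad pb s.
  move=> si; rewrite /g /corrected_grad -[X in _ --> X]mul1r.
  under eq_fun do rewrite mulrCA -grad_scaled_pressure.
  apply: cvgM; last exact: grad_cvg.
  rewrite -(@sqrtr1 R); apply: (continuous_cvg _ (@sqrt_continuous R 1)).
  rewrite -[X in _ --> X]divr1; apply: cvgM; first exact: dual_density_cvg1.
  by apply: cvgV; [exact: oner_neq0|exact: dual_density_cvg1].
have [utb [dutb utt Eutb]] := @prediction_cvg R d M mu dt divtau mu0 dt0 lin coer rho rhop u
  ut ub g (fun i s => grad pb s) rho1 rhop1 uu gg dub dut E1.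
pose a m i (s : face M i) := dt / dual_density (rho m) s.
pose h m i (s : face M i) := if internal s then ut m i s + a m i s * g m i s else 0.
have u'E m i (s : face M i) : internal s ->
    u' m i s = h m i s - a m i s * ((eps m ^+ 2)^-1 * grad (pressure gamma (rho' m)) s).
  move=> si; have dd := dual_density_gt0 si (r0 m).
  have := E2 m i s si; rewrite /h si /a -/(g m i s) => /(congr1 (fun x =>
    dt / dual_density (rho m) s * x)); rewrite mulr0 => E.
  apply/eqP; rewrite -subr_eq0 -E; apply/eqP; field.
  by rewrite dtn0 !gt_eqF.
have aa i (s : face M i) : internal s -> a m i s @[m --> \oo] --> dt.
  move=> si; rewrite -[X in _ --> X](mulr1 dt) -[X in _ * X]invr1.
  apply: cvgM; first exact: cvg_cst.
  by apply: cvgV; [exact: oner_neq0|exact: dual_density_cvg1].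
pose hb i (s : face M i) := if internal s then utb i s + dt * grad pb s else 0.
have hh i (s : face M i) : h m i s @[m --> \oo] --> hb i s.
  rewrite /h /hb; case: (boolP (internal s)) => [si|_]; last exact: cvg_cst.
  by apply: cvgD; [exact: utt|apply: cvgM; [exact: aa|exact: gg]].
pose W := 1 + \sum_i \sum_(s : face M i) `|hb i s|.
have W0 : 0 <= W by rewrite addr_ge0// sumr_ge0// => i _; rewrite sumr_ge0.
have near_h : \forall m \near \oo, forall i (s : face M i), `|h m i s| <= W.
  apply: near_faces => i s.
  have : \forall m \near \oo, `|h m i s| < `|hb i s| + 1.
    by apply: (cvgr_norm_lt (hb i s)) => //; rewrite ltrDl.
  apply: filterS => m /ltW/le_trans; apply.
  rewrite /W addrC lerD2l (bigD1 i)//= (bigD1 s)//= -addrA lerDl addr_ge0//.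
    by apply: sumr_ge0.
  by apply: sumr_ge0 => j _; apply: sumr_ge0.
have neara : \forall m \near \oo, forall i (s : face M i), internal s -> dt / 2 <= a m i s.
  apply: near_faces => i s; case: (boolP (internal s)) => [si|_]; last exact: nearW.
  have : \forall m \near \oo, dt / 2 < a m i s.
    by apply: (cvgr_gt dt (aa i s si)); rewrite ltr_pdivrMr// ltr_pMr// ltr1n.
  by apply: filterS => m /ltW.
have nearr : \forall m \near \oo, forall K, 1 / 2 <= rho m K <= 2.
  apply: filter_forall => K.
  have r1 : \forall m \near \oo, 1 / 2 < rho m K.
    by apply: (cvgr_gt 1 (rho1 K)); lra.
  have r2 : \forall m \near \oo, rho m K < 2.
    by apply: (cvgr_lt 1 (rho1 K)); lra.
  by apply: filterS2 r1 r2 => m x y; rewrite !ltW.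
have [C C0 osc] := pressure_oscillation M dt0 W0 (divr_gt0 dt0 (ltr0n R 2)).
have nearp : \forall m \near \oo, forall K L,
    pressure gamma (rho' m) L - pressure gamma (rho' m) K <= C * eps m ^+ 2.
  near=> m => K L; apply: (osc gamma (eps m) (rho m) (rho' m) (u' m) (h m) (a m)).
  - exact: gamma1.
  - exact: eps_gt0.
  - by near: m.
  - exact: r'0.
  - exact: E3.
  - move=> i s si; split; first exact: u'E.
      by move: i s si; near: m; apply: filterS near_h.
    by move: i s si; near: m.
pose mean m := (vol_Omega M)^-1 * \sum_K vol K * rho' m K.
have mean1 : mean m @[m --> \oo] --> (1 : R).
  have -> : mean = (fun m => (vol_Omega M)^-1 * \sum_K vol K * rho m K).
    by apply/funext => m; rewrite /mean (mass_conserved dt0 (E3 m)).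
  rewrite -[X in _ --> X](@mulVf _ (vol_Omega M)) ?gt_eqF ?vol_Omega_gt0//.
  apply: cvgM; first exact: cvg_cst.
  rewrite -[X in _ --> X]sum_vol; apply: cvg_sumr => K _.
  by rewrite -[X in _ --> X]mulr1; apply: cvgM; [exact: cvg_cst|exact: rho1].
have near_mean : \forall m \near \oo, 1 / 2 <= mean m.
  have : \forall m \near \oo, 1 / 2 < mean m by apply: (cvgr_gt 1 mean1); lra.
  by apply: filterS => m /ltW.
have rho'1 K : rho' m K @[m --> \oo] --> (1 : R).
  pose c : R := (1 / 2) `^ (gamma - 1).
  have diff0 : rho' m K - mean m @[m --> \oo] --> (0 : R).
    apply: norm_cvg0; apply: (@squeeze_cvgr _ _ _ _ (fun=> 0) (fun m => C / c * eps m ^+ 2)).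
    - near=> m; rewrite normr_ge0 /= mulrAC; apply: density_oscillation => //.
        by near: m.
      by near: m.
    - exact: cvg_cst.
    - exact: eps2_cvg0.
  have -> : rho'^~ K = (fun m => (rho' m K - mean m) + mean m).
    by apply/funext => m; rewrite subrK.
  by rewrite -[X in _ --> X]add0r; exact: cvgD.
pose dp m := scaled_pressure gamma (eps m) (rho' m).
have near_jump i (s : face M i) : \forall m \near \oo, `|grad (dp m) s| <=
    area s / dual_vol s * C.
  apply: filterS nearp => m osc_m; rewrite gradE normrM ger0_norm; last first.
    by rewrite divr_ge0 ?dual_vol_ge0// ltW// area_gt0.
  rewrite ler_wpM2l ?divr_ge0 ?dual_vol_ge0 ?(ltW (area_gt0 _))//.
  rewrite jump_scaled_pressure normrM ger0_norm ?invr_ge0 ?sqr_ge0//.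
  rewrite mulrC ler_pdivrMr ?exprn_gt0// /jump.
  have Ce0 : 0 <= C * eps m ^+ 2 by rewrite mulr_ge0 ?sqr_ge0// ltW.
  case: side => [K|]; last by rewrite normr0.
  case: side => [L|]; last by rewrite normr0.
  by rewrite ler_norml osc_m lerNl opprB osc_m.
have near_u i (s : face M i) : \forall m \near \oo, `|u' m i s| <=
    W + 2 * dt * (area s / dual_vol s * C).
  have B0 : 0 <= area s / dual_vol s * C.
    by rewrite mulr_ge0 ?divr_ge0 ?dual_vol_ge0// ltW// area_gt0.
  case: (boolP (internal s)) => [si|se]; last first.
    by near=> m; rewrite (du' m i s se) normr0 addr_ge0// mulr_ge0// mulr_ge0// ltW.
  have near_a : \forall m \near \oo, `|a m i s| < 2 * dt.
    by apply: (cvgr_norm_lt dt (aa i s si)); rewrite gtr0_norm//; have := dt0; lra.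
  have near_hs : \forall m \near \oo, `|h m i s| <= W.
    by apply: filterS near_h => m; exact.
  near=> m; rewrite u'E// -grad_scaled_pressure.
  apply: (le_trans (ler_normB _ _)); apply: lerD; first by near: m.
  rewrite normrM; apply: ler_pM => //.
    by apply: ltW; near: m.
  by near: m; exact: near_jump.
have div0 K : div_mass (rho' m) (u' m) K @[m --> \oo] --> (0 : R).
  have -> : (fun m => div_mass (rho' m) (u' m) K) =
      (fun m => - dt^-1 * (rho' m K - rho m K)).
    apply/funext => m; apply/eqP; rewrite -subr_eq0 mulNr opprK addrC.
    by rewrite E3.
  rewrite -[X in _ --> X](mulr0 (- dt^-1)) -[X in _ * X](subrr (1 : R)).
  by apply: cvgM; [exact: cvg_cst|apply: cvgB; [exact: rho'1|exact: rho1]].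
have divu := divergence_cvg0 rho'1 near_u div0.
(* u' + dt * grad dp differs from h by (dt - a) * grad dp, where a tends to dt and grad dp
   is bounded *)
have [] := @correction_cvg R d M dt dt0 u' (fun m i s => u' m i s + dt * grad (dp m) s) dp hb
  du' (fun m => sum_scaled_pressure _ _ _) (fun=> fun=> fun=> erefl) _ divu.
  move=> i s; case: (boolP (internal s)) => [si|se]; last first.
    have -> : (fun m => u' m i s + dt * grad (dp m) s) = (fun=> 0).
      by apply/funext => m; rewrite du'// grad_external// mulr0 addr0.
    by rewrite /hb (negbTE se); exact: cvg_cst.
  have -> : (fun m => u' m i s + dt * grad (dp m) s) =
      (fun m => h m i s + (dt - a m i s) * grad (dp m) s).
    by apply/funext => m; rewrite u'E// -grad_scaled_pressure; ring.
  rewrite -[X in _ --> X]addr0; apply: cvgD; first exact: hh.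
  apply: cvg0_mul_bounded (near_jump i s).
  by rewrite -[X in _ --> X](subrr dt); apply: cvgB; [exact: cvg_cst|exact: aa].
move=> ub' [pb' [dub' [uu' pp'] divub' mean0 Eb]].
exists utb, ub', pb'; split => // i s si.
have := Eb i s; rewrite /hb si => E.
apply/eqP; rewrite subr_eq0 -(inj_eq (mulfI dtn0)) mulrDr mulVKf//; apply/eqP.
lra.
Unshelve. all: by end_near.
Qed.

End one_step.

(** * Subsequences, uniqueness of the limit scheme and induction on time *)

Section subsequences.
Variable R : realType.

Lemma increasing_seq_ge (f : nat -> nat) : increasing_seq f -> forall n, (n <= f n)%N.
Proof.
move=> fi; elim=> // n IH; apply: leq_ltn_trans IH _.
have := fi n.+1 n; rewrite !leEnat ltnn => /negbT; by rewrite -ltnNge.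
Qed.

Lemma increasing_seq_comp (f g : nat -> nat) :
  increasing_seq f -> increasing_seq g -> increasing_seq (f \o g).
Proof. by move=> fi gi n m; rewrite /= fi; exact: gi. Qed.

Lemma cvg_subseq (a : nat -> R) (f : nat -> nat) (l : R) : increasing_seq f ->
  a m @[m --> \oo] --> l -> a (f m) @[m --> \oo] --> l.
Proof.
move=> fi /cvgrPdist_lt al; apply/cvgrPdist_lt => e e0.
have [N _ aN] := al e e0; exists N => // n /= Nn; apply: aN => /=.
exact: leq_trans Nn (increasing_seq_ge fi n).
Qed.

Lemma finite_bolzano_weierstrass (E : finType) (a : nat -> E -> R) (B : R) :
  (forall m e, `|a m e| <= B) ->
  exists psi : nat -> nat, increasing_seq psi /\
  exists l : E -> R, forall e, a (psi m) e @[m --> \oo] --> l e.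
Proof.
move=> aB; suff [psi [psi_i psiP]] : exists psi : nat -> nat, increasing_seq psi /\
    forall e, e \in enum E -> exists l : R, a (psi m) e @[m --> \oo] --> l.
  have : forall e, exists l : R, a (psi m) e @[m --> \oo] --> l.
    by move=> e; apply: psiP; rewrite mem_enum.
  by move=> /boolp.choice[l lP]; exists psi; split => //; exists l.
elim: (enum E) => [|e r [psi [psi_i psiP]]].
  by exists id; split.
have [|f fi /cvg_ex[l fl]] := @bolzano_weierstrass R (fun m => a (psi m) e).
  exists B; split; first exact: num_real.
  by move=> x Bx m _ /=; rewrite (le_trans (aB _ _))// ltW.
exists (psi \o f); split; first exact: increasing_seq_comp.
move=> e'; rewrite inE => /orP[/eqP->|/psiP[l' al']]; first by exists l.
by exists l'; exact: (cvg_subseq fi al').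
Qed.

(** Otherwise some subsequence would stay away from the limit. *)
Lemma cvg_subsubseq (a : nat -> R) (l : R) :
  (forall phi : nat -> nat, increasing_seq phi -> exists2 psi : nat -> nat,
     increasing_seq psi & a (phi (psi m)) @[m --> \oo] --> l) ->
  a m @[m --> \oo] --> l.
Proof.
move=> sub; apply/cvgrPdist_lt => e e0; apply: contrapT => far.
have {}far N : exists m, (N <= m)%N /\ e <= `|l - a m|.
  apply: contrapT => no; apply: far; exists N => // m /= Nm.
  by rewrite ltNge; apply/negP => ea; apply: no; exists m.
have [f fP] := boolp.choice far.
pose phi n := iter n (fun k => f k.+1) (f 0%N).
have phi_i : increasing_seq phi.
  by apply/increasing_seqP => n; rewrite /phi iterS ltEnat /=; case: (fP (iter n (fun k => f k.+1) (f 0%N)).+1).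
have phi_e n : e <= `|l - a (phi n)|.
  case: n => [|n]; rewrite /phi ?iterS; first by case: (fP 0%N).
  by case: (fP (iter n (fun k => f k.+1) (f 0%N)).+1).
have [psi _ /cvgrPdist_lt/(_ e e0)[N _ NP]] := sub phi phi_i.
have := NP N (leqnn N); rewrite ltNge => /negP; apply; exact: phi_e.
Qed.

End subsequences.

Section time_induction.
Variables (R : realType) (d : nat) (M : mac_mesh R d).
Variables (gamma mu dt : R) (divtau : velocity M -> velocity M) (N : nat).
Hypotheses (gamma1 : 1 <= gamma) (mu0 : 0 < mu) (dt0 : 0 < dt).
Hypotheses (lin : linear_diffusion divtau) (coer : coercive_diffusion mu divtau).

Lemma diffusion_sub (v w : velocity M) i (s : face M i) :
  discrete_velocity v -> discrete_velocity w -> internal s ->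
  divtau (fun k t => v k t - w k t) s = divtau v s - divtau w s.
Proof.
move=> dv dw si; have -> : (fun k t => v k t - w k t) = (fun k t => -1 * w k t + v k t).
  apply: functional_extensionality_dep => j; apply/funext => t; ring.
by rewrite lin//; ring.
Qed.

(** At each step, the difference of two solutions lies in the kernel of the prediction
operator, and then in that of the discrete Poisson operator. *)
Lemma incompressible_unique (v w : nat -> velocity M) (r q : nat -> density M) :
  incompressible_solution divtau dt N v r -> incompressible_solution divtau dt N w q ->
  v 0%N = w 0%N -> r 0%N = q 0%N -> (forall K, divergence (v 0%N) K = 0) ->
  forall n, (n <= N)%N -> v n = w n /\ r n = q n.
Proof.
move=> [vt [vd vtd veq]] [wt [wd wtd weq]] v0 r0 div0.
have dtn0 : dt != 0 by rewrite gt_eqF.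
suff : forall n, (n <= N)%N -> [/\ v n = w n, r n = q n & forall K, divergence (v n) K = 0].
  by move=> H n /H[].
elim=> [_//|n IH nN]; have [vw rq divn] := IH (ltnW nN).
have [v1 v2 v3] := veq n nN; have [w1 w2 w3] := weq n nN.
have vtwt : vt n.+1 = wt n.+1.
  have z : forall i (s : face M i), vt n.+1 i s - wt n.+1 i s = 0.
    apply: (@prediction_inj _ _ _ mu dt divtau (v n) (fun i s => vt n.+1 i s - wt n.+1 i s)
      mu0 dt0 coer _ divn) => [i s se|i s si].
      by rewrite (vtd n nN)// (wtd n nN)// subrr.
    rewrite diffusion_sub//; [|exact: vtd|exact: wtd].
    have -> : convection (fun=> 1) (fun k t => vt n.+1 k t - wt n.+1 k t) (v n) s =
        convection (fun=> 1) (vt n.+1) (v n) s - convection (fun=> 1) (wt n.+1) (v n) s.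
      have -> : (fun k t => vt n.+1 k t - wt n.+1 k t) =
          (fun k t => -1 * wt n.+1 k t + vt n.+1 k t).
        by apply: functional_extensionality_dep => j; apply/funext => t; ring.
      by rewrite convection_linear; ring.
    have := v1 i s si; have := w1 i s si; rewrite -vw -rq => E1 E2.
    by rewrite -[RHS](subrr (0 : R)) -{1}E2 -E1; ring.
  apply: functional_extensionality_dep => i; apply/funext => s.
  by apply/eqP; rewrite -subr_eq0; apply/eqP.
have [dv mv] := vd _ nN; have [dw mw] := wd _ nN.
have E i (s : face M i) :
    v n.+1 i s - w n.+1 i s = - dt * grad (fun K => -1 * q n.+1 K + r n.+1 K) s.
  case: (boolP (internal s)) => [si|se]; last first.
    by rewrite dv// dw// grad_external// mulr0 subrr.
  have := v2 i s si; have := w2 i s si; rewrite grad_linear -vtwt -rq => E1 E2.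
  have : dt^-1 * (v n.+1 i s - w n.+1 i s) = grad (q n.+1) s - grad (r n.+1) s by lra.
  by move/(congr1 ( *%R dt)); rewrite mulVKf// => ->; ring.
have z : forall K, -1 * q n.+1 K + r n.+1 K = 0.
  apply: pressure_op_inj => K; rewrite /pressure_op.
  have -> : \sum_L vol L * (-1 * q n.+1 L + r n.+1 L) = 0.
    transitivity (- (\sum_L vol L * q n.+1 L) + \sum_L vol L * r n.+1 L); last first.
      by rewrite mv mw oppr0 addr0.
    by rewrite -sumrN -big_split; apply: eq_bigr => L _ /=; ring.
  have -> : (fun i s => grad (fun K => -1 * q n.+1 K + r n.+1 K) s) =
      (fun i (s : face M i) => - dt^-1 * v n.+1 i s + dt^-1 * w n.+1 i s).
    apply: functional_extensionality_dep => j; apply/funext => t.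
    apply: (mulfI dtn0); rewrite mulrDr mulNr mulrN !mulVKf//.
    by have := E j t; lra.
  rewrite divergence_linear v3.
  have -> : (fun i (s : face M i) => dt^-1 * w n.+1 i s) =
      (fun i s => (dt^-1 - 1) * w n.+1 i s + w n.+1 i s).
    by apply: functional_extensionality_dep => j; apply/funext => t; ring.
  by rewrite divergence_linear w3; ring.
have rq' : r n.+1 = q n.+1.
  by apply/funext => K; have := z K; lra.
split => //.
apply: functional_extensionality_dep => i; apply/funext => s.
apply/eqP; rewrite -subr_eq0 E grad_linear rq'; apply/eqP; ring.
Qed.

Variable eps : nat -> R.
Hypotheses (eps_gt0 : forall m, 0 < eps m) (eps0 : eps m @[m --> \oo] --> (0 : R)).

(** The density of step -1 tends to 1 as well, because the initial velocities become
divergence free. *)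
Lemma scheme_cvg (rho0 : R -> Rd R d -> R) (u0 : R -> 'I_d -> Rd R d -> R)
    (Du0 : R -> 'I_d -> 'I_d -> Rd R d -> R)
    (rho : nat -> nat -> density M) (u : nat -> nat -> velocity M)
    (ulim0 : velocity M) (dplim0 : density M) :
  (forall m, compressible_solution gamma divtau dt N (eps m) (rho0 (eps m))
     (u0 (eps m)) (Du0 (eps m)) (rho m) (u m)) ->
  (forall K, rho m 0%N K @[m --> \oo] --> (1 : R)) ->
  (forall i (s : face M i), u m 0%N i s @[m --> \oo] --> ulim0 i s) ->
  (forall K, divergence ulim0 K = 0) ->
  (forall K, scaled_pressure gamma (eps m) (rho m 0%N) K @[m --> \oo] --> dplim0 K) ->
  exists (ulim : nat -> velocity M) (dplim : nat -> density M),
  [/\ incompressible_solution divtau dt N ulim dplim,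
      ulim 0%N = ulim0 /\ dplim 0%N = dplim0 &
      forall n, (n <= N)%N ->
        [/\ forall K, rho m n K @[m --> \oo] --> (1 : R),
            forall i (s : face M i), u m n i s @[m --> \oo] --> ulim n i s &
            forall K, scaled_pressure gamma (eps m) (rho m n) K @[m --> \oo] -->
              dplim n K]].
Proof.
move=> sol rho1 uu divu pp.
have [rhom1 {}sol] := boolp.choice sol; have [ut {}sol] := boolp.choice sol.
have rhom11 K : rhom1 m K @[m --> \oo] --> (1 : R).
  have -> : rhom1^~ K = (fun m => rho m 0%N K + dt * div_mass (rho m 0%N) (u m 0%N) K).
    apply/funext => m; have [[_ _ H] _ _ _] := sol m; move: (H K).
    move/(congr1 ( *%R dt)); rewrite mulr0 mulrDr mulVKf ?gt_eqF//; lra.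
  rewrite -[X in _ --> X]addr0 -[X in _ --> _ + X](mulr0 dt) -(divu K).
  apply: cvgD; first exact: rho1.
  by apply: cvgM; [exact: cvg_cst|exact: div_mass_cvg].
have du m n : (n <= N)%N -> discrete_velocity (u m n).
  by case: (sol m) => _ H _ _ /H[].
have pos m n : (n <= N)%N -> forall K, 0 < rho m n K.
  by case: (sol m) => _ H _ _ /H[].
pose ulim n : velocity M := fun i s => lim (u m n i s @[m --> \oo]).
pose dplim n : density M := fun K =>
  lim (scaled_pressure gamma (eps m) (rho m n) K @[m --> \oo]).
pose good n := [/\ (forall K, prev_density (rhom1 m) (rho m) n K @[m --> \oo] --> (1 : R)),
   (forall K, rho m n K @[m --> \oo] --> (1 : R)),
   (forall i (s : face M i), u m n i s @[m --> \oo] --> ulim n i s),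
   (forall K, scaled_pressure gamma (eps m) (rho m n) K @[m --> \oo] --> dplim n K) &
   (forall K, divergence (ulim n) K = 0)].
have step n : (n < N)%N -> good n -> good n.+1 /\ exists utb : velocity M,
  [/\ discrete_velocity utb,
      forall i (s : face M i), internal s ->
        dt^-1 * (utb i s - ulim n i s) + convection (fun=> 1) utb (ulim n) s -
        divtau utb s + grad (dplim n) s = 0 &
      forall i (s : face M i), internal s ->
        dt^-1 * (ulim n.+1 i s - utb i s) + grad (dplim n.+1) s - grad (dplim n) s = 0].
  move=> nN [c1 c2 c3 c4 c5].
  have [] := @time_step_cvg R d M gamma mu dt divtau gamma1 mu0 dt0 lin coer eps eps_gt0 eps0
    (fun m => prev_density (rhom1 m) (rho m) n) (fun m => rho m n) (fun m => rho m n.+1)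
    (fun m => u m n) (fun m => ut m n.+1) (fun m => u m n.+1) (ulim n) (dplim n)
    (fun m => pos m _ (ltnW nN)) (fun m => pos m _ nN) _ (fun m => du m _ nN) c1 c2 c3 c5 c4.
  - by move=> m; case: (sol m) => _ _ H _; exact: H.
  - by move=> m; case: (sol m) => _ _ _ /(_ n nN)[].
  - by move=> m; case: (sol m) => _ _ _ /(_ n nN)[].
  - by move=> m; case: (sol m) => _ _ _ /(_ n nN)[].
  move=> utb [ub' [pb' [[dutb dub' divub' mean0] [r1 uu' pp'] E1 E2]]].
  have ubE : ub' = ulim n.+1.
    apply: functional_extensionality_dep => i; apply/funext => s.
    by rewrite /ulim; symmetry; apply: (cvg_lim (@Rhausdorff R)); exact: uu'.
  have pbE : pb' = dplim n.+1.
    by apply/funext => K; symmetry; apply: (cvg_lim (@Rhausdorff R)); exact: pp'.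
  rewrite /good -ubE -pbE; split; [split|exists utb; split] => //; exact: c2.
have ulim0E : ulim 0%N = ulim0.
  apply: functional_extensionality_dep => i; apply/funext => s.
  by apply: (cvg_lim (@Rhausdorff R)); exact: uu.
have dplim0E : dplim 0%N = dplim0.
  by apply/funext => K; apply: (cvg_lim (@Rhausdorff R)); exact: pp.
have good_all n : (n <= N)%N -> good n.
  elim: n => [_|n IH nN]; first (by split; [exact: rhom11|exact: rho1|rewrite ulim0E|rewrite dplim0E|rewrite ulim0E]).
  by case: (step n nN (IH (ltnW nN))).
exists ulim, dplim; split; last by move=> n /good_all[].
  have : forall n, exists utb : velocity M, (n < N)%N -> 
    [/\ discrete_velocity utb,
      forall i (s : face M i), internal s ->
        dt^-1 * (utb i s - ulim n i s) + convection (fun=> 1) utb (ulim n) s -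
        divtau utb s + grad (dplim n) s = 0 &
      forall i (s : face M i), internal s ->
        dt^-1 * (ulim n.+1 i s - utb i s) + grad (dplim n.+1) s - grad (dplim n) s = 0].
    move=> n; case: (boolP (n < N)%N) => nN; last by exists (ulim n).
    by have [_ [utb utbP]] := step n nN (good_all _ (ltnW nN)); exists utb.
  move=> /boolp.choice[utb utbP]; exists (fun n => utb n.-1); split.
  - move=> n nN; have [_ _ c3 c4 _] := good_all n nN; split.
      move=> i s se; have u0' : u m n i s @[m --> \oo] --> (0 : R).
        by under eq_fun do rewrite (du _ _ nN)//; exact: cvg_cst.
      exact: (cvg_unique _ (c3 i s) u0').
    have s1 : \sum_K vol K * scaled_pressure gamma (eps m) (rho m n) K @[m --> \oo] -->
        \sum_K vol K * dplim n K.
      by apply: cvg_sumr => K _; apply: cvgM; [exact: cvg_cst|exact: c4].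
    have s0 : \sum_K vol K * scaled_pressure gamma (eps m) (rho m n) K @[m --> \oo] -->
        (0 : R).
      by under eq_fun do rewrite sum_scaled_pressure; exact: cvg_cst.
    exact: (cvg_unique _ s1 s0).
  - by move=> n /utbP[].
  - move=> n nN; have [a1 a2 a3] := utbP n nN; split => //.
    by have [] := good_all _ nN.
by split.
Qed.

End time_induction.

(** * Lebesgue measure of boxes and insertion of a coordinate *)

Section lebesgue_Rn_theory.
Variable R : realType.
Local Notation lambda := (@lebesgue_measure R).

(** The pairing of the two arguments makes this a map between measurable spaces. *)
Definition insert_coord n (i : 'I_n.+1) (p : measurableTypeR R * Rd R n) : Rd R n.+1 :=
  @hyperplane_pt R n.+1 i p.1 p.2.

Lemma tnth_insert_coord n (i : 'I_n.+1) p :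
  tnth (insert_coord i p) i = p.1.
Proof. by rewrite tnth_mktuple unlift_none. Qed.

Lemma tnth_insert_lift n (i : 'I_n.+1) (j : 'I_n) p :
  tnth (insert_coord i p) (lift i j) = tnth p.2 j.
Proof. by rewrite tnth_mktuple liftK. Qed.

Lemma measurable_insert_coord n (i : 'I_n.+1) :
  measurable_fun [set: measurableTypeR R * Rd R n] (insert_coord i).
Proof.
apply/measurable_fun_tnthP => j.
rewrite (_ : _ \o _ = fun p : measurableTypeR R * Rd R n =>
    if unlift i j is Some k then tnth p.2 k else p.1); last first.
  by apply/funext => p /=; rewrite tnth_mktuple; case: unliftP.
case: unliftP => [k _|_]; last exact: measurable_fst.
by apply: (measurableT_comp (measurable_tnth k)); exact: measurable_snd.
Qed.

Lemma insert_coord0 n : @insert_coord n ord0 = @consp R n.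
Proof.
apply/funext => -[a y]; apply/eq_from_tnth => j; rewrite tnth_mktuple.
case: unliftP => [k ->|->] /=; first by rewrite !(tnth_nth a).
by rewrite (tnth_nth a).
Qed.

Lemma insert_coord_lift n (i : 'I_n.+1) (a b : measurableTypeR R) (y : Rd R n) :
  insert_coord (lift ord0 i) (a, consp (b, y)) = consp (b, insert_coord i (a, y)).
Proof.
apply/eq_from_tnth => j.
have consS m (z : Rd R m) k : tnth (consp (b, z)) (lift ord0 k) = tnth z k.
  by rewrite !(tnth_nth b).
have cons0 m (z : Rd R m) : tnth (consp (b, z)) ord0 = b by rewrite (tnth_nth b).
have [k ->|->] := unliftP (lift ord0 i) j; last first.
  by rewrite tnth_insert_coord consS tnth_insert_coord.
rewrite tnth_insert_lift /=.
have [l ->|->] := unliftP ord0 k.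
  rewrite consS (_ : lift (lift ord0 i) (lift ord0 l) = lift ord0 (lift i l)).
    by rewrite consS tnth_insert_lift.
  by apply: val_inj; rewrite /= /bump !leq0n !add1n ltnS addnS.
rewrite cons0 (_ : lift (lift ord0 i) ord0 = ord0) ?cons0//.
by apply: val_inj; rewrite /= /bump.
Qed.

Lemma leb_consE n (A : set (Rd R n.+1)) :
  leb n.+1 A = (\int[lambda]_b leb n (xsection (@consp R n @^-1` A) b))%E.
Proof. by []. Qed.

(** Lebesgue measure is built by adjoining coordinates in front; by Tonelli's theorem
adjoining them at any other position gives the same measure. *)
Lemma leb_insert n (i : 'I_n.+1) (A : set (Rd R n.+1)) : measurable A ->
  leb n.+1 A = (lambda \x leb n)%E (insert_coord i @^-1` A).
Proof.
elim: n i A => [|n IH] i A mA.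
  by rewrite (ord1 i) insert_coord0.
have [i' ->|->] := unliftP ord0 i; last by rewrite insert_coord0.
pose B : set ((measurableTypeR R * measurableTypeR R) * Rd R n) :=
  [set q | A (consp (q.1.2, insert_coord i' (q.1.1, q.2)))].
have mB : measurable B.
  have mh : measurable_fun [set: (measurableTypeR R * measurableTypeR R) * Rd R n]
      (fun q => consp (q.1.2, insert_coord i' (q.1.1, q.2))).
    apply: (measurableT_comp (@measurable_consp R n.+1)).
    apply/measurable_fun_pair => /=.
      by apply: (measurableT_comp (@measurable_snd _ _ _ _)); exact: measurable_fst.
    apply: (measurableT_comp (measurable_insert_coord i')).
    apply/measurable_fun_pair => /=; last exact: measurable_snd.
    by apply: (measurableT_comp (@measurable_fst _ _ _ _)); exact: measurable_fst.
  by rewrite /B -[X in measurable X]setTI; exact: mh.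
pose f q := leb n (xsection B q).
have mf := measurable_fun_xsection (leb n) mB.
have -> : leb n.+2 A = (\int[lambda]_b \int[lambda]_a f (a, b))%E.
  rewrite leb_consE; apply: eq_integral => b _.
  have mAb : measurable (xsection (@consp R n.+1 @^-1` A) b).
    apply: measurable_xsection; rewrite -[X in measurable X]setTI.
    exact: measurable_consp.
  rewrite (IH i' _ mAb); apply: eq_integral => a _.
  congr (leb n _); apply/seteqP; split => y; rewrite /xsection /B /= !inE /=;
    by rewrite /xsection /= !inE.
rewrite -fubini_tonelli//=.
apply: eq_integral => a _; rewrite /= leb_consE; apply: eq_integral => b _.
congr (leb n _); apply/seteqP; split => y; rewrite /xsection /B /= !inE /= ?inE /=;
  by rewrite insert_coord_lift.
Qed.

Lemma measurable_box n (A : 'I_n -> set (measurableTypeR R)) :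
  (forall j, measurable (A j)) ->
  measurable [set x : Rd R n | forall j, A j (tnth x j)].
Proof.
move=> mA; rewrite (_ : mkset _ =
    \bigcap_(j in [set: 'I_n]) ((fun x : Rd R n => tnth x j) @^-1` A j)); last first.
  by apply/seteqP; split => x /= h j; [move=> _; exact: h|exact: h].
apply: fin_bigcap_measurable => [|j _]; first exact: finite_finset.
rewrite -[X in measurable X]setTI.
have mt := @measurable_tnth _ (measurableTypeR R) n j.
exact: (mt measurableT _ (mA j)).
Qed.

Lemma leb_box n (A : 'I_n -> set (measurableTypeR R)) :
  (forall j, measurable (A j)) ->
  leb n [set x : Rd R n | forall j, A j (tnth x j)] = (\prod_j lambda (A j))%E.
Proof.
elim: n A => [|n IH] A mA.
  rewrite big_ord0 /= diracE mem_set//= => -[].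
  by [].
have mB := @measurable_box n (fun j => A (lift ord0 j)) (fun j => mA _).
rewrite big_ord_recl -(IH (fun j => A (lift ord0 j)))//.
rewrite -(product_measure1E lambda (leb n) (mA ord0) mB).
congr ((lambda \x leb n)%E _); apply/seteqP; split => -[a y] /=.
  move=> h; split => /=; first by have := h ord0; rewrite (tnth_nth a).
  by move=> j; have := h (lift ord0 j); rewrite !(tnth_nth a).
move=> [/= Aa Ay] j; have [k ->|->] := unliftP ord0 j.
  by have := Ay k; rewrite !(tnth_nth a).
by rewrite (tnth_nth a).
Qed.

End lebesgue_Rn_theory.

(** * Integration over slabs *)

Section measurability.
Variable R : realType.

(** The product sigma-algebra on n-tuples contains the open sets of R^n: each of them
is a countable union of cubes with rational data. *)
Lemma measurable_preimage_pt n (U : set 'rV[R]_n) : open U ->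
  measurable (@pt R n @^-1` U).
Proof.
move=> oU; pose I := ({ffun 'I_n -> rat} * nat)%type.
pose cube (c : I) : set (Rd R n) :=
  [set x | forall j, `|ratr (c.1 j) - (tnth x j : R)| < (c.2.+1%:R)^-1].
have mcube c : measurable (cube c).
  apply: (@measurable_box R n (fun j => [set t : measurableTypeR R |
    `|ratr (c.1 j) - (t : R)| < (c.2.+1%:R)^-1])) => j.
  rewrite (_ : mkset _ = `]ratr (c.1 j) - c.2.+1%:R^-1, ratr (c.1 j) + c.2.+1%:R^-1[%classic).
    exact: measurable_itv.
  by apply/seteqP; split => t /=; rewrite in_itv /= ltr_distlC.
pose F (c : I) : set (Rd R n) := if `[< cube c `<=` @pt R n @^-1` U >] then cube c else set0.
have -> : @pt R n @^-1` U = \bigcup_(c in [set: I]) F c.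
  apply/seteqP; split => [x Ux|x [c _]]; last first.
    by rewrite /F; case: asboolP => // + cx; apply.
  have /nbhs_ballP[e /= e0 eU] : nbhs (pt x) U by apply: open_nbhs_nbhs; split.
  have e2 : 0 < e / 2 by rewrite divr_gt0.
  have [k _ kP] := near_infty_natSinv_lt (PosNum e2).
  pose r : R := (k.+1%:R)^-1; have r0 : 0 < r by rewrite invr_gt0 ltr0n.
  have re : r < e / 2 by apply: (kP k); rewrite /=.
  have q_ex j : exists q : rat, `|ratr q - (tnth x j : R)| < r.
    have [|q] := @rat_in_itvoo R ((tnth x j : R) - r) ((tnth x j : R) + r).
      by rewrite ltrBlDr -addrA ltrDl addr_gt0.
    rewrite in_itv /= => /andP[q1 q2]; exists q; rewrite ltr_norml; lra.
  have [q qP] := boolp.choice q_ex.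
  exists ([ffun j => q j], k) => //; rewrite /F.
  have cx : cube ([ffun j => q j], k) x by move=> j /=; rewrite ffunE; exact: qP.
  case: asboolP => // no; exfalso; apply: no => y cy; apply: eU; split => // i j.
  rewrite !mxE /ball /= /ball_; have := cx j; have := cy j => /=.
  rewrite !ltr_norml -/r; lra.
apply: countable_bigcupT_measurable => [|c]; last by rewrite /F; case: asboolP.
exact: countableP.
Qed.

Lemma measurable_continuous_pt n (phi : 'rV[R]_n -> R) : continuous phi ->
  measurable_fun [set: Rd R n] (phi \o @pt R n).
Proof.
move=> cphi; apply: (measurability (@RGenOInfty.G R)) => //.
  exact: RGenOInfty.measurableE.
move=> _ [_ [a ->] <-]; rewrite setTI comp_preimage.
apply: measurable_preimage_pt; move/continuousP: cphi; apply.
exact: rray_open.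
Qed.

End measurability.

Section slab.
Variables (R : realType) (n : nat) (i : 'I_n.+1).
Local Notation lambda := (@lebesgue_measure R).

Definition drop_coord (x : Rd R n.+1) : Rd R n := [tuple tnth x (lift i l) | l < n].

Definition slab (a b : R) (S : set (Rd R n)) : set (Rd R n.+1) :=
  [set x | a < (tnth x i : R) < b /\ S (drop_coord x)].

Lemma insert_coordK p : drop_coord (insert_coord i p) = p.2.
Proof. by apply/eq_from_tnth => l; rewrite tnth_mktuple tnth_insert_lift. Qed.

Lemma measurable_drop_coord : measurable_fun [set: Rd R n.+1] drop_coord.
Proof.
apply/measurable_fun_tnthP => l.
rewrite (_ : _ \o _ = fun x : Rd R n.+1 => tnth x (lift i l)); last first.
  by apply/funext => x /=; rewrite tnth_mktuple.
exact: measurable_tnth.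
Qed.

Lemma slab_insert a b S : insert_coord i @^-1` slab a b S = `]a, b[%classic `*` S.
Proof.
by apply/seteqP; split => p; rewrite /slab /= insert_coordK tnth_insert_coord in_itv.
Qed.

Lemma measurable_slab a b S : measurable S -> measurable (slab a b S).
Proof.
move=> mS; have -> : slab a b S = (fun x : Rd R n.+1 => tnth x i) @^-1` `]a, b[%classic `&`
    drop_coord @^-1` S.
  by apply/seteqP; split => x; rewrite /slab /= in_itv.
apply: measurableI; rewrite -[X in measurable X]setTI.
  have mt := @measurable_tnth _ (measurableTypeR R) n.+1 i.
  exact: (mt measurableT _ (measurable_itv _)).
exact: measurable_drop_coord.
Qed.

Lemma leb_slab a b S : a < b -> measurable S ->
  leb n.+1 (slab a b S) = ((b - a)%:E * leb n S)%E.
Proof.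
move=> ab mS; rewrite (leb_insert i); last exact: measurable_slab.
rewrite slab_insert product_measure1E//.
congr (_ * _)%E; have := @lebesgue_measure_itv R `]a, b[; by rewrite /= lte_fin ab.
Qed.

(** Fubini's theorem with the coordinate i singled out. *)
Lemma integral_slab (G : Rd R n.+1 -> R) (H : Rd R n -> R) a b S :
  measurable S -> measurable_fun [set: Rd R n.+1] G ->
  (leb n.+1).-integrable (slab a b S) (EFin \o G) ->
  (forall y, S y ->
     (\int[lambda]_(t in `]a, b[) (G (insert_coord i (t, y)))%:E = (H y)%:E)%E) ->
  (\int[leb n.+1]_(x in slab a b S) (G x)%:E = \int[leb n]_(y in S) (H y)%:E)%E.
Proof.
move=> mS mG iG GH; set D := slab a b S in iG *.
have mD : measurable D by exact: measurable_slab.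
pose f := (EFin \o G) \_ D.
have mf : measurable_fun [set: Rd R n.+1] f.
  apply: (measurable_restrict (EFin \o G) mD measurableT).1.
  by apply: measurable_funTS; exact/measurable_EFinP.
have if1 : (leb n.+1).-integrable setT f by apply/(integrable_mkcond _ mD).
have leb_push A : measurable A ->
    leb n.+1 A = pushforward (lambda \x leb n)%E (insert_coord i) A.
  exact: leb_insert.
have mins := @measurable_insert_coord R n i.
pose P_ : {measure set (Rd R n.+1) -> \bar R} := pushforward (lambda \x leb n)%E (insert_coord i).
pose P := P_ mins.
have int2 : (lambda \x leb n)%E.-integrable setT (f \o insert_coord i).
  apply/integrableP; split; first exact: measurableT_comp.
  move/integrableP: if1 => [_].
  rewrite (eq_measure_integral P); last by move=> A mA _; exact: leb_push.
  rewrite ge0_integral_pushforward//.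
  by apply: measurableT_comp.
rewrite integral_mkcond -/f.
rewrite (eq_measure_integral P); last by move=> A mA _; exact: leb_push.
rewrite (integral_pushforward mins)//.
rewrite preimage_setT -(integral21_prod_meas1 int2) [RHS]integral_mkcond.
apply: eq_integral => y _; rewrite /fubini_G patchE.
case: ifPn => yS.
  rewrite -GH; last by move/set_mem: yS.
  rewrite [RHS]integral_mkcond; apply: eq_integral => t _.
  rewrite /= /f !patchE; congr (if _ then _ else _).
  apply/idP/idP => /set_mem.
    by move=> [/=]; rewrite tnth_insert_coord /= => tab _; apply/mem_set; rewrite /= in_itv.
  rewrite /= in_itv /= => tab; apply/mem_set; split; first by rewrite tnth_insert_coord.
  by rewrite insert_coordK; exact: set_mem.
apply: integral0_eq => t _; rewrite /= /f patchE memNset//.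
by rewrite /D /slab /= insert_coordK => -[_ Sy]; move/negP: yS; apply; exact/mem_set.
Qed.

End slab.

(** * Traces of smooth functions *)

Section smooth_trace.
Variables (R : realType) (n : nat) (i : 'I_n.+1).
Local Notation lambda := (@lebesgue_measure R).

Lemma pt_insert_coord (t : R) (y : Rd R n) :
  pt (insert_coord i (t, y)) = pt (insert_coord i (0, y)) + t *: delta_mx 0 i.
Proof.
apply/rowP => j; rewrite !mxE !tnth_mktuple /= ?eqxx /=.
case: unliftP => [k ->|->] /=; last by rewrite eqxx mulr1 add0r.
by rewrite eq_sym (negbTE (neq_lift _ _)) mulr0 addr0.
Qed.

Lemma smooth1 (phi : 'rV[R]_n.+1 -> R) : smooth phi ->
  [/\ continuous phi, forall x, derivable phi x (delta_mx 0 i) & continuous (partial i phi)].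
Proof.
move=> sphi; have [c0 d0] := sphi [::]; have [c1 _] := sphi [:: i].
by split => // x; exact: d0.
Qed.

Lemma line_continuous (p : 'rV[R]_n.+1) :
  continuous (fun t : R => p + t *: (delta_mx 0 i : 'rV[R]_n.+1)).
Proof.
move=> t; apply: cvgD; first exact: cvg_cst.
by apply: cvgZr_tmp; exact: cvg_id.
Qed.

Lemma integral_line (phi : 'rV[R]_n.+1 -> R) (c a b : R) (y : Rd R n) :
  a < b -> smooth phi ->
  (\int[lambda]_(t in `]a, b[)
     (phi (pt (insert_coord i (t, y))) + (t - c) * partial i phi (pt (insert_coord i (t, y))))%:E =
   ((b - c) * phi (pt (insert_coord i (b, y))) -
    (a - c) * phi (pt (insert_coord i (a, y))))%:E)%E.
Proof.
move=> ab sphi; have [c0 d0 c1] := smooth1 sphi.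
pose p := pt (insert_coord i (0, y)); pose e : 'rV[R]_n.+1 := delta_mx 0 i.
pose psi (t : R) := phi (p + t *: e).
pose dpsi (t : R) := partial i phi (p + t *: e).
pose f t := psi t + (t - c) * dpsi t.
pose F t := (t - c) * psi t.
have cpsi : continuous psi.
  by move=> t; apply: continuous_comp; [exact: line_continuous|exact: c0].
have cdpsi : continuous dpsi.
  by move=> t; apply: continuous_comp; [exact: line_continuous|exact: c1].
have ctc : continuous (fun t : R => t - c).
  by move=> t; apply: cvgB; [exact: cvg_id|exact: cvg_cst].
have cf : continuous f.
  by move=> t; apply: cvgD; [exact: cpsi|apply: cvgM; [exact: ctc|exact: cdpsi]].
have dpsiE (t : R) : is_derive t (1 : R) psi (dpsi t).
  have E : (fun h : R => h^-1 *: ((psi \o shift t) (h *: (1 : R)) - psi t)) =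
      (fun h : R => h^-1 *: ((phi \o shift (p + t *: e)) (h *: e) - phi (p + t *: e))).
    apply/funext => h; rewrite /psi /= /shift /=; congr (_ *: (phi _ - _)).
    by rewrite [h *: 1]mulr1 scalerDl addrCA.
  apply: DeriveDef.
    by rewrite /derivable E; exact: d0.
  by rewrite /derive E.
have dF (t : R) : is_derive t (1 : R) F (f t).
  have d1 : is_derive t (1 : R) (fun s : R => s - c) 1.
    have := @is_deriveB R R R id (cst c) t 1 _ _ (is_derive_id t 1) (is_derive_cst c t 1).
    by rewrite subr0.
  apply: is_derive_eq (is_deriveM d1 (dpsiE t)) _.
  by rewrite [psi t *: 1]mulr1 addrC.
have -> : (\int[lambda]_(t in `]a, b[)
     (phi (pt (insert_coord i (t, y))) + (t - c) * partial i phi (pt (insert_coord i (t, y))))%:E =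
     \int[lambda]_(t in `]a, b[) (f t)%:E)%E.
  by apply: eq_integral => t _; rewrite pt_insert_coord.
have mf A : measurable_fun A (EFin \o f).
  by apply: measurable_funTS; apply/measurable_EFinP; exact: continuous_measurable_fun.
rewrite integral_itv_bndo_bndc// integral_itv_obnd_cbnd//.
rewrite (@continuous_FTC2 _ f F)//.
- by rewrite [in RHS](pt_insert_coord b) [in RHS](pt_insert_coord a) EFinB.
- exact: continuous_subspaceT.
- have cF : continuous F by move=> t; apply: cvgM; [exact: ctc|exact: cpsi].
  split.
  + by move=> t _; exact: ex_derive.
  + by apply: cvg_at_right_filter; exact: cF.
  + by apply: cvg_at_left_filter; exact: cF.
- by move=> t _; rewrite derive1E; exact: derive_val.
Qed.

(** The trace formula for smooth functions: integration by parts along e^(i) against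
a weight that vanishes on one of the two sides of the slab. *)
Lemma smooth_slab (phi : 'rV[R]_n.+1 -> R) (c a b : R) (S : set (Rd R n)) :
  a < b -> measurable S -> smooth phi ->
  (leb n.+1).-integrable (slab i a b S)
    (EFin \o (fun x => phi (pt x) + ((tnth x i : R) - c) * partial i phi (pt x))) ->
  \int[leb n.+1]_(x in slab i a b S) (phi (pt x) + ((tnth x i : R) - c) * partial i phi (pt x)) =
  \int[leb n]_(y in S) ((b - c) * phi (pt (insert_coord i (b, y))) -
    (a - c) * phi (pt (insert_coord i (a, y)))).
Proof.
move=> ab mS sphi iG; have [c0 d0 c1] := smooth1 sphi.
rewrite /Rintegral; congr fine.
apply: (@integral_slab R n i (fun x => phi (pt x) + ((tnth x i : R) - c) * partial i phi (pt x))
  (fun y => (b - c) * phi (pt (insert_coord i (b, y))) -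
    (a - c) * phi (pt (insert_coord i (a, y))))) => //.
  apply: measurable_funD; first exact: (measurable_continuous_pt c0).
  apply: measurable_funM; last exact: (measurable_continuous_pt c1).
  by apply: measurable_funB; [exact: measurable_tnth|exact: measurable_cst].
move=> y _; rewrite -(integral_line c y ab sphi); apply: eq_integral => t _.
by rewrite tnth_insert_coord.
Qed.

End smooth_trace.

(** * Integration against L2 functions *)

Section L2.
Context {dd : measure_display} {T : measurableType dd} {R : realType}.
Variables (mu : {measure set T -> \bar R}) (Om D : set T).
Hypotheses (mOm : measurable Om) (mD : measurable D) (DOm : D `<=` Om).

(** Cauchy-Schwarz inequality between f and the indicator function of D. *)
Lemma integral_abs_L2 (f w : T -> R) (B : R) : 0 <= B ->
  measurable_fun Om f -> measurable_fun D w -> (forall x, D x -> `|w x| <= B) ->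
  (\int[mu]_(x in D) `|(w x * f x)%:E| <=
   B%:E * (Lnorm mu 2%:E (EFin \o (f \_ Om)) * mu D `^ 2^-1))%E.
Proof.
move=> B0 mf mw wB.
have mfD : measurable_fun D f by exact: measurable_funS mf.
have mfOm : measurable_fun setT (f \_ Om).
  by apply: (measurable_restrict f mOm measurableT).1; rewrite setTI.
have m1 : measurable_fun setT (\1_D : T -> R) by exact: measurable_indic.
have mafD : measurable_fun D (fun x => `|(f x)%:E|)%E.
  by apply: measurableT_comp => //; apply/measurable_EFinP.
have mawD : measurable_fun D (fun x => `|(w x * f x)%:E|)%E.
  by apply: measurableT_comp => //; apply/measurable_EFinP; exact: measurable_funM.
have le1 : (\int[mu]_(x in D) `|(w x * f x)%:E| <= \int[mu]_(x in D) (B%:E * `|(f x)%:E|))%E.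
  apply: ge0_le_integral => //; first exact: measurable_funeM.
  by move=> x Dx /=; rewrite -EFinM lee_fin normrM ler_wpM2r// wB.
apply: (le_trans le1); rewrite ge0_integralZl//.
apply: lee_wpmul2l => //.
have half : 2^-1 + 2^-1 = 1 :> R by rewrite -mulr2n -[2^-1]mul1r -mulrnAr; field.
have := @hoelder _ _ _ mu (f \_ Om) \1_D 2 2 mfOm m1 (ltr0n R 2) (ltr0n R 2) half.
have -> : (Lnorm mu 1%E (EFin \o (f \_ Om \* \1_D)%R) = \int[mu]_(x in D) `|(f x)%:E|)%E.
  rewrite Lnorm1 [RHS]integral_mkcond; apply: eq_integral => x _.
  rewrite /= indicE [in RHS]patchE; case: (boolP (x \in D)) => xD.
    by rewrite mulr1 patchE mem_set//; apply: DOm; exact: set_mem.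
  by rewrite mulr0 normr0.
have -> // : (Lnorm mu 2%:E (EFin \o \1_D) = mu D `^ 2^-1)%E.
have -> : (mu D = \int[mu]_x `|(EFin \o \1_D) x| `^ 2)%E.
  rewrite -[X in mu X = _](setIT D) -(integral_indic mu measurableT mD).
  apply: eq_integral => x _ /=; rewrite indicE.
  by case: (x \in D); rewrite /= ?normr1 ?normr0 ?powR1 ?powR0.
by rewrite unlock.
Qed.

Lemma L2_integrable (f w : T -> R) (B : R) : 0 <= B -> (mu D < +oo)%E ->
  measurable_fun Om f -> (Lnorm mu 2%:E (EFin \o (f \_ Om)) < +oo)%E ->
  measurable_fun D w -> (forall x, D x -> `|w x| <= B) ->
  mu.-integrable D (EFin \o (fun x => w x * f x)).
Proof.
move=> B0 muD mf fN mw wB; apply/integrableP; split.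
  by apply/measurable_EFinP; apply: measurable_funM => //; exact: measurable_funS mf.
apply: le_lt_trans (integral_abs_L2 B0 mf mw wB) _.
rewrite lte_mul_pinfty// lte_mul_pinfty ?Lnorm_ge0//.
  by rewrite ge0_fin_numE ?Lnorm_ge0.
by rewrite poweR_lty.
Qed.

Lemma L2_Rintegral_le (f w : T -> R) (B c m : R) : 0 <= B -> mu D = m%:E ->
  measurable_fun Om f -> (Lnorm mu 2%:E (EFin \o (f \_ Om)) <= c%:E)%E ->
  measurable_fun D w -> (forall x, D x -> `|w x| <= B) ->
  `|\int[mu]_(x in D) (w x * f x)| <= B * (c * Num.sqrt m).
Proof.
move=> B0 muD mf fN mw wB.
have m0 : 0 <= m by rewrite -lee_fin -muD.
have iwf : mu.-integrable D (EFin \o (fun x => w x * f x)).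
  by apply: L2_integrable B0 _ mf _ mw wB; rewrite ?muD ?ltry// (le_lt_trans fN)// ltry.
rewrite -lee_fin EFin_normr_Rintegral//.
apply: le_trans (le_abse_integral _ _ _) _ => //; first exact: measurable_int iwf.
apply: le_trans (integral_abs_L2 B0 mf mw wB) _.
rewrite EFinM; apply: lee_wpmul2l => //.
rewrite muD poweR_EFin powR12_sqrt// [leRHS]EFinM.
by apply: lee_wpmul2r => //; rewrite lee_fin sqrtr_ge0.
Qed.

(** The norm of psi itself may be infinite a priori: the integrability of psi comes from
that of f and of psi - f. *)
Lemma L2_Rintegral_perturb (f psi w : T -> R) (B e m : R) : 0 <= B -> mu D = m%:E ->
  measurable_fun Om f -> (Lnorm mu 2%:E (EFin \o (f \_ Om)) < +oo)%E ->
  measurable_fun Om psi ->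
  (Lnorm mu 2%:E (EFin \o ((fun x => psi x - f x)%R \_ Om)) <= e%:E)%E ->
  measurable_fun D w -> (forall x, D x -> `|w x| <= B) ->
  mu.-integrable D (EFin \o (fun x => w x * psi x)) /\
  `|\int[mu]_(x in D) (w x * psi x) - \int[mu]_(x in D) (w x * f x)| <=
    B * (e * Num.sqrt m).
Proof.
move=> B0 muD mf fN mpsi Ne mw wB.
have muDy : (mu D < +oo)%E by rewrite muD ltry.
have mdiff : measurable_fun Om (fun x => psi x - f x) by exact: measurable_funB.
have if1 := L2_integrable B0 muDy mf fN mw wB.
have id1 : mu.-integrable D (EFin \o (fun x => w x * (psi x - f x))).
  by apply: L2_integrable B0 muDy mdiff _ mw wB; rewrite (le_lt_trans Ne)// ltry.
have E : (fun x => w x * psi x) = (fun x => w x * f x + w x * (psi x - f x)).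
  by apply/funext => x; ring.
have ipsi : mu.-integrable D (EFin \o (fun x => w x * psi x)).
  by rewrite E; exact: (integrableD mD if1 id1).
split=> //; rewrite {1}E RintegralD// addrAC subrr add0r.
exact: L2_Rintegral_le.
Qed.

End L2.

(** * Traces of H1 functions *)

Lemma cvge0_near_le (R : realType) (v : nat -> \bar R) (e : R) :
  v k @[k --> \oo] --> 0%E -> (forall k, (0 <= v k)%E) -> 0 < e ->
  \forall k \near \oo, (v k <= e%:E)%E.
Proof.
move=> /fine_cvgP[vfin /cvgr0Pnorm_lt v0] vge0 e0.
apply: filterS2 vfin (v0 e e0) => k /= vk /ltW.
by rewrite ger0_norm ?fine_ge0// -lee_fin fineK.
Qed.

Section trace_formula.
Variables (R : realType) (n : nat) (i : 'I_n.+1) (Om : set (Rd R n.+1)).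
Hypothesis mOm : measurable Om.
Variables (f : Rd R n.+1 -> R) (Df : 'I_n.+1 -> Rd R n.+1 -> R).
Hypothesis fH1 : inH1 Om f Df.

Lemma abs_le_eps (x K : R) : (forall e, 0 < e -> `|x| <= K * e) -> x = 0.
Proof.
move=> xe; apply/eqP; rewrite -normr_le0; apply/ler_addgt0Pl => e e0.
have K1 : 0 < `|K| + 1 by rewrite ltr_wpDl.
rewrite addr0; apply: le_trans (xe (e / (`|K| + 1)) _) _; first exact: divr_gt0.
rewrite mulrCA ger_pMr//  ler_pdivrMr// mul1r (le_trans (ler_norm K))//.
by rewrite lerDl.
Qed.

(** Trace formula: a trace on one side of a slab is determined by the function and its
normal derivative inside the slab. Both sides are continuous for the norms that define
traces, so that it is enough to know the formula for smooth functions. *)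
Lemma trace_slab (a b c c' s : R) (S : set (Rd R n)) (g : Rd R n -> R) :
  a < b -> measurable S -> leb n S = s%:E -> slab i a b S `<=` Om ->
  (c = a /\ c' = b) \/ (c = b /\ c' = a) ->
  @is_trace R n.+1 i Om f Df c S g ->
  \int[leb n.+1]_(x in slab i a b S) f x +
  \int[leb n.+1]_(x in slab i a b S) (((tnth x i : R) - c') * Df i x) =
  (b - a) * \int[leb n]_(y in S) g y.
Proof.
move=> ab mS lS slabOm cc' [[mg gN] [phi_ [sphi [H1f H1D] trg]]].
have [[mf fN] /(_ i) [[mD DN] _]] := fH1.
have mslab : measurable (slab i a b S) := measurable_slab i a b mS.
have lslab : leb n.+1 (slab i a b S) = ((b - a) * s)%:E.
  by rewrite leb_slab// lS EFinM.
have ba0 : 0 <= b - a by rewrite subr_ge0 ltW.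
pose m := (b - a) * s.
apply/eqP; rewrite -subr_eq0; apply/eqP.
apply: (@abs_le_eps _ (Num.sqrt m + (b - a) * Num.sqrt m + (b - a) * Num.sqrt s)) => e e0.
have LpN_ge0 k (D : set (Rd R k)) (h : Rd R k -> R) : (0 <= LpN D 2%:E h)%E.
  exact: Lnorm_ge0.
have near_f := cvge0_near_le H1f (fun _ => LpN_ge0 _ _ _) e0.
have near_D := cvge0_near_le (H1D i) (fun _ => LpN_ge0 _ _ _) e0.
have near_g := cvge0_near_le trg (fun _ => LpN_ge0 _ _ _) e0.
have [k [[fk Dk] gk]] := filter_ex (filterI (filterI near_f near_D) near_g).
move: {H1f H1D trg} fk Dk gk => /= fk Dk gk; pose psi := phi_ k.
have [c0 _ c1] := smooth1 i (sphi k).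
have mpsi : measurable_fun Om (fun x => psi (pt x)).
  by apply: measurable_funTS; exact: (measurable_continuous_pt c0).
have mdpsi : measurable_fun Om (fun x => partial i psi (pt x)).
  by apply: measurable_funTS; exact: (measurable_continuous_pt c1).
have mw : measurable_fun (slab i a b S) (fun x : Rd R n.+1 => (tnth x i : R) - c').
  apply: measurable_funB; last exact: measurable_cst.
  by apply: measurable_funTS; exact: measurable_tnth.
have wB x : slab i a b S x -> `|(tnth x i : R) - c'| <= b - a.
  move=> [/andP[x1 x2] _]; rewrite ler_norml.
  by case: cc' => -[_ ->]; apply/andP; split; lra.
have [ipsi d1] := L2_Rintegral_perturb mOm mslab slabOm ler01 lslab mf fN mpsi fk
  (measurable_cst (1 : R)) (fun x _ => ltac:(by rewrite normr1)).
have [idpsi d2] := L2_Rintegral_perturb mOm mslab slabOm ba0 lslab mD DN mdpsi Dk mw wB.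
have mtr : measurable_fun S (fun y => psi (pt (insert_coord i (c, y)))).
  apply: measurable_funTS.
  apply: (measurableT_comp (measurable_continuous_pt c0)).
  apply: (measurableT_comp (measurable_insert_coord i)).
  by apply/measurable_fun_pair => /=; [exact: measurable_cst|exact: measurable_id].
have [itr d3] := L2_Rintegral_perturb mS mS (@subset_refl _ S) ba0 lS mg gN mtr gk
  (measurable_cst (b - a)) (fun x _ => ltac:(by rewrite ger0_norm)).
have ifull : (leb n.+1).-integrable (slab i a b S)
    (EFin \o (fun x => psi (pt x) + ((tnth x i : R) - c') * partial i psi (pt x))).
  have := integrableD mslab ipsi idpsi; congr (_.-integrable _ _).
  by apply/funext => x /=; rewrite mul1r.
have := smooth_slab ab mS (sphi k) ifull.
have -> : \int[leb n.+1]_(x in slab i a b S)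
    (psi (pt x) + ((tnth x i : R) - c') * partial i psi (pt x)) =
    \int[leb n.+1]_(x in slab i a b S) (cst (1 : R) x * psi (pt x)) +
    \int[leb n.+1]_(x in slab i a b S) (((tnth x i : R) - c') * partial i psi (pt x)).
  rewrite -RintegralD//; apply: eq_Rintegral => x _.
  by rewrite /= mul1r.
have -> : \int[leb n]_(y in S) ((b - c') * psi (pt (insert_coord i (b, y))) -
    (a - c') * psi (pt (insert_coord i (a, y)))) =
    \int[leb n]_(y in S) (cst (b - a) y * psi (pt (insert_coord i (c, y)))).
  apply: eq_Rintegral => y _; rewrite /=.
  by case: cc' => -[-> ->]; ring.
have eg : \int[leb n]_(y in S) (cst (b - a) y * g y) = (b - a) * \int[leb n]_(y in S) g y.
  have ig : (leb n).-integrable S (EFin \o g).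
    have lSy : (leb n S < +oo)%E by rewrite lS ltry.
    have := @L2_integrable _ _ _ (leb n) S S mS mS (@subset_refl _ S) g (cst 1) 1 ler01
      lSy mg gN (measurable_cst _) (fun x _ => ltac:(by rewrite normr1)).
    congr (_.-integrable _ _).
    by apply/funext => x /=; rewrite mul1r.
  by rewrite -RintegralZl.
have ef : \int[leb n.+1]_(x in slab i a b S) (cst (1 : R) x * f x) =
    \int[leb n.+1]_(x in slab i a b S) f x.
  by apply: eq_Rintegral => x _; rewrite /= mul1r.
move: d1 d2 d3; rewrite eg ef -/m.
move: (\int[_]_(x in _) (cst 1 x * psi _)) (\int[_]_(x in _) (_ * partial i psi _))
  (\int[_]_(x in _) (cst (b - a) x * psi _)) (\int[_]_(x in _) f x)
  (\int[_]_(x in _) (_ * Df i _)) ((b - a) * \int[_]_(x in _) g x) => I1 I2 I3 J1 J2 J3.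
move=> d1 d2 d3 E.
have -> : J1 + J2 - J3 = (I3 - J3) - (I1 - J1) - (I2 - J2) by rewrite -E; ring.
apply: le_trans (ler_normB _ _) _; apply: (@le_trans _ _
  ((b - a) * (e * Num.sqrt s) + 1 * (e * Num.sqrt m) + (b - a) * (e * Num.sqrt m))).
  by apply: lerD => //; apply: le_trans (ler_normB _ _) _; exact: lerD.
by rewrite le_eqVlt; apply/orP; left; apply/eqP; ring.
Qed.

End trace_formula.

(** * Geometry of the cells and of the faces *)

Section interval_boxes.
Variables (R : realType) (n : nat) (I : 'I_n -> interval R).

Lemma measurable_itv_box : measurable [set x : Rd R n | forall j, (tnth x j : R) \in I j].
Proof.
apply: (@measurable_box R n (fun j => [set` I j])) => j.
exact: (@measurable_itv R (I j)).
Qed.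

Lemma leb_itv_box : leb n [set x : Rd R n | forall j, (tnth x j : R) \in I j] =
  (\prod_j @lebesgue_measure R [set` I j])%E.
Proof.
apply: (@leb_box R n (fun j => [set` I j])) => j.
exact: (@measurable_itv R (I j)).
Qed.

End interval_boxes.

Section mesh_geometry.
Variables (R : realType) (n : nat) (M : mac_mesh R n.+1).
Implicit Types (K L : cell M) (i j : 'I_n.+1) (b : bool).
Local Notation lambda := (@lebesgue_measure R).

Lemma grid_le j k l : (k <= l)%N -> (l <= ncells M j)%N -> grid M j k <= grid M j l.
Proof.
elim: l => [|l IH]; first by rewrite leqn0 => /eqP ->.
rewrite leq_eqVlt => /predU1P[->//|kl] lN.
by rewrite (le_trans (IH kl (ltnW lN)))// ltW// grid_lt.
Qed.

Lemma lebesgue_itv_oo (a b : R) : a <= b -> lambda `]a, b[%classic = (b - a)%:E.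
Proof.
move=> ab; rewrite lebesgue_measure_itv /= lte_fin; case: ltP => // ba.
by have -> : a = b by [apply/eqP; rewrite eq_le ab]; rewrite subrr.
Qed.

Lemma measurable_Omega : measurable (Omega M).
Proof.
rewrite (_ : Omega M = [set x : Rd R n.+1 | forall j,
    (tnth x j : R) \in `]grid M j 0, grid M j (ncells M j)[]).
  exact: measurable_itv_box.
by apply/seteqP; split => x h j; have := h j; rewrite /= in_itv.
Qed.

Lemma leb_Omega : leb n.+1 (Omega M) = (vol_Omega M)%:E.
Proof.
rewrite (_ : Omega M = [set x : Rd R n.+1 | forall j,
    (tnth x j : R) \in `]grid M j 0, grid M j (ncells M j)[]).
  rewrite leb_itv_box.
  rewrite /vol_Omega -prodEFin; apply: eq_bigr => j _.
  by rewrite lebesgue_itv_oo// grid_le.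
by apply/seteqP; split => x h j; have := h j; rewrite /= in_itv.
Qed.

Lemma measurable_face_set i (s : face M i) : measurable (face_set s).
Proof.
rewrite (_ : face_set s = [set y : Rd R n | forall l, (tnth y l : R) \in `]grid M (lift i l) (s (lift i l)),
    grid M (lift i l) (s (lift i l)).+1[]).
  exact: measurable_itv_box.
by apply/seteqP; split => x h j; have := h j; rewrite /= in_itv.
Qed.

Lemma leb_face_set i (s : face M i) : leb n (face_set s) = (area s)%:E.
Proof.
rewrite (_ : face_set s = [set y : Rd R n | forall l, (tnth y l : R) \in `]grid M (lift i l) (s (lift i l)),
    grid M (lift i l) (s (lift i l)).+1[]); last first.
  by apply/seteqP; split => x h j; have := h j; rewrite /= in_itv.
rewrite leb_itv_box.
rewrite /area (reindex_omap (lift i) (unlift i)) /=; last first.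
  by move=> j ji; case: unliftP ji => [l ->//|->]; rewrite eqxx.
rewrite -prodEFin; apply: eq_big => [l|l _].
  by rewrite liftK eqxx andbT eq_sym neq_lift.
rewrite lebesgue_itv_oo// ltW// grid_lt//.
suff {2}<- : (ncells M (lift i l) + (lift i l == i) = ncells M (lift i l))%N by [].
by rewrite eq_sym (negbTE (neq_lift _ _)) addn0.
Qed.

Definition open_cell K : set (Rd R n.+1) :=
  [set x | forall j, grid M j (K j) < (tnth x j : R) < grid M j (K j).+1].

Lemma open_cell_Omega K : open_cell K `<=` Omega M.
Proof.
move=> x xK j; have /andP[x1 x2] := xK j; apply/andP; split.
  by apply: le_lt_trans x1; rewrite grid_le// ltnW.
by apply: lt_le_trans x2 _; rewrite grid_le.
Qed.

Lemma open_cell_slab K i b :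
  slab i (grid M i (K i)) (grid M i (K i).+1) (face_set (face_of K i b)) = open_cell K.
Proof.
have lE l : face_of K i b (lift i l) = K (lift i l) :> nat.
  by rewrite face_ofE eq_sym (negbTE (neq_lift _ _)) andbF addn0.
apply/seteqP; split => x.
  move=> [xi xS] j; have [l ->|->//] := unliftP i j.
  by have := xS l; rewrite /= !lE tnth_mktuple.
move=> xK; split; first exact: xK.
by move=> l /=; rewrite !lE tnth_mktuple; exact: xK.
Qed.

Lemma measurable_open_cell K : measurable (open_cell K).
Proof. by rewrite -(open_cell_slab K ord0 true); apply: measurable_slab; exact: measurable_face_set. Qed.

Lemma leb_open_cell K : leb n.+1 (open_cell K) = (vol K)%:E.
Proof.
rewrite (_ : open_cell K = [set x : Rd R n.+1 | forall j,
    (tnth x j : R) \in `]grid M j (K j), grid M j (K j).+1[]).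
  rewrite leb_itv_box.
  rewrite /vol -prodEFin; apply: eq_bigr => j _.
  by rewrite lebesgue_itv_oo// grid_le.
by apply/seteqP; split => x h j; have := h j; rewrite /= in_itv.
Qed.

Lemma measurable_cell_set K : measurable (cell_set K).
Proof.
rewrite (_ : cell_set K = Omega M `&` [set x : Rd R n.+1 | forall j,
    (tnth x j : R) \in `[grid M j (K j), grid M j (K j).+1[]).
  apply: measurableI; first exact: measurable_Omega.
  exact: measurable_itv_box.
by apply/seteqP; split => x [xO h]; split => // j; have := h j; rewrite /= in_itv.
Qed.

(** The cells that touch the boundary of the domain are not half-open boxes; their measure
is squeezed between that of the open cell and that of the half-open box. *)
Lemma leb_cell_set K : leb n.+1 (cell_set K) = (vol K)%:E.
Proof.
have upper : (leb n.+1 (cell_set K) <= (vol K)%:E)%E.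
  pose H := [set x : Rd R n.+1 | forall j,
    (tnth x j : R) \in `[grid M j (K j), grid M j (K j).+1[].
  have mH : measurable H by exact: measurable_itv_box.
  have -> : (vol K)%:E = leb n.+1 H.
    rewrite leb_itv_box.
    rewrite /vol -prodEFin; apply: eq_bigr => j _.
    by rewrite [RHS]lebesgue_measure_itv /= lte_fin grid_lt.
  apply: le_measure; rewrite ?inE//; first exact: measurable_cell_set.
  by move=> x [_ h] j; have := h j; rewrite /= in_itv.
apply/eqP; rewrite eq_le upper /= -leb_open_cell.
apply: le_measure; rewrite ?inE; [exact: measurable_open_cell|exact: measurable_cell_set|].
move=> x xK; split; first exact: open_cell_Omega xK.
by move=> j; have /andP[/ltW -> ->] := xK j.
Qed.

(** Otherwise the translate of K by one index would lie on the other side. *)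
Lemma external_face_grid K i b : ~~ internal (face_of K i b) ->
  grid M i (face_of K i b i) = grid M i 0 \/
  grid M i (face_of K i b i) = grid M i (ncells M i).
Proof.
rewrite internal_face_of face_ofE eqxx andbT; case: b => /=; rewrite ?addn0 ?addn1 => ext.
  right; congr (grid M i _); apply/eqP; rewrite eqn_leq ltn_ord /= leqNgt.
  apply: contra ext => Ki.
  have ltK j : (K j + (j == i) < ncells M j)%N.
    by have [->|_] := eqVneq j i; rewrite ?addn1 ?addn0.
  pose L : cell M := [ffun j => Ordinal (ltK j)].
  suff -> : face_of K i true = face_of L i false by have /= -> := side_face_of L i false.
  by apply/ffunP => j; apply: ord_inj; rewrite !face_ofE ffunE /= addn0.
left; congr (grid M i _); apply/eqP; apply: contraT; rewrite -lt0n => Ki.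
case/negP: ext.
have ltK j : (K j - (j == i) < ncells M j)%N by rewrite (leq_ltn_trans (leq_subr _ _)).
pose L : cell M := [ffun j => Ordinal (ltK j)].
suff -> : face_of K i false = face_of L i true by have /= -> := side_face_of L i true.
apply/ffunP => j; apply: ord_inj; rewrite !face_ofE ffunE /= addn0 subnK//.
by case: eqP => // ->.
Qed.

(** The indicator function of a cell is a product of differences of step functions, which
telescope. *)
Lemma cell_indic_sum x : Omega M x -> \sum_(K : cell M) \1_(cell_set K) x = 1 :> R.
Proof.
move=> Ox; pose h (j : 'I_n.+1) (k : nat) : R :=
  ((tnth x j : R) < grid M j k.+1)%R%:R - ((tnth x j : R) < grid M j k)%R%:R.
have -> : \sum_(K : cell M) \1_(cell_set K) x = \sum_(K : cell M) \prod_j h j (K j).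
  apply: eq_bigr => K _; rewrite indicE.
  have hE j : h j (K j) =
      (grid M j (K j) <= (tnth x j : R) < grid M j (K j).+1)%R%:R.
    rewrite /h leNgt; have gg : grid M j (K j) < grid M j (K j).+1 by rewrite grid_lt.
    case: (ltP (tnth x j : R) (grid M j (K j))) => [xk|_]; last by rewrite subr0.
    by rewrite (lt_trans xk gg) subrr.
  under eq_bigr do rewrite hE.
  case: (boolP (x \in cell_set K)) => [/set_mem[_ xK]|xK].
    by rewrite big1// => j _; rewrite xK.
  have [j xj] : exists j, ~~ (grid M j (K j) <= (tnth x j : R) < grid M j (K j).+1).
    apply: contrapT => no; move/negP: xK; apply; apply/mem_set; split => // j.
    by apply: contrapT => xj; apply: no; exists j; exact/negP.
  by rewrite (bigD1 j)//= (negbTE xj) mul0r.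
rewrite sum_cell_prod big1// => j _.
rewrite -(big_mkord xpredT (h j)).
rewrite (@telescope_sumr_eq _ _ _ (fun k => ((tnth x j : R) < grid M j k)%R%:R))//.
have /andP[x1 x2] := Ox j.
by rewrite x2 ltNge (ltW x1) subr0.
Qed.

End mesh_geometry.

(** * Discrete initial velocities *)

Section initial_velocity.
Variables (R : realType) (n : nat) (M : mac_mesh R n.+1).
Implicit Types (K L : cell M) (i j : 'I_n.+1) (b : bool).
Variables (u0 : 'I_n.+1 -> Rd R n.+1 -> R) (Du0 : 'I_n.+1 -> 'I_n.+1 -> Rd R n.+1 -> R).
Hypothesis H10 : forall i, inH10 (Omega M) (u0 i) (Du0 i).
Variable u : velocity M.
Arguments u : clear implicits.
Hypothesis init : initial_velocity u0 Du0 u.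

Lemma pt_inj : injective (@pt R n.+1).
Proof. by move=> x y /rowP xy; apply/eq_from_tnth => j; have := xy j; rewrite !mxE. Qed.

(** The test functions that approximate a function of H^1_0 vanish on the boundary. *)
Lemma inH10_trace0 i (c : R) (S : set (Rd R n)) :
  c = grid M i 0 \/ c = grid M i (ncells M i) -> measurable S ->
  is_trace i (Omega M) (u0 i) (Du0 i) c S (fun=> 0).
Proof.
move=> cb mS; have [_ [phi_ tphi H1]] := H10 i.
have zero_norm : LpN S 2%:E (fun=> 0 : R) = 0%E.
  rewrite /LpN -[RHS](@Lnorm0 _ _ _ (leb n) 2%:E); last by rewrite eqe pnatr_eq0.
  by apply: eq_Lnorm => x /=; rewrite patchE if_same.
split; first by split; [exact: measurable_cst|rewrite zero_norm ltry].
exists phi_; split => //; first by move=> k; case: (tphi k).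
rewrite (_ : (fun k => _) = fun=> 0%E); first exact: cvg_cst.
apply/funext => k; rewrite -[RHS]zero_norm; congr LpN; apply/funext => y.
rewrite subr0; have [_ [C [_ CO C0]]] := tphi k; apply: C0 => /CO[x Ox /pt_inj xy].
have := Ox i; rewrite xy (@tnth_insert_coord R n i (c, y)) /=.
by case: cb => ->; rewrite ltxx ?andbF.
Qed.

Lemma face_trace K i b : exists2 g,
  is_trace i (Omega M) (u0 i) (Du0 i) (grid M i (face_of K i b i)) (face_set (face_of K i b)) g &
  area (face_of K i b) * u i (face_of K i b) =
    \int[leb n]_(y in face_set (face_of K i b)) g y.
Proof.
have [si|se] := boolP (internal (face_of K i b)).
  have [g tr ->] := init.2 i _ si; exists g => //.
  by rewrite mulVKf// gt_eqF// area_gt0.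
exists (fun=> 0).
  by apply: inH10_trace0; [exact: external_face_grid|exact: measurable_face_set].
rewrite (init.1 i _ se) mulr0 Rintegral_cst ?mul0r//; exact: measurable_face_set.
Qed.

Lemma inH1_inH10 i : inH1 (Omega M) (u0 i) (Du0 i). Proof. by case: (H10 i). Qed.

Lemma coord_weight_bound i (a b c : R) (S : set (Rd R n)) x : a <= c <= b ->
  slab i a b S x -> `|(tnth x i : R) - c| <= b - a.
Proof.
move=> /andP[ac cb] [/andP[x1 x2] _]; rewrite ler_norml; apply/andP; split; lra.
Qed.

Lemma measurable_coord_weight i (c : R) (D : set (Rd R n.+1)) :
  measurable_fun D (fun x : Rd R n.+1 => (tnth x i : R) - c).
Proof.
apply: measurable_funB; last exact: measurable_cst.
by apply: measurable_funTS; exact: measurable_tnth.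
Qed.

Lemma grad_integrable K i j :
  (leb n.+1).-integrable (open_cell K) (EFin \o Du0 i j).
Proof.
have [_ /(_ j)[[mD DN] _]] := inH1_inH10 i.
have lK : (leb n.+1 (open_cell K) < +oo)%E by rewrite leb_open_cell ltry.
have := @L2_integrable _ _ _ (leb n.+1) (Omega M) (open_cell K) (measurable_Omega M)
  (measurable_open_cell K) (@open_cell_Omega _ _ _ K) (Du0 i j) (cst 1) 1 ler01
  lK mD DN (measurable_cst _) (fun x _ => ltac:(by rewrite normr1)).
congr (_.-integrable _ _).
by apply/funext => x /=; rewrite mul1r.
Qed.

(** Divergence theorem in a cell, one direction at a time: the trace formulas on the two
opposite faces have different weights, and their difference is constant. *)
Lemma cell_flux K i :
  \sum_b flux (fun=> 1) u K i b = \int[leb n.+1]_(x in open_cell K) Du0 i i x.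
Proof.
pose a := grid M i (K i); pose b := grid M i (K i).+1.
have ab : a < b by rewrite /a /b grid_lt.
have trf c' (e : bool) : (if e then b else a, c') = (if e then (b, a) else (a, b)) ->
    \int[leb n.+1]_(x in open_cell K) u0 i x +
    \int[leb n.+1]_(x in open_cell K) (((tnth x i : R) - c') * Du0 i i x) =
    (b - a) * (area (face_of K i e) * u i (face_of K i e)).
  move=> ce; have [g tr ->] := face_trace K i e.
  have lS := leb_face_set (face_of K i e).
  rewrite -(open_cell_slab K i e) -/a -/b.
  apply: (trace_slab (measurable_Omega M) (inH1_inH10 i) ab
    (measurable_face_set (face_of K i e)) lS _ _ tr).
    by rewrite open_cell_slab; exact: open_cell_Omega.
  rewrite face_ofE eqxx andbT.
  by case: e ce {tr lS} => /= -[<-]; rewrite ?addn1 ?addn0; [right|left].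
have tr1 := trf a true erefl; have tr0 := trf b false erefl.
have [_ /(_ i)[[mD DN] _]] := inH1_inH10 i.
have iw c : a <= c <= b -> (leb n.+1).-integrable (open_cell K)
    (EFin \o (fun x : Rd R n.+1 => ((tnth x i : R) - c) * Du0 i i x)).
  move=> acb; have lK : (leb n.+1 (open_cell K) < +oo)%E by rewrite leb_open_cell ltry.
  apply: (L2_integrable (measurable_Omega M) (measurable_open_cell K)
    (@open_cell_Omega _ _ _ K) (B := b - a) _ lK mD DN).
  - by rewrite subr_ge0 ltW.
  - exact: measurable_coord_weight.
  - by move=> x; rewrite -(open_cell_slab K i true); exact: coord_weight_bound.
have E : (b - a) * \int[leb n.+1]_(x in open_cell K) Du0 i i x =
    \int[leb n.+1]_(x in open_cell K) (((tnth x i : R) - a) * Du0 i i x) -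
    \int[leb n.+1]_(x in open_cell K) (((tnth x i : R) - b) * Du0 i i x).
  have ia : a <= a <= b by rewrite lexx ltW.
  have ib : a <= b <= b by rewrite lexx ltW.
  have mK := measurable_open_cell K.
  rewrite -(RintegralB mK (iw a ia) (iw b ib)) -(RintegralZl _ mK (grad_integrable K i i)).
  by apply: eq_Rintegral => x _; rewrite -mulrBl; congr (_ * _);
    rewrite opprB [RHS]addrC addrA subrK.
have fE e : flux (fun=> 1) u K i e = sgn R e * (area (face_of K i e) * u i (face_of K i e)).
  rewrite fluxE face_flux1; case: ifPn => // se.
  by rewrite (init.1 i _ se) !mulr0.
rewrite big_bool !fE mul1r mulN1r.
have ban0 : b - a != 0 by rewrite subr_eq0 gt_eqF.
apply: (mulfI ban0); rewrite E mulrDr mulrN -tr1 -tr0.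
by rewrite opprD addrACA subrr add0r.
Qed.

Lemma Rintegral_sum (D : set (Rd R n.+1)) (r : seq 'I_n.+1) (f : 'I_n.+1 -> Rd R n.+1 -> R) :
  measurable D -> (forall i, (leb n.+1).-integrable D (EFin \o f i)) ->
  (leb n.+1).-integrable D (EFin \o (fun x => \sum_(i <- r) f i x)) /\
  \int[leb n.+1]_(x in D) (\sum_(i <- r) f i x) =
    \sum_(i <- r) \int[leb n.+1]_(x in D) f i x.
Proof.
move=> mD fi; elim: r => [|i r [IH1 IH2]].
  rewrite big_nil; split; last first.
    under eq_Rintegral do rewrite big_nil.
    by rewrite Rintegral_cst// mul0r.
  rewrite (_ : EFin \o _ = cst 0%E); first exact: integrable0.
  by apply/funext => x /=; rewrite big_nil.
have -> : (fun x => \sum_(i0 <- i :: r) f i0 x) = (fun x => f i x + \sum_(i0 <- r) f i0 x).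
  by apply/funext => x; rewrite big_cons.
split; first exact: (integrableD mD (fi i) IH1).
by rewrite RintegralD// IH2 big_cons.
Qed.

Lemma initial_divergence_bound K (c : R) :
  (LpN (Omega M) 2%:E (fun x => \sum_(i < n.+1) Du0 i i x)%R <= c%:E)%E ->
  `|divergence u K| <= (vol K)^-1 * (c * Num.sqrt (vol K)).
Proof.
move=> Nc; have vK := vol_gt0 K.
rewrite /divergence /div_mass normrM ger0_norm ?invr_ge0 ?(ltW vK)//.
rewrite ler_pM2l ?invr_gt0//.
under eq_bigr do rewrite cell_flux.
have [_ <-] := Rintegral_sum (index_enum _) (measurable_open_cell K)
  (fun i => grad_integrable K i i).
have mD : measurable_fun (Omega M) (fun x => \sum_(i < n.+1) Du0 i i x).
  by apply: measurable_sum => i; have [_ /(_ i)[[]]] := inH1_inH10 i.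
have := @L2_Rintegral_le _ _ _ (leb n.+1) (Omega M) (open_cell K) (measurable_Omega M)
  (measurable_open_cell K) (@open_cell_Omega _ _ _ K) _ (cst 1) 1 c (vol K) ler01
  (leb_open_cell K) mD Nc (measurable_cst _) (fun x _ => ltac:(by rewrite normr1)).
rewrite mul1r; congr (`|_| <= _); apply: eq_Rintegral => x _.
by rewrite /= mul1r.
Qed.

(** In the trace formula for a slab of width h, the gradient has a weight at most h. So the
value at a face is close to an average over a thin slab, uniformly for a bounded H^1
norm, and this average is continuous for the L2 norm. *)
Lemma face_value_approx i (s : face M i) K (h cf cD : R) (ub : Rd R n.+1 -> R) :
  internal s -> side s true = Some K -> 0 < h <= width M i (K i) ->
  Lp (Omega M) 2%:E ub ->
  (LpN (Omega M) 2%:E (fun x => u0 i x - ub x)%R <= cf%:E)%E ->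
  (LpN (Omega M) 2%:E (Du0 i i) <= cD%:E)%E ->
  let v := h * area s in
  `|u i s - v^-1 * \int[leb n.+1]_(x in slab i (grid M i (s i)) (grid M i (s i) + h) (face_set s))
     ub x| <= v^-1 * (cf * Num.sqrt v + h * (cD * Num.sqrt v)).
Proof.
move=> si sK /andP[h0 hw] [mub ubN] Ncf NcD /=; set v := h * area s.
have v0 : 0 < v by rewrite mulr_gt0// area_gt0.
have [g tr uE] := init.2 i s si.
move/sideP: (sK) => /= es.
set a := grid M i (s i); have aK : a = grid M i (K i).
  by rewrite /a -es face_ofE addn0.
have ab : a < a + h by rewrite ltrDl.
have mS := measurable_face_set s; have lS := leb_face_set s.
have sub : slab i a (a + h) (face_set s) `<=` Omega M.
  move=> x [/andP[x1 x2] xS]; apply: (@open_cell_Omega _ _ _ K).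
  rewrite -(open_cell_slab K i false) es; split=> //; apply/andP; split; first by rewrite -aK.
  apply: lt_le_trans x2 _; rewrite aK addrC -lerBrDr; exact: hw.
have mD := measurable_slab i a (a + h) mS.
have lD : leb n.+1 (slab i a (a + h) (face_set s)) = v%:E.
  by rewrite leb_slab// lS -EFinM addrAC subrr add0r.
have := trace_slab (measurable_Omega M) (inH1_inH10 i) ab mS lS sub
  (or_introl (conj erefl erefl)) tr.
rewrite (_ : a + h - a = h); last by ring.
have -> : \int[leb n]_(y in face_set s) g y = area s * u i s.
  by rewrite uE mulVKf// gt_eqF// area_gt0.
rewrite mulrA -/v => trE.
have [[mf fN] /(_ i)[[mDf DN] _]] := inH1_inH10 i.
have h0' := ltW h0.
have b1 := @L2_Rintegral_le _ _ _ (leb n.+1) _ _ (measurable_Omega M) mD sub _ _ h cD v h0' lD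
  mDf NcD (@measurable_coord_weight i (a + h) _) _.
have {}b1 : `|\int[leb n.+1]_(x in slab i a (a + h) (face_set s))
    (((tnth x i : R) - (a + h)) * Du0 i i x)| <= h * (cD * Num.sqrt v).
  apply: b1 => x xs; have := @coord_weight_bound i a (a + h) (a + h) (face_set s) x _ xs.
  by rewrite lexx ltW// (_ : a + h - a = h); [exact|ring].
have [_ b2] := @L2_Rintegral_perturb _ _ _ (leb n.+1) _ _ (measurable_Omega M) mD sub ub (u0 i)
  (cst 1) 1 cf v ler01 lD mub ubN mf Ncf (measurable_cst _)
  (fun x _ => ltac:(by rewrite normr1)).
have one w : \int[leb n.+1]_(x in slab i a (a + h) (face_set s)) (cst (1 : R) x * w x) =
    \int[leb n.+1]_(x in slab i a (a + h) (face_set s)) w x.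
  by apply: eq_Rintegral => x _; rewrite /= mul1r.
move: b2; rewrite !one mul1r => b2.
have -> : u i s = v^-1 * (v * u i s) by rewrite mulKf// gt_eqF.
rewrite -trE -mulrBr normrM ger0_norm ?invr_ge0 ?(ltW v0)//.
rewrite ler_pM2l ?invr_gt0// addrAC.
by apply: le_trans (ler_normD _ _) _; exact: lerD.
Qed.

End initial_velocity.

(** * Discrete initial densities and norms *)

Section norms.
Variables (R : realType) (n : nat).

Lemma H1N_grad_le (D : set (Rd R n)) (v : 'I_n -> Rd R n -> R)
    (Dv : 'I_n -> 'I_n -> Rd R n -> R) (C : R) i j :
  (H1N D v Dv <= C%:E)%E -> (LpN D 2%:E (Dv i j) <= C%:E)%E.
Proof.
set N := LpN D _ _; rewrite /H1N; set S := (\sum_(k < n) _)%E => SC.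
have N0 : (0 <= N)%E by exact: Lnorm_ge0.
have NS : (N ^+ 2 <= S)%E.
  have s1 : (N ^+ 2 <= \sum_(l < n) LpN D 2%:E (Dv i l) ^+ 2)%E.
    rewrite (bigD1 j)//= leeDl//; apply: sume_ge0 => l _; exact: sqre_ge0.
  have s2 : (\sum_(l < n) LpN D 2%:E (Dv i l) ^+ 2 <=
      LpN D 2%:E (v i) ^+ 2 + \sum_(l < n) LpN D 2%:E (Dv i l) ^+ 2)%E.
    by rewrite leeDr//; exact: sqre_ge0.
  apply: (le_trans s1); apply: (le_trans s2); rewrite /S [leRHS](bigD1 i)//= leeDl//.
  apply: sume_ge0 => k _; apply: adde_ge0; first exact: sqre_ge0.
  by apply: sume_ge0 => l _; exact: sqre_ge0.
have : ((N ^+ 2) `^ 2^-1 <= C%:E)%E.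
  have S0 : (0 <= S)%E by apply: le_trans NS; exact: sqre_ge0.
  have half0 : 0 <= 2^-1 :> R by rewrite invr_ge0.
  by apply: le_trans SC; apply: (gt0_ler_poweR half0) => //;
    rewrite in_itv /= leey andbT ?S0// sqre_ge0.
case: N N0 {NS} => [r| |]// r0; last by rewrite poweRyr// invr_neq0// pnatr_eq0.
rewrite expe2 -EFinM -expr2 poweR_EFin !lee_fin powR12_sqrt ?sqr_ge0// sqrtr_sqr.
by rewrite ger0_norm.
Qed.

Lemma le_scaled_norm (a C : R) (x : \bar R) : 0 < a ->
  ((a^-1)%:E * x <= C%:E)%E -> (x <= (a * C)%:E)%E.
Proof. by move=> a0; rewrite lee_pdivrMl// -EFinM. Qed.

Lemma LpN_infty_ae (D : set (Rd R n)) (h : Rd R n -> R) (C : R) :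
  measurable D -> (0 < leb n D)%E -> (LpN D +oo%E h <= C%:E)%E ->
  {ae leb n, forall x, D x -> `|h x| <= C}.
Proof.
move=> mD D0; rewrite /LpN unlock /= ifT; last first.
  by apply: lt_le_trans D0 _; apply: le_measure; rewrite ?inE.
move=> /ess_sup_inf.ess_supP; apply: filterS => x /= hC Dx.
by move: hC; rewrite patchE mem_set.
Qed.

Lemma LpN_le_sup (D : set (Rd R n)) (h : Rd R n -> R) (q C m : R) :
  measurable D -> measurable_fun D h -> leb n D = m%:E -> 0 < q ->
  (forall x, D x -> `|h x| <= C) -> 0 <= C ->
  (LpN D q%:E h <= (C * m `^ q^-1)%:E)%E.
Proof.
move=> mD mh Dm q0 hC C0; have m0 : 0 <= m by rewrite -lee_fin -Dm.
have qn0 : q != 0 by rewrite gt_eqF.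
have mhD : measurable_fun setT (h \_ D).
  by apply: (measurable_restrict h mD measurableT).1; rewrite setTI.
have le1 : (\int[leb n]_x (`|(EFin \o (h \_ D)) x| `^ q)%E <= (C `^ q * m)%:E)%E.
  have -> : ((C `^ q * m)%:E = \int[leb n]_(x in D) (cst (C `^ q)%:E x))%E.
    by rewrite integral_cst// [X in (_ * X)%E]Dm -EFinM.
  rewrite [leRHS]integral_mkcond; apply: ge0_le_integral => //.
  - by move=> x _; exact: poweR_ge0.
  - apply: (measurableT_comp (measurable_poweR q)); apply: measurableT_comp => //.
    exact/measurable_EFinP.
  - by apply: (measurable_restrict _ mD measurableT).1; exact: measurable_cst.
  - move=> x _ /=; rewrite !patchE; case: ifPn => xD.
      rewrite ?poweR_EFin lee_fin; apply: ge0_ler_powR; rewrite ?nnegrE//; first exact: ltW.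
      by apply: hC; exact: set_mem.
    by rewrite normr0 ?poweR_EFin powR0.
rewrite /LpN unlock /=.
apply: (@le_trans _ _ ((C `^ q * m)%:E `^ q^-1)%E).
  have q10 : 0 <= q^-1 by rewrite invr_ge0 ltW.
  have I0 : (0 <= \int[leb n]_x (`|(EFin \o (h \_ D)) x| `^ q))%E.
    by apply: integral_ge0 => x _; exact: poweR_ge0.
  apply: (gt0_ler_poweR q10) => //; rewrite in_itv /= leey andbT//.
  by rewrite lee_fin mulr_ge0// powR_ge0.
by rewrite poweR_EFin powRM ?powR_ge0// -powRrM divff// powRr1.
Qed.

End norms.

Section initial_data.
Variables (R : realType) (n : nat) (M : mac_mesh R n.+1).
Implicit Types (K L : cell M).

Lemma measurable_piecewise (rho : density M) (D : set (Rd R n.+1)) :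
  measurable_fun D (piecewise rho).
Proof.
apply: measurable_funTS; apply: measurable_sum => K.
apply: measurable_funM; first exact: measurable_cst.
by apply: measurable_indic; exact: measurable_cell_set.
Qed.

Lemma piecewise_sub1 (rho : density M) x : Omega M x ->
  `|piecewise rho x - 1| <= \sum_K `|rho K - 1|.
Proof.
move=> Ox; rewrite -[X in _ - X](@cell_indic_sum R n M x Ox) /piecewise -sumrB.
apply: le_trans (ler_norm_sum _ _ _) _; apply: ler_sum => K _.
rewrite indicE; case: (x \in _); first by rewrite /= mulr1.
by rewrite mulr0 subrr normr0.
Qed.

Lemma initial_density_bound (rho0 : Rd R n.+1 -> R) (rho : density M) (C : R) :
  initial_density rho0 rho -> Lp (Omega M) +oo%E rho0 ->
  (LpN (Omega M) +oo%E (fun x => rho0 x - 1)%R <= C%:E)%E ->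
  forall K, `|rho K - 1| <= C.
Proof.
move=> rhoE [mr _] NC K; rewrite rhoE.
have vK := vol_gt0 K.
have Om0 : (0 < leb n.+1 (Omega M))%E by rewrite leb_Omega lte_fin vol_Omega_gt0.
have ae := LpN_infty_ae (measurable_Omega M) Om0 NC.
have sub : cell_set K `<=` Omega M by move=> x [].
have mK := measurable_cell_set K.
have mh : measurable_fun (cell_set K) (fun x => rho0 x - 1).
  by apply: measurable_funB; [exact: (measurable_funS (measurable_Omega M) sub mr)|exact: measurable_cst].
have C0 : 0 <= C by rewrite -lee_fin; apply: le_trans NC; exact: Lnorm_ge0.
have le1 : (\int[leb n.+1]_(x in cell_set K) `|(rho0 x - 1)%:E| <= (C * vol K)%:E)%E.
  have -> : ((C * vol K)%:E = \int[leb n.+1]_(x in cell_set K) (cst C%:E x))%E.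
    by rewrite integral_cst// [X in (_ * X)%E]leb_cell_set -EFinM.
  apply: ae_ge0_le_integral => //.
  - by apply: measurableT_comp => //; exact/measurable_EFinP.
  - by apply: filterS ae => x h /sub Ox /=; rewrite lee_fin h.
have ih : (leb n.+1).-integrable (cell_set K) (EFin \o (fun x => rho0 x - 1)).
  by apply/integrableP; split; [exact/measurable_EFinP|rewrite (le_lt_trans le1)// ltry].
have i1 : (leb n.+1).-integrable (cell_set K) (EFin \o cst (1 : R)).
  apply/integrableP; split; first by apply/measurable_EFinP; exact: measurable_cst.
  under eq_integral do rewrite /= normr1.
  by rewrite integral_cst// mul1e [X in (X < _)%E]leb_cell_set ltry.
have -> : \int[leb n.+1]_(x in cell_set K) rho0 x =
    \int[leb n.+1]_(x in cell_set K) (rho0 x - 1) + vol K.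
  have -> : vol K = \int[leb n.+1]_(x in cell_set K) cst (1 : R) x.
    by rewrite Rintegral_cst// mul1r [X in fine X]leb_cell_set.
  by rewrite -RintegralD//; apply: eq_Rintegral => x _; rewrite /= subrK.
rewrite mulrDr mulVf ?gt_eqF// addrK normrM ger0_norm ?invr_ge0 ?(ltW vK)//.
rewrite mulrC ler_pdivrMr//.
rewrite -lee_fin EFin_normr_Rintegral//.
by apply: le_trans (le_abse_integral _ _ _) le1 => //; exact/measurable_EFinP.
Qed.

End initial_data.

(** * Well-prepared initial data *)

Section real_sequences.
Variable R : realType.

Lemma cvg_of_approx (a : nat -> R) :
  (forall e, 0 < e -> exists l, \forall m \near \oo, `|a m - l| <= e) ->
  exists l : R, a m @[m --> \oo] --> l.
Proof.
move=> approx; suff : cvgn a by move=> /cvg_ex.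
apply/cauchy_cvgP; apply: cauchy_exP => e e0.
have e2 : 0 < e / 2 by rewrite divr_gt0.
have [l lP] := approx _ e2; exists l; apply: filterS lP => m /= am.
rewrite /ball /= distrC; apply: le_lt_trans am _.
by rewrite ltr_pdivrMr// ltr_pMr// ltr1n.
Qed.

Lemma seq_cvg0_bounded (a : nat -> R) : (forall m, 0 < a m) ->
  a m @[m --> \oo] --> (0 : R) -> exists2 B, 0 < B & forall m, a m <= B.
Proof.
move=> a0 ac; have [N _ aN] : \forall m \near \oo, a m < 1 by exact: (cvgr_lt 0 ac).
exists (1 + \sum_(k < N) a k) => [|m].
  by rewrite ltr_wpDr// sumr_ge0// => k _; exact: ltW.
have [mN|Nm] := ltnP m N; last first.
  by rewrite (le_trans (ltW (aN m Nm)))// lerDl sumr_ge0// => k _; exact: ltW.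
rewrite (bigD1 (Ordinal mN))//= addrCA lerDl addr_ge0// sumr_ge0// => k _.
exact: ltW.
Qed.

(** By comparison with an integer exponent larger than gamma. *)
Lemma powR_sub1_le (gamma B : R) : 1 <= gamma -> 1 <= B ->
  exists2 C, 0 <= C & forall x, 0 < x <= B -> `|x `^ gamma - 1| <= C * `|x - 1|.
Proof.
move=> g1 B1; pose N := (Num.truncn gamma).+1.
have gN : gamma <= N%:R by rewrite ltW// truncnS_gt.
have C0 : 0 <= N%:R * B ^+ N by rewrite mulr_ge0// exprn_ge0// (le_trans ler01).
exists (N%:R * B ^+ N) => // x /andP[x0 xB].
have x0' := ltW x0.
have sum_le : `|x ^+ N - 1| <= N%:R * B ^+ N * `|x - 1|.
  rewrite subrX1 normrM mulrC ler_wpM2r//.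
  apply: le_trans (ler_norm_sum _ _ _) _.
  have -> : N%:R * B ^+ N = \sum_(k < N) B ^+ N by rewrite sumr_const card_ord mulr_natl.
  apply: ler_sum => k _; rewrite ger0_norm ?exprn_ge0//.
  apply: (@le_trans _ _ (B ^+ k)); first by rewrite lerXn2r// nnegrE (le_trans ler01).
  by apply: ler_weXn2l => //; exact: ltnW.
apply: le_trans sum_le; rewrite -powR_mulrn//.
have [x1|x1] := leP 1 x.
  have g_ge : 1 <= x `^ gamma.
    by rewrite -(powRr0 x) ler_powR// (le_trans ler01).
  have gN' : x `^ gamma <= x `^ N%:R by rewrite ler_powR.
  rewrite !ger0_norm ?subr_ge0 ?lerD2r//; exact: le_trans gN'.
have g_le : x `^ gamma <= 1.
  have := @ge0_ler_powR R gamma (le_trans ler01 g1) x 1.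
  by rewrite !nnegrE x0' ler01 powR1 => /(_ isT isT (ltW x1)).
have gN' : x `^ N%:R <= x `^ gamma by apply: ger_powR => //; rewrite x0 ltW.
rewrite !ler0_norm ?subr_le0//; last exact: le_trans g_le.
by rewrite !opprB lerD2l lerN2.
Qed.

End real_sequences.

Section well_prepared_data.
Variables (R : realType) (n : nat) (M : mac_mesh R n.+1).
Variables (rho0 : R -> Rd R n.+1 -> R) (u0 : R -> 'I_n.+1 -> Rd R n.+1 -> R)
  (Du0 : R -> 'I_n.+1 -> 'I_n.+1 -> Rd R n.+1 -> R) (ubar0 : 'I_n.+1 -> Rd R n.+1 -> R).
Hypothesis prep : well_prepared M rho0 u0 Du0 ubar0.
Variable eps : nat -> R.
Hypotheses (eps_gt0 : forall m, 0 < eps m) (eps0 : eps m @[m --> \oo] --> (0 : R)).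

Lemma well_prepared_bounds : exists2 C, 0 <= C & forall e, 0 < e ->
  [/\ forall i j, (LpN (Omega M) 2%:E (Du0 e i j) <= C%:E)%E,
      (LpN (Omega M) 2%:E (fun x => \sum_(i < n.+1) Du0 e i i x)%R <= (e * C)%:E)%E &
      (LpN (Omega M) +oo (fun x => rho0 e x - 1)%R <= (e ^+ 2 * C)%:E)%E].
Proof.
have [_ [C bound] _] := prep.
have Lp0 k p (D : set (Rd R k)) (h : Rd R k -> R) : (0 <= LpN D p h)%E by exact: Lnorm_ge0.
have parts e : 0 < e -> [/\ (H1N (Omega M) (u0 e) (Du0 e) <= C%:E)%E,
    ((e^-1)%:E * LpN (Omega M) 2%:E (fun x => \sum_(i < n.+1) Du0 e i i x)%R <= C%:E)%E &
    (((e ^+ 2)^-1)%:E * LpN (Omega M) +oo (fun x => rho0 e x - 1)%R <= C%:E)%E].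
  move=> e0; have := bound e e0.
  have h1 : (0 <= H1N (Omega M) (u0 e) (Du0 e))%E by exact: poweR_ge0.
  have h2 : (0 <= (e^-1)%:E * LpN (Omega M) 2%:E (fun x => \sum_(i < n.+1) Du0 e i i x)%R)%E.
    by rewrite mule_ge0// lee_fin invr_ge0 ltW.
  have h3 : (0 <= ((e ^+ 2)^-1)%:E * LpN (Omega M) +oo (fun x => rho0 e x - 1)%R)%E.
    by rewrite mule_ge0// lee_fin invr_ge0 sqr_ge0.
  move=> le; split; apply: le_trans le.
  - by rewrite -addeA leeDl// adde_ge0.
  - by rewrite addeAC leeDr// adde_ge0.
  - by rewrite leeDr// adde_ge0.
have C0 : 0 <= C.
  have [p _ _] := parts 1 ltr01; rewrite -lee_fin; apply: le_trans p; exact: poweR_ge0.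
exists C => // e e0; have [p1 p2 p3] := parts e e0; split.
- by move=> i j; exact: H1N_grad_le p1.
- exact: le_scaled_norm p2.
- by apply: le_scaled_norm p3; rewrite exprn_gt0.
Qed.

Lemma initial_density_eps2 : exists2 C, 0 <= C & forall e (rho : density M), 0 < e ->
  initial_density (rho0 e) rho -> forall K, `|rho K - 1| <= e ^+ 2 * C.
Proof.
have [C C0 bound] := well_prepared_bounds; exists C => // e rho e0 init.
have [_ _ b3] := bound e e0; have [/(_ e e0)[_ Lrho _] _ _] := prep.
exact: initial_density_bound init Lrho b3.
Qed.

Section initial_velocities.
Variable u : nat -> velocity M.
Arguments u : clear implicits.
Hypothesis init : forall m, initial_velocity (u0 (eps m)) (Du0 (eps m)) (u m).

Lemma eps_at_right : eps m @[m --> \oo] --> 0^'+.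
Proof.
move=> P [e /= e0 eP]; have : \forall m \near \oo, `|eps m| < e.
  by move/cvgr0Pnorm_lt : eps0; exact.
apply: filterS => m em; apply: eP => //=.
by rewrite sub0r normrN.
Qed.

(** Means on a face are uniformly close to averages over thin slabs, by the bound in H^1,
and these averages converge, by the convergence in L2. *)
Lemma initial_face_value_cvg i (s : face M i) : internal s ->
  exists l : R, u m i s @[m --> \oo] --> l.
Proof.
move=> si; apply: cvg_of_approx => e e0.
have [C C0 bound] := well_prepared_bounds.
move/internalP: (si) => [_ [K [_ sK]]].
have A0 := area_gt0 s; set A := area s in A0.
have wK : 0 < width M i (K i) by rewrite width_gt0.
(* h is chosen so that C * sqrt (h * A) <= e * A / 2 *)
pose r := e * A / 2 / (C + 1).
have C1 : 0 < C + 1 by rewrite ltr_wpDl.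
have r0 : 0 < r by rewrite divr_gt0// divr_gt0// mulr_gt0.
pose h := Num.min (width M i (K i)) (r ^+ 2 / A).
have h0 : 0 < h by rewrite lt_min wK divr_gt0// exprn_gt0.
have hA : h * A <= r ^+ 2 by rewrite -ler_pdivlMr// ge_min lexx orbT.
have hw : 0 < h <= width M i (K i) by rewrite h0 ge_min lexx.
have v0 : 0 < h * A by rewrite mulr_gt0.
have sv0 : 0 < Num.sqrt (h * A) by rewrite sqrtr_gt0.
have sv : Num.sqrt (h * A) <= r by rewrite -(ger0_norm (ltW r0)) -sqrtr_sqr ler_wsqrtr.
pose eta := e / 2 * Num.sqrt (h * A).
have eta0 : 0 < eta by rewrite mulr_gt0// divr_gt0.
exists ((h * A)^-1 * \int[leb n.+1]_(x in slab i (grid M i (s i)) (grid M i (s i) + h) (face_set s))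
  ubar0 i x).
have [H10 _ /(_ i)[Lub ucvg]] := prep.
have : \forall m \near \oo,
    (LpN (Omega M) 2%:E (fun x => u0 (eps m) i x - ubar0 i x)%R <= eta%:E)%E.
  apply: cvge0_near_le => //; last by move=> m; exact: Lnorm_ge0.
  exact: (cvg_comp _ _ eps_at_right ucvg).
apply: filterS => m um; have [bD _ _] := bound (eps m) (eps_gt0 m).
have [_ _ HH] := H10 (eps m) (eps_gt0 m).
have := @face_value_approx R n M (u0 (eps m)) (Du0 (eps m)) HH (u m) (init m) i s K h eta C
  (ubar0 i) si sK hw Lub um (bD i i).
rewrite -/A => /le_trans; apply.
set S := Num.sqrt (h * A) in sv0 sv eta eta0 um *.
have sq : S * S = h * A by rewrite -expr2 sqr_sqrtr// ltW.
have -> : (h * A)^-1 * (eta * S + h * (C * S)) = e / 2 + C * S / A.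
  rewrite mulrDr /eta -(mulrA (e / 2)) sq mulrCA mulVf ?mulr1 ?gt_eqF//; congr (_ + _).
  by field; rewrite !gt_eqF.
have CS : C * S <= (C + 1) * r.
  by apply: ler_pM => //; [exact: ltW|rewrite lerDl].
have -> : e = e / 2 + (C + 1) * r / A.
  by rewrite /r; field; rewrite !gt_eqF.
rewrite {1}(_ : e / 2 + (C + 1) * r / A = e); last first.
  by rewrite /r; field; rewrite !gt_eqF.
by rewrite lerD2l ler_pM2r// invr_gt0.
Qed.

Lemma initial_velocity_cvg : exists ulim0 : velocity M,
  (forall i (s : face M i), u m i s @[m --> \oo] --> ulim0 i s) /\
  (forall K, divergence ulim0 K = 0).
Proof.
have ex (e : {i : 'I_n.+1 & face M i}) : exists l : R,
    u m (tag e) (tagged e) @[m --> \oo] --> l.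
  case: e => i s /=; have [si|se] := boolP (internal s).
    exact: initial_face_value_cvg.
  by exists 0; under eq_fun do rewrite (init _).1//; exact: cvg_cst.
have [l lP] := boolp.choice ex.
pose ulim0 : velocity M := fun i s => l (existT _ i s).
have uu i (s : face M i) : u m i s @[m --> \oo] --> ulim0 i s := lP (existT _ i s).
exists ulim0; split => // K.
have d1 : divergence (u m) K @[m --> \oo] --> divergence ulim0 K.
  by apply: (@div_mass_cvg _ _ _ (fun=> fun=> 1)) => // L; exact: cvg_cst.
have [C C0 bound] := well_prepared_bounds.
have [H10 _ _] := prep.
have d0 : divergence (u m) K @[m --> \oo] --> (0 : R).
  pose c := (vol K)^-1 * (C * Num.sqrt (vol K)).
  apply: norm_cvg0; apply: (@squeeze_cvgr _ _ _ _ (fun=> 0) (fun m => c * eps m)).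
  - near=> m; rewrite normr_ge0 /=.
    have [_ b2 _] := bound (eps m) (eps_gt0 m).
    have [_ _ HH] := H10 (eps m) (eps_gt0 m).
    apply: le_trans (initial_divergence_bound HH (init m) K b2) _.
    by rewrite /c le_eqVlt; apply/orP; left; apply/eqP; ring.
  - exact: cvg_cst.
  - by rewrite -[X in _ --> X](mulr0 c); apply: cvgM; [exact: cvg_cst|exact: eps0].
exact: (cvg_unique _ d1 d0).
Unshelve. all: by end_near.
Qed.

End initial_velocities.
End well_prepared_data.

(** * Low Mach number limit *)

Section low_mach.
Variables (R : realType) (n : nat) (M : mac_mesh R n.+1).

(** The pressure law is Lipschitz at 1, so that the pressure and its mean are both at
distance O(eps^2) of 1. *)
Lemma scaled_pressure_bound (gamma C E : R) : 1 <= gamma -> 0 <= C -> 0 < E ->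
  exists B, forall (eps : R) (rho : density M), 0 < eps <= E ->
    (forall K, 0 < rho K) -> (forall K, `|rho K - 1| <= eps ^+ 2 * C) ->
    forall K, `|scaled_pressure gamma eps rho K| <= B.
Proof.
move=> g1 C0 E0; pose b := 1 + E ^+ 2 * C.
have b1 : 1 <= b by rewrite lerDl mulr_ge0// sqr_ge0.
have [L L0 lip] := powR_sub1_le g1 b1.
exists (2 * (L * C)) => eps rho /andP[e0 eE] r0 rC K.
have e2 : 0 < eps ^+ 2 by rewrite exprn_gt0.
have p1 X : `|pressure gamma rho X - 1| <= eps ^+ 2 * (L * C).
  apply: le_trans (lip _ _) _.
    rewrite r0 /= -lerBlDl (le_trans (ler_norm _))// (le_trans (rC X))//.
    by rewrite ler_wpM2r// lerXn2r// nnegrE ltW.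
  by rewrite mulrCA ler_wpM2l.
have V0 := vol_Omega_gt0 M.
set mean := (vol_Omega M)^-1 * \sum_(X : cell M) vol X * pressure gamma rho X.
have mean1 : `|mean - 1| <= eps ^+ 2 * (L * C).
  have -> : mean - 1 = (vol_Omega M)^-1 * \sum_(X : cell M) vol X * (pressure gamma rho X - 1).
    rewrite -[X in _ - X](@mulVf _ (vol_Omega M)) ?gt_eqF// -[X in _ - _ * X]sum_vol.
    rewrite /mean -mulrBr -sumrB; congr (_ * _); apply: eq_bigr => X _.
    by rewrite mulrBr mulr1.
  rewrite normrM ger0_norm ?invr_ge0 ?(ltW V0)// ler_pdivrMl//.
  apply: le_trans (ler_norm_sum _ _ _) _; rewrite -sum_vol mulr_suml.
  apply: ler_sum => X _; rewrite normrM ger0_norm ?(ltW (vol_gt0 X))//.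
  by rewrite ler_pM2l ?vol_gt0.
rewrite /scaled_pressure -/mean normrM ger0_norm ?invr_ge0 ?sqr_ge0//.
rewrite ler_pdivrMl//.
have -> : pressure gamma rho K - mean = (pressure gamma rho K - 1) - (mean - 1) by ring.
apply: le_trans (ler_normB _ _) _.
have -> : eps ^+ 2 * (2 * (L * C)) = eps ^+ 2 * (L * C) + eps ^+ 2 * (L * C) by ring.
exact: lerD.
Qed.

Lemma LpN_piecewise_le (rho : density M) (q : R) : 1 <= q ->
  (LpN (Omega M) q%:E (fun x => piecewise rho x - 1)%R <=
    ((\sum_K `|rho K - 1|) * vol_Omega M `^ q^-1)%:E)%E.
Proof.
move=> q1; apply: LpN_le_sup.
- exact: measurable_Omega.
- by apply: measurable_funB; [exact: measurable_piecewise|exact: measurable_cst].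
- exact: leb_Omega.
- exact: lt_le_trans q1.
- by move=> x; exact: piecewise_sub1.
- exact: sumr_ge0.
Qed.

Lemma low_mach_limit (gamma mu dt : R) (hgamma : 1 <= gamma) (hmu : 0 < mu)
  (hdt : 0 < dt) (divtau : velocity M -> velocity M)
  (hlin : linear_diffusion divtau) (hcoer : coercive_diffusion mu divtau)
  (rho0 : R -> Rd R n.+1 -> R) (u0 : R -> 'I_n.+1 -> Rd R n.+1 -> R)
  (Du0 : R -> 'I_n.+1 -> 'I_n.+1 -> Rd R n.+1 -> R) (ubar0 : 'I_n.+1 -> Rd R n.+1 -> R)
  (hprep : well_prepared M rho0 u0 Du0 ubar0)
  (eps : nat -> R) (heps : forall m, 0 < eps m)
  (heps0 : eps m @[m --> \oo] --> (0 : R)) (N : nat)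
  (rho : nat -> nat -> density M) (u : nat -> nat -> velocity M)
  (hsol : forall m, compressible_solution gamma divtau dt N
     (eps m) (rho0 (eps m)) (u0 (eps m)) (Du0 (eps m)) (rho m) (u m)) :
  let dp := fun m k => scaled_pressure gamma (eps m) (rho m k) in
  (forall q : R, 1 <= q ->
     \big[Order.max/0%E]_(k < N.+1)
       LpN (Omega M) q%:E (fun x => piecewise (rho m k) x - 1)
     @[m --> \oo] --> 0%E) /\
  (exists ulim0 : velocity M,
    [/\ forall i (s : face M i), u m 0%N i s @[m --> \oo] --> ulim0 i s,
        forall phi : nat -> nat, increasing_seq phi ->
          exists psi : nat -> nat, increasing_seq psi /\
          exists dplim0 : density M,
            forall K, dp (phi (psi m)) 0%N K @[m --> \oo] --> dplim0 K &
        forall (phi : nat -> nat) (dplim0 : density M), increasing_seq phi ->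
          (forall K, dp (phi m) 0%N K @[m --> \oo] --> dplim0 K) ->
          exists (ulim : nat -> velocity M) (dplim : nat -> density M),
          [/\ incompressible_solution divtau dt N ulim dplim,
              ulim 0%N = ulim0 /\ dplim 0%N = dplim0,
              forall k, (k <= N)%N ->
                (forall i (s : face M i),
                   u (phi m) k i s @[m --> \oo] --> ulim k i s) /\
                (forall K, dp (phi m) k K @[m --> \oo] --> dplim k K) &
              forall (v : nat -> velocity M) (r : nat -> density M),
                incompressible_solution divtau dt N v r ->
                v 0%N = ulim0 -> r 0%N = dplim0 ->
                forall k, (k <= N)%N ->
                  (forall i (s : face M i), v k i s = ulim k i s) /\
                  (forall K, r k K = dplim k K)]]).
Proof.
move=> dp.
have init m : [/\ initial_density (rho0 (eps m)) (rho m 0%N),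
    initial_velocity (u0 (eps m)) (Du0 (eps m)) (u m 0%N) & forall K, 0 < rho m 0%N K].
  have [rhom1 [ut [[i1 i2 _] pos _ _]]] := hsol m.
  by split => //; have [_] := pos 0%N (leq0n N).
have [C C0 rhoC] := initial_density_eps2 hprep.
have rho_eps m K : `|rho m 0%N K - 1| <= eps m ^+ 2 * C.
  by have [i1 _ _] := init m; exact: rhoC (heps m) i1 K.
have rho_cvg0 K : rho m 0%N K @[m --> \oo] --> (1 : R).
  have d0 : rho m 0%N K - 1 @[m --> \oo] --> (0 : R).
    apply: norm_cvg0; apply: (@squeeze_cvgr _ _ _ _ (fun=> 0) (fun m => C * eps m ^+ 2)).
    - by near=> m; rewrite normr_ge0 /= mulrC.
    - exact: cvg_cst.
    - exact: eps2_cvg0.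
  have -> : (fun m => rho m 0%N K) = (fun m => (rho m 0%N K - 1) + 1).
    by apply/funext => m; rewrite subrK.
  by rewrite -[X in _ --> X]add0r; apply: cvgD; [exact: d0|exact: cvg_cst].
have [ulim0 [uu divu]] := initial_velocity_cvg hprep heps heps0
  (u := fun m => u m 0%N) (fun m => let: And3 _ i2 _ := init m in i2).
have [E E0 epsE] := seq_cvg0_bounded heps heps0.
have [B dpB] := scaled_pressure_bound hgamma C0 E0.
have dp_bounded m K : `|dp m 0%N K| <= B.
  have [_ _ pos] := init m; apply: (dpB (eps m) (rho m 0%N) _ pos (rho_eps m)).
  by rewrite heps epsE.
have compact_dp (phi : nat -> nat) : increasing_seq phi ->
    exists psi : nat -> nat, increasing_seq psi /\ exists dplim0 : density M,
      forall K, dp (phi (psi m)) 0%N K @[m --> \oo] --> dplim0 K.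
  move=> _; exact: (finite_bolzano_weierstrass (a := fun m K => dp (phi m) 0%N K)
    (fun m K => dp_bounded (phi m) K)).
have conv (phi : nat -> nat) (dplim0 : density M) : increasing_seq phi ->
    (forall K, dp (phi m) 0%N K @[m --> \oo] --> dplim0 K) ->
    exists (ulim : nat -> velocity M) (dplim : nat -> density M),
    [/\ incompressible_solution divtau dt N ulim dplim,
        ulim 0%N = ulim0 /\ dplim 0%N = dplim0 &
        forall k, (k <= N)%N ->
        [/\ forall K, rho (phi m) k K @[m --> \oo] --> (1 : R),
            forall i (s : face M i), u (phi m) k i s @[m --> \oo] --> ulim k i s &
            forall K, dp (phi m) k K @[m --> \oo] --> dplim k K]].
  move=> phi_i dpc.
  apply: (@scheme_cvg R n.+1 M gamma mu dt divtau N hgamma hmu hdt hlin hcoer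
    (fun m => eps (phi m)) (fun m => heps (phi m)) (cvg_subseq phi_i heps0)
    rho0 u0 Du0 (fun m => rho (phi m)) (fun m => u (phi m)) ulim0 dplim0) => //.
  - by move=> K; exact: (cvg_subseq phi_i (rho_cvg0 K)).
  - by move=> i s; exact: (cvg_subseq phi_i (uu i s)).
split; last first.
  exists ulim0; split => //.
  move=> phi dplim0 phi_i dpc.
  have [ulim [dplim [sol [ul dl] lims]]] := conv phi dplim0 phi_i dpc.
  exists ulim, dplim; split => //; first by move=> k /lims[].
  move=> v r vr v0 r0 k kN.
  have [|||-> ->] // := incompressible_unique hmu hdt hlin hcoer vr sol _ _ _ kN.
  - by rewrite v0 ul.
  - by rewrite r0 dl.
  - by rewrite v0.
move=> q q1.
have rho1 k K : (k <= N)%N -> rho m k K @[m --> \oo] --> (1 : R).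
  move=> kN; apply: cvg_subsubseq => phi phi_i.
  have [psi [psi_i [dplim0 dpc]]] := compact_dp phi phi_i.
  have [ulim [dplim [_ _ lims]]] := conv (phi \o psi) dplim0
    (increasing_seq_comp phi_i psi_i) dpc.
  by have [r1 _ _] := lims k kN; exists psi => //; exact: r1.
pose c := vol_Omega M `^ q^-1.
have c0 : 0 <= c by exact: powR_ge0.
pose bound m := \sum_(k < N.+1) (\sum_K `|rho m k K - 1|) * c.
have bound0 : bound m @[m --> \oo] --> (0 : R).
  rewrite [X in _ --> X](_ : 0 = \sum_(k < N.+1) (\sum_(K : cell M) 0) * c :> R).
    apply: cvg_sumr => k _; apply: cvgM; last exact: cvg_cst.
    apply: cvg_sumr => K _; rewrite -[X in _ --> X](@normr0 _ R) -[X in `|X|](subrr (1 : R)).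
    apply: cvg_norm; apply: cvgB; last exact: cvg_cst.
    by apply: rho1; rewrite -ltnS.
  by rewrite big1// => k _; rewrite big1// mul0r.
apply: (@squeeze_cvge _ _ _ _ (fun=> 0%E) _ (fun m => (bound m)%:E)).
- near=> m; apply/andP; split; first exact: bigmax_ge_id.
  have term_ge0 k : 0 <= (\sum_K `|rho m k K - 1|) * c by rewrite mulr_ge0// sumr_ge0.
  apply: bigmax_le => [|k _]; first by rewrite lee_fin sumr_ge0.
  apply: le_trans (LpN_piecewise_le _ q1) _; rewrite lee_fin -/c.
  by rewrite /bound (bigD1 k)//= lerDl sumr_ge0.
- exact: cvg_cst.
- apply: cvg_EFin; last exact: bound0.
  by near=> m.
Unshelve. all: by end_near.
Qed.

End low_mach.

Theorem theorem3p3 (R : realType) (d : nat) (hd : d = 2%N \/ d = 3%N)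
  (M : mac_mesh R d) (T gamma mu lambda dt : R)
  (hT : 0 < T) (hgamma : 1 <= gamma) (hmu : 0 < mu) (hlambda : 0 < mu + lambda)
  (hdt : 0 < dt)
  (divtau : velocity M -> velocity M)
  (hlin : linear_diffusion divtau) (hcoer : coercive_diffusion mu divtau)
  (rho0 : R -> Rd R d -> R) (u0 : R -> 'I_d -> Rd R d -> R)
  (Du0 : R -> 'I_d -> 'I_d -> Rd R d -> R) (ubar0 : 'I_d -> Rd R d -> R)
  (hprep : well_prepared M rho0 u0 Du0 ubar0)
  (eps : nat -> R) (heps : forall m, 0 < eps m)
  (heps0 : eps m @[m --> \oo] --> (0 : R))
  (rho : nat -> nat -> density M) (u : nat -> nat -> velocity M)
  (hsol : forall m, compressible_solution gamma divtau dt (Num.truncn (T / dt))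
     (eps m) (rho0 (eps m)) (u0 (eps m)) (Du0 (eps m)) (rho m) (u m)) :
  let N := Num.truncn (T / dt) in
  let dp := fun m n => scaled_pressure gamma (eps m) (rho m n) in
  (forall q : R, 1 <= q -> q <= Num.min gamma 2 ->
     \big[Order.max/0%E]_(n < N.+1)
       LpN (Omega M) q%:E (fun x => piecewise (rho m n) x - 1)
     @[m --> \oo] --> 0%E) /\
  (exists ulim0 : velocity M,
    [/\ forall i (s : face M i), u m 0%N i s @[m --> \oo] --> ulim0 i s,
        forall phi : nat -> nat, increasing_seq phi ->
          exists psi : nat -> nat, increasing_seq psi /\
          exists dplim0 : density M,
            forall K, dp (phi (psi m)) 0%N K @[m --> \oo] --> dplim0 K &
        forall (phi : nat -> nat) (dplim0 : density M), increasing_seq phi ->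
          (forall K, dp (phi m) 0%N K @[m --> \oo] --> dplim0 K) ->
          exists (ulim : nat -> velocity M) (dplim : nat -> density M),
          [/\ incompressible_solution divtau dt N ulim dplim,
              ulim 0%N = ulim0 /\ dplim 0%N = dplim0,
              forall n, (n <= N)%N ->
                (forall i (s : face M i),
                   u (phi m) n i s @[m --> \oo] --> ulim n i s) /\
                (forall K, dp (phi m) n K @[m --> \oo] --> dplim n K) &
              forall (v : nat -> velocity M) (r : nat -> density M),
                incompressible_solution divtau dt N v r ->
                v 0%N = ulim0 -> r 0%N = dplim0 ->
                forall n, (n <= N)%N ->
                  (forall i (s : face M i), v n i s = ulim n i s) /\
                  (forall K, r n K = dplim n K)]]).
Proof.
move=> N dp; have [n dn] : exists n, d = n.+1 by case: hd => ->; [exists 1%N|exists 2%N].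
subst d.
have [cvg_rho cvg_u] := low_mach_limit hgamma hmu hdt hlin hcoer hprep heps heps0 hsol.
by split => // q q1 _; exact: cvg_rho.
Qed.
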